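(* Let $G$ be a countable group with a non-elementary action by isometries on a geodesic hyperbolic metric space $X$, such that at least one element of $G$ is WPD for this action. Let $\mu$ be a generating probability measure on $G$ with finite entropy. Let $\partial X$ be the hyperbolic (Gromov) boundary of $X$, and let $\nu$ be the hitting measure on $\partial X$ of the random walk driven by $\mu$. Then $(\partial X,\nu)$ is the Poisson boundary of $(G,\mu)$.
   Context: An element $g$ is loxodromic if $\lim_{n\to\infty} d(g^n o,o)/n>0$ for a (any) base point $o\in X$. The action (or a semigroup of isometries) is non-elementary if it contains two loxodromic elements with disjoint fixed point sets in $\partial X$. For $K>0$ and $x,y\in X$, $\mathrm{Stab}_K(x,y)=\{g\in G: d(x,gx)\le K,\ d(y,gy)\le K\}$. An element $g\in G$ is WPD if it is loxodromic and for any $x\in X$ and any $K\ge0$ there exists $P\ge1$ such that $\mathrm{Stab}_K(x,g^Px)$ is finite. A measure $\mu$ is generating if the semigroup generated by its support is $G$; finite entropy means $-\sum_g\mu(g)\log\mu(g)<\infty$. The random walk is $w_n=g_1\cdots g_n$ with $g_i$ i.i.d. of law $\mu$; for $o\in X$, $w_no$ converges almost surely to a point of $\partial X$, and $\nu(A)=\mathbb{P}(\lim_n w_no\in A)$. The Poisson boundary of $(G,\mu)$ is the maximal $\mu$-boundary (space of ergodic components of the shift-tail equivalence relation on sample paths with the image of the path measure); the claim is that $(\partial X,\nu)$ with the limit-point map is isomorphic to it as a measure $G$-space. *)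

(* Defs.v *)
From HB Require Import structures.
From mathcomp Require Import all_boot all_order all_algebra.
From mathcomp Require Import all_classical all_reals all_analysis.
Set Implicit Arguments. Unset Strict Implicit. Unset Printing Implicit Defensive.
Import Order.TTheory GRing.Theory Num.Theory.
Import numFieldNormedType.Exports.
Local Open Scope classical_set_scope.
Local Open Scope ring_scope.

Definition is_metric (R : realType) (X : Type) (d : X -> X -> R) : Prop :=
  (forall x y, d x y = 0 <-> x = y) /\
  (forall x y, d x y = d y x) /\
  (forall x y z, d x z <= d x y + d y z).

Definition geodesic_space (R : realType) (X : Type) (d : X -> X -> R) : Prop :=
  forall x y : X, exists gam : R -> X,
    gam 0 = x /\ gam (d x y) = y /\
    forall s t, 0 <= s <= d x y -> 0 <= t <= d x y ->
      d (gam s) (gam t) = `|s - t|.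

Definition gprod (R : realType) (X : Type) (d : X -> X -> R) (w x y : X) : R :=
  (d x w + d y w - d x y) / 2.

Definition hyperbolic (R : realType) (X : Type) (d : X -> X -> R) : Prop :=
  exists delta : R, 0 <= delta /\
    forall w x y z : X,
      Num.min (gprod d w x z) (gprod d w y z) - delta <= gprod d w x y.

Definition conv_infty (R : realType) (X : Type) (d : X -> X -> R) (o : X)
  (x : nat -> X) : Prop :=
  forall M : R, exists N : nat, forall n m : nat, (N <= n)%N -> (N <= m)%N ->
    M <= gprod d o (x n) (x m).

Definition seq_equiv (R : realType) (X : Type) (d : X -> X -> R) (o : X)
  (x y : nat -> X) : Prop :=
  forall M : R, exists N : nat, forall n m : nat, (N <= n)%N -> (N <= m)%N ->
    M <= gprod d o (x n) (y m).

(* points of the Gromov boundary = equivalence classes of sequences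
   converging at infinity, represented as sets of sequences *)
Definition bpoint (R : realType) (X : Type) (d : X -> X -> R) (o : X)
  (xi : set (nat -> X)) : Prop :=
  (exists x, xi x) /\
  (forall x, xi x -> conv_infty d o x) /\
  (forall x, xi x -> forall y, xi y <-> (conv_infty d o y /\ seq_equiv d o x y)).

Definition bnbhd (R : realType) (X : Type) (d : X -> X -> R) (o : X)
  (xi : set (nat -> X)) (r : R) : set (set (nat -> X)) :=
  [set eta | bpoint d o eta /\
     exists x y, xi x /\ eta y /\
       exists N : nat, forall n m : nat, (N <= n)%N -> (N <= m)%N ->
         r < gprod d o (x n) (y m)].

Definition bopen (R : realType) (X : Type) (d : X -> X -> R) (o : X)
  (U : set (set (nat -> X))) : Prop :=
  U `<=` bpoint d o /\
  forall xi, U xi -> exists r : R, bnbhd d o xi r `<=` U.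

Definition bborel (R : realType) (X : Type) (d : X -> X -> R) (o : X) :
  set (set (set (nat -> X))) :=
  smallest (sigma_algebra (bpoint d o)) [set U | bopen d o U].

Definition is_group (G : Type) (mul : G -> G -> G) (one : G) (inv : G -> G)
  : Prop :=
  (forall a b c, mul a (mul b c) = mul (mul a b) c) /\
  (forall a, mul one a = a) /\ (forall a, mul a one = a) /\
  (forall a, mul (inv a) a = one) /\ (forall a, mul a (inv a) = one).

Definition isom_action (R : realType) (G X : Type) (mul : G -> G -> G)
  (one : G) (d : X -> X -> R) (act : G -> X -> X) : Prop :=
  (forall x, act one x = x) /\
  (forall g h x, act (mul g h) x = act g (act h x)) /\
  (forall g x y, d (act g x) (act g y) = d x y).

Definition gpow (G : Type) (mul : G -> G -> G) (one : G) (g : G) (n : nat) : G :=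
  iter n (mul g) one.

Definition loxodromic (R : realType) (G X : Type) (mul : G -> G -> G)
  (one : G) (d : X -> X -> R) (act : G -> X -> X) (g : G) : Prop :=
  exists (o : X) (l : R), 0 < l /\
    (fun n : nat => d (act (gpow mul one g n) o) o / n%:R) @ \oo --> l.

Definition bact (G X : Type) (act : G -> X -> X) (g : G)
  (xi : set (nat -> X)) : set (nat -> X) :=
  [set y | exists x, xi x /\ y = (fun n => act g (x n))].

Definition bfix (R : realType) (G X : Type) (d : X -> X -> R) (o : X)
  (act : G -> X -> X) (g : G) : set (set (nat -> X)) :=
  [set xi | bpoint d o xi /\ bact act g xi = xi].

Definition non_elementary (R : realType) (G X : Type) (mul : G -> G -> G)
  (one : G) (d : X -> X -> R) (o : X) (act : G -> X -> X) : Prop :=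
  exists g h : G, loxodromic mul one d act g /\ loxodromic mul one d act h /\
    bfix d o act g `&` bfix d o act h = set0.

Definition StabK (R : realType) (G X : Type) (d : X -> X -> R)
  (act : G -> X -> X) (K : R) (x y : X) : set G :=
  [set g | d x (act g x) <= K /\ d y (act g y) <= K].

Definition WPD (R : realType) (G X : Type) (mul : G -> G -> G) (one : G)
  (d : X -> X -> R) (act : G -> X -> X) (g : G) : Prop :=
  loxodromic mul one d act g /\
  forall (x : X) (K : R), 0 <= K ->
    exists P : nat, (1 <= P)%N /\
      finite_set (StabK d act K x (act (gpow mul one g P) x)).

Definition prob_on (R : realType) (G : choiceType) (mu : G -> R) : Prop :=
  (forall g, 0 <= mu g) /\ (\esum_(g in [set: G]) (mu g)%:E = 1)%E.

Definition generating (R : realType) (G : Type) (mul : G -> G -> G) (one : G)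
  (mu : G -> R) : Prop :=
  forall g : G, exists s : seq G, s <> [::] /\
    all (fun a => 0 < mu a) s /\ foldr mul one s = g.

(* finite entropy (with the convention 0 log 0 = 0; here ln 0 = 0) *)
Definition finite_entropy (R : realType) (G : choiceType) (mu : G -> R) : Prop :=
  (\esum_(g in [set: G]) (- (mu g * ln (mu g)))%:E < +oo)%E.

Definition iid_law (R : realType) (dO : measure_display) (Omega : measurableType dO)
  (P : probability Omega R) (G : Type) (mu : G -> R) (incr : nat -> Omega -> G)
  : Prop :=
  (forall (i : nat) (a : G), measurable [set w | incr i w = a]) /\
  (forall (n : nat) (a : nat -> G),
     P [set w | forall i, (i < n)%N -> incr i w = a i] =
       (\prod_(i < n) mu (a i))%:E).

Fixpoint walk (G Omega : Type) (mul : G -> G -> G) (one : G)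
  (incr : nat -> Omega -> G) (n : nat) (w : Omega) : G :=
  match n with
  | 0 => one
  | n'.+1 => mul (walk mul one incr n' w) (incr n' w)
  end.

Definition path_cylinders (G : Type) : set (set (nat -> G)) :=
  [set C | exists (i : nat) (a : G), C = [set x | x i = a]].

Definition path_measurable (G : Type) (A : set (nat -> G)) : Prop :=
  smallest (sigma_algebra setT) (@path_cylinders G) A.

Definition shift_tail (G : Type) (x y : nat -> G) : Prop :=
  exists k p N : nat, forall n, (N <= n)%N -> x (n + k)%N = y (n + p)%N.

Definition shift_tail_invariant (G : Type) (A : set (nat -> G)) : Prop :=
  forall x y, shift_tail x y -> (A x <-> A y).

Definition ae_eq_set (R : realType) (dO : measure_display)
  (Omega : measurableType dO) (P : probability Omega R) (E F : set Omega) : Prop :=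
  exists N : set Omega, measurable N /\ P N = 0%E /\
    ((E `\` F) `|` (F `\` E)) `<=` N.

(* Main.v *)
Require Import Defs.
From HB Require Import structures.
From mathcomp Require Import all_boot all_order all_algebra.
From mathcomp Require Import all_classical all_reals all_analysis.
From mathcomp Require Import measurable_realfun ring lra zify.
Set Implicit Arguments. Unset Strict Implicit. Unset Printing Implicit Defensive.
Import Order.TTheory GRing.Theory Num.Theory.
Import numFieldNormedType.Exports.
Local Open Scope classical_set_scope.
Local Open Scope ring_scope.

(* For an invariant finite-valued label [Y] of the path, the mutual information [I(w_k; Y)] is at most
   the entropy increment [H(w_(n+k)) - H(w_n)], so that [q I(w_k; Y) <= H(w_(qk))] for all [q].  If some
   function [Z] of the limit point satisfies [I(w_n; Z) >= H(w_n) - o(n)], with [Z] allowed to depend on [n],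
   then the supremum of [I(w_k; Z)] over functions [Z] of the limit point bounds [I(w_k; Y)] for every
   invariant [Y].  Applied to [Y = (Z, 1_A)] with [Z] nearly optimal and [k] large, this makes the conditional
   entropy of an invariant event [A] given [Z] small, so that [A] coincides almost surely with a Borel
   event of the boundary.

   The bound [H(w_n | Z) = o(n)] needs no moment assumption.  Outside a set of times of small density, [k] is
   a pivot: all later positions stay within bounded distance of passing through [w_k o] as seen from [o].
   Only the increments at the other times are transmitted, which costs a small multiple of [n] because [mu]
   has finite entropy; they determine [d(o, w_t o)] up to an error linear in [n], and the error costs
   [O(log n)].  Just before time [n] the walk spells with high probability a long word [v] adapted to the WPD
   element, starting at [w_t], in such a way that [w_t o] and [w_t v o] are both close to the way to the
   limit point.  Two candidates for [w_t] with the same distances to [o] and the same limit point differ by an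
   element that moves [o] and [v o] a bounded amount, and by WPD there are boundedly many of these. *)

(** * Gromov products and boundary classes *)

(** [X] is not assumed proper, so no compactness of the boundary is at hand, and even convergence of
    the walk must come out of the estimates used for the entropy bound. They all stem from one fact:
    the probability that the walk ever enters the shadow of depth [s] of a point [x] becomes small
    for large [s], uniformly in [x]. By uniformity [x] may be [w_k^-1 o], which is independent of
    the increments after time [k]; hence most times are pivots. The adapted words come in pairs,
    because a single word might point back to the past of the walk. All labels are finite-valued, so
    that conditional laws are finite families of harmonic functions on [G] and no disintegration
    over the boundary occurs. This is why the limit point is only tested against shadows of finitely
    many group elements. Convexity enters solely as [ln x <= x - 1] for a ratio of expectation at
    most 1, and martingale convergence is replaced by approximation of events by cylinders. *)

Section Hyperbolic.
Variables (R : realType) (X : Type) (d : X -> X -> R) (dl : R).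
Hypothesis dmet : is_metric d.
Hypothesis dl_ge0 : 0 <= dl.
Hypothesis dhyp : forall w x y z : X,
  Num.min (gprod d w x z) (gprod d w y z) - dl <= gprod d w x y.

Lemma dist_refl x : d x x = 0.
Proof. by case: dmet => h _; apply/h. Qed.

Lemma dist_sym x y : d x y = d y x.
Proof. by case: dmet => _ [h _]. Qed.

Lemma dist_tri x y z : d x z <= d x y + d y z.
Proof. by case: dmet => _ [_ h]. Qed.

Lemma dist_ge0 x y : 0 <= d x y.
Proof. have := dist_tri x y x; rewrite dist_refl (dist_sym y x); lra. Qed.

Lemma gprodC w x y : gprod d w x y = gprod d w y x.
Proof. by rewrite /gprod (dist_sym x y); lra. Qed.

Lemma gprod_ge0 w x y : 0 <= gprod d w x y.
Proof. have := dist_tri x w y; rewrite (dist_sym w y) /gprod; lra. Qed.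

Lemma gprod_le_l w x y : gprod d w x y <= d x w.
Proof. have := dist_tri y x w; rewrite (dist_sym y x) /gprod; lra. Qed.

Lemma gprod_le_r w x y : gprod d w x y <= d y w.
Proof. by rewrite gprodC gprod_le_l. Qed.

Lemma gprod_base w y : gprod d w w y = 0.
Proof. by rewrite /gprod dist_refl (dist_sym w y); lra. Qed.

Lemma gprod_swap w x y : gprod d w x y = d x w - gprod d x w y.
Proof. by rewrite /gprod (dist_sym w x) (dist_sym y x) (dist_sym y w); lra. Qed.

Lemma gprod_lip_l w x x' y : gprod d w x y <= gprod d w x' y + d x x'.
Proof.
have := dist_tri x x' w; have := dist_tri x' x y.
by rewrite (dist_sym x' x) /gprod; lra.
Qed.

Lemma gprod_lip_r w x y y' : gprod d w x y <= gprod d w x y' + d y y'.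
Proof. by rewrite gprodC (gprodC w x y') gprod_lip_l. Qed.

Lemma gprod_lip_base w w' x y : gprod d w x y <= gprod d w' x y + d w w'.
Proof.
have := dist_tri x w' w; have := dist_tri y w' w.
by rewrite (dist_sym w' w) /gprod; lra.
Qed.

Lemma gprod_hyp w x y z :
  gprod d w x z <= gprod d w x y + dl \/ gprod d w z y <= gprod d w x y + dl.
Proof.
have := dhyp w x y z; rewrite (gprodC w z y).
case: (leP (gprod d w x z) (gprod d w y z)) => _; lra.
Qed.

Lemma gprod_ultra w x y z m :
  m <= gprod d w x z -> m <= gprod d w z y -> m - dl <= gprod d w x y.
Proof. by case: (gprod_hyp w x y z) => h h1 h2; lra. Qed.

Section Boundary.
Variable o : X.
Local Notation gp := (gprod d o).
Local Notation conv := (conv_infty d o).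
Local Notation eqv := (seq_equiv d o).

Lemma eqv_sym x y : eqv x y -> eqv y x.
Proof. by move=> h M; have [N hN] := h M; exists N => n m ? ?; rewrite gprodC hN. Qed.

Lemma eqv_trans x y z : eqv x y -> eqv y z -> eqv x z.
Proof.
move=> h1 h2 M; have [N1 hN1] := h1 (M + dl); have [N2 hN2] := h2 (M + dl).
exists (maxn N1 N2) => n m; rewrite !geq_max => /andP[n1 n2] /andP[m1 m2].
have := @gprod_ultra o (x n) (z m) (y (maxn N1 N2)) (M + dl).
rewrite addrK; apply; [exact: hN1 (leq_maxl _ _)|exact: hN2 (leq_maxr _ _) _].
Qed.

Lemma eqv_bounded_shift x y y' C :
  (forall n, d (y n) (y' n) <= C) -> eqv x y -> eqv x y'.
Proof.
move=> hC h M; have [N hN] := h (M + C); exists N => n m hn hm.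
by have := hN n m hn hm; have := gprod_lip_r o (x n) (y m) (y' m); have := hC m; lra.
Qed.

Lemma eqv_subseq x (f : nat -> nat) : conv x ->
  (forall n, (n <= f n)%N) -> eqv x (fun n => x (f n)).
Proof.
by move=> h hf M; have [N hN] := h M; exists N => n m hn hm; apply: hN => //; exact: leq_trans hm (hf m).
Qed.

(** Non-equivalence yields a single pair of late indices with product below some [M]. The hyperbolic
    inequality, used once for each sequence, spreads this to all late pairs with a loss of [2 dl]; a
    pair with an early index is bounded by the distance of that early point to [o]. *)
Lemma not_eqv_bounded x y : conv x -> conv y -> ~ eqv x y ->
  exists C, forall n m, gp (x n) (y m) <= C.
Proof.
move=> cx cy /existsNP[M /forallNP hM]; have D0 := dl_ge0.
have [Nx hx] := cx (M + dl + dl + 1); have [Ny hy] := cy (M + dl + dl + 1).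
have [n0 [m0 [hn0 hm0 hlt]]] : exists n0 m0, [/\ (maxn Nx Ny <= n0)%N,
    (maxn Nx Ny <= m0)%N & gp (x n0) (y m0) < M].
  have /existsNP[n0 /existsNP[m0 /not_implyP[h1 /not_implyP[h2 h3]]]] := hM (maxn Nx Ny).
  by exists n0, m0; split=> //; rewrite ltNge; apply/negP.
move: hn0 hm0; rewrite !geq_max => /andP[n1 n2] /andP[m1 m2].
have [S ES] : exists S : R, S = \sum_(i < Nx) d (x i) o + \sum_(i < Ny) d (y i) o by eexists.
have Sx i : (i < Nx)%N -> d (x i) o <= S.
  move=> iN; rewrite ES (bigD1 (Ordinal iN)) //=.
  have : 0 <= \sum_(j < Nx | j != Ordinal iN) d (x j) o by apply: sumr_ge0 => *; exact: dist_ge0.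
  have : 0 <= \sum_(j < Ny) d (y j) o by apply: sumr_ge0 => *; exact: dist_ge0.
  by lra.
have Sy i : (i < Ny)%N -> d (y i) o <= S.
  move=> iN; rewrite ES (bigD1 (Ordinal iN)) //=.
  have : 0 <= \sum_(j < Ny | j != Ordinal iN) d (y j) o by apply: sumr_ge0 => *; exact: dist_ge0.
  have : 0 <= \sum_(j < Nx) d (x j) o by apply: sumr_ge0 => *; exact: dist_ge0.
  by lra.
have [K [M0 Mn0]] : exists K : R, M <= K /\ 0 <= K.
  by exists `|M|; rewrite ler_norm normr_ge0.
exists (K + dl + dl + 1 + S) => n m.
have S0 : 0 <= S by rewrite ES; apply: addr_ge0; apply: sumr_ge0 => *; exact: dist_ge0.
case: (ltnP n Nx) => hn; first by have := gprod_le_l o (x n) (y m); have := Sx n hn; lra.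
case: (ltnP m Ny) => hm; first by have := gprod_le_r o (x n) (y m); have := Sy m hm; lra.
have := hx n0 n n1 hn; have := hy m m0 hm m2.
case: (gprod_hyp o (x n0) (y m0) (x n)); first by lra.
by case: (gprod_hyp o (x n) (y m0) (y m)); lra.
Qed.

(* The boundary point of a sequence; empty when the sequence does not converge. *)
Definition bclass (x : nat -> X) : set (nat -> X) :=
  [set y | [/\ conv x, conv y & eqv x y]].

Lemma bclassP x : conv x -> bpoint d o (bclass x).
Proof.
move=> cx; split; [by exists x|split=> [y []//|y [_ cy xy] z]].
split=> [[_ cz xz]|[cz yz]].
  by split=> //; exact: eqv_trans (eqv_sym xy) xz.
by split=> //; exact: eqv_trans xy yz.
Qed.

Lemma bclass_refl x : conv x -> bclass x x. Proof. by split. Qed.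

Lemma bpoint_class xi x : bpoint d o xi -> xi x -> xi = bclass x.
Proof.
move=> [_ [hc he]] xix; apply/seteqP; split=> y.
  by move=> /(he x xix)[cy xy]; split=> //; exact: hc.
by move=> [_ cy xy]; apply/(he x xix).
Qed.

Lemma bclass_eq x y : conv x -> eqv x y -> conv y -> bclass x = bclass y.
Proof.
move=> cx xy cy; apply/seteqP; split=> z [_ cz xz]; split=> //.
  exact: eqv_trans (eqv_sym xy) xz.
exact: eqv_trans xy xz.
Qed.

End Boundary.
End Hyperbolic.

(** One variable stands for the data and the axioms in all later sections; the hyperbolicity
    constant is fixed once and for all. *)
Record hyp_action (R : realType) := HypAction {
  G_of : countType;
  mul_of : G_of -> G_of -> G_of;
  one_of : G_of;
  inv_of : G_of -> G_of;
  grp_of : is_group mul_of one_of inv_of;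
  X_of : Type;
  d_of : X_of -> X_of -> R;
  met_of : is_metric d_of;
  dl_of : R;
  dl_of_ge0 : 0 <= dl_of;
  hyp_of : forall w x y z : X_of,
    Num.min (gprod d_of w x z) (gprod d_of w y z) - dl_of <= gprod d_of w x y;
  o_of : X_of;
  act_of : G_of -> X_of -> X_of;
  isom_of : isom_action mul_of one_of d_of act_of }.

(** * Isometric actions and loxodromic elements *)

Section Action.
Variables (R : realType) (S : hyp_action R).
Local Notation G := (G_of S).
Local Notation mul := (@mul_of R S).
Local Notation one := (@one_of R S).
Local Notation inv := (@inv_of R S).
Local Notation X := (X_of S).
Local Notation d := (@d_of R S).
Local Notation dl := (@dl_of R S).
Local Notation o := (@o_of R S).
Local Notation act := (@act_of R S).
Local Notation gp := (gprod d o).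
Local Notation conv := (conv_infty d o).
Local Notation eqv := (seq_equiv d o).
Local Notation met := (@met_of R S).
Local Notation pow := (gpow mul one).

Lemma gmulA a b c : mul a (mul b c) = mul (mul a b) c.
Proof. by case: (grp_of S). Qed.
Lemma gmul1 a : mul one a = a.
Proof. by case: (grp_of S) => _ []. Qed.
Lemma gmul1r a : mul a one = a.
Proof. by case: (grp_of S) => _ [_ []]. Qed.
Lemma gmulV a : mul (inv a) a = one.
Proof. by case: (grp_of S) => _ [_ [_ []]]. Qed.
Lemma gmulVr a : mul a (inv a) = one.
Proof. by case: (grp_of S) => _ [_ [_ []]]. Qed.
Lemma gmulKV a b : mul (inv a) (mul a b) = b.
Proof. by rewrite gmulA gmulV gmul1. Qed.
Lemma gmulVK a b : mul a (mul (inv a) b) = b.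
Proof. by rewrite gmulA gmulVr gmul1. Qed.
Lemma inv_uniq a b : mul a b = one -> inv a = b.
Proof. by move=> h; rewrite -[inv a]gmul1r -h gmulKV. Qed.
Lemma ginvK a : inv (inv a) = a.
Proof. exact/inv_uniq/gmulV. Qed.
Lemma ginvM a b : inv (mul a b) = mul (inv b) (inv a).
Proof. by apply: inv_uniq; rewrite -gmulA gmulVK gmulVr. Qed.

Lemma act1 x : act one x = x. Proof. by case: (isom_of S). Qed.
Lemma actM g h x : act (mul g h) x = act g (act h x).
Proof. by case: (isom_of S) => _ []. Qed.
Lemma act_isom g x y : d (act g x) (act g y) = d x y.
Proof. by case: (isom_of S) => _ []. Qed.
Lemma actV g x : act (inv g) (act g x) = x.
Proof. by rewrite -actM gmulV act1. Qed.
Lemma actKV g x : act g (act (inv g) x) = x.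
Proof. by rewrite -actM gmulVr act1. Qed.

Lemma gprod_act g w x y : gprod d (act g w) (act g x) (act g y) = gprod d w x y.
Proof. by rewrite /gprod !act_isom. Qed.

Definition len (g : G) : R := d (act g o) o.

Lemma len_ge0 g : 0 <= len g. Proof. exact: dist_ge0 met _ _. Qed.
Lemma len1 : len one = 0. Proof. by rewrite /len act1 dist_refl //; exact: met. Qed.
Lemma lenV g : len (inv g) = len g.
Proof. by rewrite /len -(act_isom g (act (inv g) o)) actKV (dist_sym met). Qed.
Lemma lenM g h : len (mul g h) <= len g + len h.
Proof.
rewrite /len actM; have := dist_tri met (act g (act h o)) (act g o) o.
by rewrite act_isom; lra.
Qed.

Lemma dist_len g h : d (act g o) (act h o) = len (mul (inv g) h).
Proof. by rewrite /len actM -(act_isom (inv g) (act g o)) actV (dist_sym met). Qed.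

Lemma gprod_act_ge g x y : gp x y - len g <= gp (act g x) (act g y).
Proof.
rewrite -(gprod_act (inv g) o (act g x)) !actV.
have := gprod_lip_base met o (act (inv g) o) x y.
by rewrite (dist_sym met) -/(len (inv g)) lenV; lra.
Qed.

Lemma conv_act g x : conv x -> conv (fun n => act g (x n)).
Proof.
move=> h M; have [N hN] := h (M + len g); exists N => n m hn hm.
by have := gprod_act_ge g (x n) (x m); have := hN n m hn hm; lra.
Qed.

Lemma eqv_act g x y : eqv x y -> eqv (fun n => act g (x n)) (fun n => act g (y n)).
Proof.
move=> h M; have [N hN] := h (M + len g); exists N => n m hn hm.
by have := gprod_act_ge g (x n) (y m); have := hN n m hn hm; lra.
Qed.

Lemma bact_class g x : conv x ->
  bact act g (bclass d o x) = bclass d o (fun n => act g (x n)).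
Proof.
move=> cx; apply/seteqP; split => y.
  move=> [z [[_ cz xz] ->]]; split; [exact: conv_act|exact: conv_act|exact: eqv_act].
move=> [_ cy xy]; exists (fun n => act (inv g) (y n)); split.
  split=> //; first exact: conv_act.
  have := eqv_act (inv g) xy; congr (seq_equiv d o _ _).
  by apply/funext => n; rewrite actV.
by apply/funext => n; rewrite actKV.
Qed.

Lemma bfix_class g x : conv x -> eqv (fun n => act g (x n)) x ->
  bfix d o act g (bclass d o x).
Proof.
move=> cx h; have D0 := dl_of_ge0 S; split; first exact: (bclassP met (@hyp_of _ S)).
rewrite bact_class //; apply: (bclass_eq met (@hyp_of _ S)) => //; exact: conv_act.
Qed.

Lemma powS g n : pow g n.+1 = mul g (pow g n). Proof. by []. Qed.
Lemma powD g m n : pow g (m + n) = mul (pow g m) (pow g n).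
Proof. by elim: m => [|m IH]; rewrite ?gmul1 // addSn !powS IH gmulA. Qed.
Lemma powSr g n : pow g n.+1 = mul (pow g n) g.
Proof. by rewrite -addn1 powD powS gmul1r. Qed.
Lemma powM g m n : pow g (m * n) = pow (pow g m) n.
Proof. by elim: n => [|n IH]; rewrite ?muln0 // mulnS powD powS IH. Qed.
Lemma powV g n : pow (inv g) n = inv (pow g n).
Proof.
elim: n => [|n IH]; first by apply/esym/inv_uniq; rewrite gmul1r.
by rewrite powS IH powSr ginvM.
Qed.

(** The base point in [loxodromic] is existential; replacing it by [o] costs twice their distance.
    This loss and the indices before the limit takes effect are absorbed in [c']. *)
Lemma lox_growth g : loxodromic mul one d act g ->
  exists c c', 0 < c /\ forall n, c * n%:R - c' <= len (pow g n).
Proof.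
move=> [x [l [l0 /cvgrPdist_lt/(_ (l / 2) ltac:(lra))[N _ hN]]]].
exists (l / 2), (l / 2 * N%:R + d x o + d x o); split=> [|n]; first by lra.
have E : d (act (pow g n) x) x <= len (pow g n) + d x o + d x o.
  have := dist_tri met (act (pow g n) x) (act (pow g n) o) x.
  have := dist_tri met (act (pow g n) o) o x.
  by rewrite act_isom (dist_sym met o x) /len; lra.
suff : l / 2 * n%:R - l / 2 * N%:R <= d (act (pow g n) x) x by lra.
have [nN|Nn] := ltnP n N.
  have := dist_ge0 met (act (pow g n) x) x.
  suff : l / 2 * n%:R <= l / 2 * N%:R by lra.
  by rewrite ler_pM2l ?ler_nat 1?ltnW //; lra.
case: (posnP n) => [n0|n0].
  have : N = 0%N by lia.
  by move=> ->; rewrite n0 mulr0 subr0 (dist_ge0 met).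
have n0' : 0 < n%:R :> R by rewrite ltr0n.
have /= h := hN n Nn; have {}h : l / 2 < d (act (pow g n) x) x / n%:R.
  by move: (le_lt_trans (ler_norm _) h); lra.
have : 0 <= l / 2 * N%:R by apply: mulr_ge0; [lra|].
by move: h; rewrite ltr_pdivlMr //; lra.
Qed.

(** If every doubling of the exponent gained less than [K], then the length of [g^(2^k)] would grow
    at most linearly in [k], against the linear growth in the exponent itself. *)
Lemma lox_doubling g (K : R) : loxodromic mul one d act g ->
  exists N, (0 < N)%N /\ len (pow g N) + K <= len (pow (pow g N) 2).
Proof.
move=> /lox_growth[c [c' [c0 hc]]]; apply: contrapT => hn.
have {}hn N : (0 < N)%N -> len (pow g (N * 2)) < len (pow g N) + K.
  by move=> N0; rewrite ltNge; apply/negP => h; apply: hn; exists N; rewrite -powM.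
have f k : len (pow g (2 ^ k)) <= len (pow g 1) + k%:R * K.
  elim: k => [|k IH]; first by rewrite expn0 mul0r addr0.
  by have := hn (2 ^ k)%N ltac:(by rewrite expn_gt0); rewrite -expnSr -natr1; lra.
pose B := (`|2 * K| + `|len (pow g 1)| + `|c'|) / c.
have [j hj] : exists j : nat, B + 1 < j%:R by exists (Num.truncn (B + 1)).+1; exact: truncnS_gt.
have B0 : 0 <= B by apply: divr_ge0; [rewrite !addr_ge0|exact: ltW].
(* At the exponent [2^(2j)] the lower bound is at least [c j^2 - c'], the upper bound is linear in
   [j]. *)
have h1 := hc (2 ^ (j + j))%N; have h2 := f (j + j)%N.
have j2 : j%:R * j%:R <= (2 ^ (j + j))%N%:R :> R.
  by rewrite -natrM ler_nat expnD leq_mul // ltnW // ltn_expl.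
have h3 : c * (j%:R * j%:R) <= c * (2 ^ (j + j))%N%:R by rewrite ler_pM2l.
have h4 : c * B = `|2 * K| + `|len (pow g 1)| + `|c'| by rewrite /B mulrC divfK // gt_eqF.
have [[k1 k2] k3] := (ler_norm (2 * K), ler_norm (len (pow g 1)), ler_norm c').
rewrite natrD in h2.
have h5 : (c * B + c) * j%:R <= c * (j%:R * j%:R).
  by rewrite -{2}[c]mulr1 -mulrDr -mulrA ler_pM2l // ler_wpM2r // ltW.
have j1 : 1 <= j%:R :> R by lra.
move: h4 h5 k1 k2 k3; set a1 := `|_|; set a2 := `|_|; set a3 := `|_|.
have [a10 a20 a30] : [/\ 0 <= a1, 0 <= a2 & 0 <= a3] by split; exact: normr_ge0.
move=> h4; rewrite h4 => h5 k1 k2 k3.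
have q1 : 2 * K * j%:R <= a1 * j%:R by rewrite ler_wpM2r //; lra.
have q2 : a2 <= a2 * j%:R by rewrite ler_peMr.
have q3 : a3 <= a3 * j%:R by rewrite ler_peMr.
have q4 : c <= c * j%:R by rewrite ler_peMr // ltW.
nra.
Qed.

Section Chain.
Variable h : G.
Hypothesis hdbl : len h + (4 * dl + 2) <= len (pow h 2).
Variables (F : nat -> R) (x : nat -> X).
Hypotheses (FE : forall k, F k = len (pow h k)) (xE : forall k, x k = act (pow h k) o).

Lemma chain_gprod i j k : (i <= j)%N -> (j <= k)%N ->
  gprod d (x j) (x i) (x k) = (F (j - i) + F (k - j) - F (k - i)) / 2.
Proof.
move=> ij jk; have e a b : (a <= b)%N -> d (x a) (x b) = F (b - a)%N.
  by move=> ab; rewrite !xE FE dist_len -{1}(subnKC ab) powD gmulKV.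
by rewrite /gprod (dist_sym met (x k)) !e // (leq_trans ij).
Qed.

(** A local-to-global argument. The product at one orbit point of its two neighbours is
    [F 1 - F 2 / 2]. If [x 0] has a small product with [x i.+2] at [x i.+1], then at [x i.+2] it
    lies in the direction of [x i.+1], by the margin in [hdbl], hence away from [x i.+3]. *)
Lemma chain_step i : (0 < i)%N ->
  gprod d (x i) (x 0%N) (x i.+1) <= F 1 - F 2 / 2 + dl.
Proof.
have D0 := dl_of_ge0 S.
have F1 : F 1%N = len h by rewrite FE powS gmul1r.
have H : len h + (4 * dl + 2) <= F 2 by rewrite FE; exact: hdbl.
case: i => // i _; elim: i => [|i IH].
  rewrite chain_gprod; [|lia|lia].
  by rewrite !subn0 subSnn; lra.
have := gprod_hyp met (@hyp_of _ S) (x i.+2) (x i.+1) (x i.+3) (x 0%N).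
have -> : gprod d (x i.+2) (x i.+1) (x i.+3) = F 1%N - F 2 / 2.
  rewrite chain_gprod; [|lia|lia].
  have [-> -> ->] : [/\ i.+2 - i.+1 = 1, i.+3 - i.+2 = 1 & i.+3 - i.+1 = 2]%N by split; lia.
  by lra.
rewrite (gprod_swap met) (gprodC met _ (x i.+2)).
have -> : d (x i.+1) (x i.+2) = F 1%N.
  by rewrite !xE FE dist_len (powSr h i.+1) gmulKV powS gmul1r.
by lra.
Qed.

(** By [chain_step] and [hdbl] each further step gains at least [2 dl + 2]. *)
Lemma chain_growth i : i%:R <= F i.
Proof.
have D0 := dl_of_ge0 S.
have F1 : F 1%N = len h by rewrite FE powS gmul1r.
have H : len h + (4 * dl + 2) <= F 2 by rewrite FE; exact: hdbl.
have H2 : F 2 <= F 1%N + F 1%N by rewrite !FE (powD h 1 1); exact: lenM.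
elim: i => [|[|i] IH]; [by rewrite FE len_ge0|by lra|].
have := chain_step (ltn0Sn i); rewrite chain_gprod; [|lia|lia].
rewrite !subn0 subSnn; by rewrite -[i.+2%:R]natr1; lra.
Qed.

Lemma chain_conv_ge i j : (i <= j)%N ->
  i%:R - (F 1%N - F 2 / 2 + 2 * dl) <= gp (x i) (x j).
Proof.
have D0 := dl_of_ge0 S.
have F1 : F 1%N = len h by rewrite FE powS gmul1r.
have H : len h + (4 * dl + 2) <= F 2 by rewrite FE; exact: hdbl.
have H2 : F 2 <= F 1%N + F 1%N by rewrite !FE (powD h 1 1); exact: lenM.
have x0 : x 0%N = o by rewrite xE act1.
move=> ij; rewrite (gprod_swap met) {1}xE -/(len _) -FE -x0; have := chain_growth i.
suff : gprod d (x i) (x 0%N) (x j) <= F 1%N - F 2 / 2 + 2 * dl by lra.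
move: ij; rewrite leq_eqVlt => /orP[/eqP ->|ij].
  by rewrite (gprodC met) (gprod_base met); lra.
case: i ij => [|i] ij; first by rewrite (gprod_base met); lra.
(* This is [chain_step] read backwards: by [chain_gprod] the product depends only on the gaps
   between the indices, symmetrically. *)
have st : gprod d (x i.+1) (x i) (x j) <= F 1%N - F 2 / 2 + dl.
  have p : (0 < j - i.+1)%N by lia.
  have := chain_step p; rewrite !chain_gprod; try lia.
  rewrite (_ : j - i.+1 - 0 = j - i.+1)%N; last lia.
  rewrite (_ : (j - i.+1).+1 - (j - i.+1) = 1)%N; last lia.
  rewrite (_ : i.+1 - i = 1)%N; last lia.
  by rewrite (_ : (j - i.+1).+1 - 0 = j - i)%N; [lra|lia].
case: i ij st => [|i] ij st; first by lra.
have := gprod_hyp met (@hyp_of _ S) (x i.+2) (x i.+1) (x j) (x 0%N).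
have := chain_step (ltn0Sn i).
rewrite (gprod_swap met (x i.+2) (x i.+1)) (gprodC met _ (x i.+2)).
have -> : d (x i.+1) (x i.+2) = F 1%N.
  by rewrite !xE FE dist_len (powSr h i.+1) gmulKV powS gmul1r.
by lra.
Qed.
End Chain.

(** The chain estimates apply to a power [g^N] with the doubling property; the other points of the
    orbit stay within bounded distance of the orbit of [g^N]. *)
Lemma lox_conv g : loxodromic mul one d act g -> conv (fun n => act (pow g n) o).
Proof.
move=> /lox_doubling-/(_ (4 * dl + 2))[N [N0 hd]].
pose C := len (pow (pow g N) 1) - len (pow (pow g N) 2) / 2 + 2 * dl.
have [rho hr] : exists rho : R, forall r, (r < N)%N -> len (pow g r) <= rho.
  exists (\sum_(i < N) len (pow g i)) => r rN; rewrite (bigD1 (Ordinal rN)) //=.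
  by rewrite lerDl; apply: sumr_ge0 => i _; exact: len_ge0.
have dq n : d (act (pow g n) o) (act (pow (pow g N) (n %/ N)) o) <= rho.
  rewrite (dist_sym met) -powM dist_len {2}(divn_eq n N) powD mulnC gmulKV.
  by apply: hr; rewrite ltn_mod.
move=> M; pose q := (Num.truncn (`|M + C + rho + rho|)).+1.
have Mq : M + C + rho + rho <= q%:R.
  by apply: ltW; apply: le_lt_trans (ler_norm _) _; exact: truncnS_gt.
exists (q * N)%N => n m hn hm.
have [hn' hm'] : (q <= n %/ N)%N /\ (q <= m %/ N)%N by rewrite !leq_divRL.
have H i j : (q <= i)%N -> (q <= j)%N ->
    M + rho + rho <= gp (act (pow (pow g N) i) o) (act (pow (pow g N) j) o).
  wlog ij : i j / (i <= j)%N => [W|] qi qj.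
    by case/orP: (leq_total i j) => ij; [|rewrite (gprodC met)]; exact: W.
  have := chain_conv_ge hd (F := fun k => len (pow (pow g N) k)) (x := fun k => act (pow (pow g N) k) o) (fun=> erefl) (fun=> erefl) ij.
  rewrite -/C.
  have : q%:R <= i%:R :> R by rewrite ler_nat.
  by lra.
have := H _ _ hn' hm'; have := dq n; have := dq m.
have := gprod_lip_l met o (act (pow (pow g N) (n %/ N)) o) (act (pow g n) o) (act (pow (pow g N) (m %/ N)) o).
have := gprod_lip_r met o (act (pow g n) o) (act (pow (pow g N) (m %/ N)) o) (act (pow g m) o).
rewrite !(dist_sym met (act (pow (pow g N) _) o)).
by lra.
Qed.

Lemma pow_fixed g : conv (fun n => act (pow g n) o) ->
  eqv (fun n => act g (act (pow g n) o)) (fun n => act (pow g n) o).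
Proof.
move=> cg; apply: (eqv_sym met); apply: (eqv_bounded_shift met (C := len g)) cg => n.
by rewrite -actM -powS powSr dist_len gmulKV.
Qed.

Lemma lox_inv g : loxodromic mul one d act g -> loxodromic mul one d act (inv g).
Proof.
move=> [x [l [l0 h]]]; exists x, l; split=> //.
suff <- : (fun n : nat => d (act (pow g n) x) x / n%:R) =
  (fun n : nat => d (act (pow (inv g) n) x) x / n%:R) by [].
by apply/funext => n; rewrite powV -(act_isom (pow g n) (act (inv _) x)) actKV (dist_sym met).
Qed.

End Action.

(** * Schottky words and WPD words *)

Section Schottky.
Variables (R : realType) (S : hyp_action R).
Local Notation G := (G_of S).
Local Notation mul := (@mul_of R S).
Local Notation one := (@one_of R S).
Local Notation inv := (@inv_of R S).
Local Notation X := (X_of S).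
Local Notation d := (@d_of R S).
Local Notation dl := (@dl_of R S).
Local Notation o := (@o_of R S).
Local Notation act := (@act_of R S).
Local Notation gp := (gprod d o).
Local Notation conv := (conv_infty d o).
Local Notation eqv := (seq_equiv d o).
Local Notation met := (@met_of R S).
Local Notation hyp := (@hyp_of R S).
Local Notation dl0 := (@dl_of_ge0 R S).
Local Notation pow := (gpow mul one).
Local Notation lox := (loxodromic mul one d act).

Lemma bfix_inv g xi : bfix d o act g xi -> bfix d o act (inv g) xi.
Proof.
move=> [b e]; split=> //; rewrite -{1}e; apply/seteqP; split=> y.
  by move=> [_ [[x [xx ->]] ->]]; congr (xi _): xx; apply/funext => n; rewrite actV.
move=> xy; exists (fun n => act g (y n)); split; first by exists y.
by apply/funext => n; rewrite actV.
Qed.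

(** The limit point of the powers of [g] cannot be fixed by both [h1] and [h2]; the element [a] is
    one of the two that moves it. *)
Lemma lox_not_fixed g h1 h2 : lox g -> bfix d o act h1 `&` bfix d o act h2 = set0 ->
  exists a C, forall n m, gp (act a (act (pow g n) o)) (act (pow g m) o) <= C.
Proof.
move=> /lox_conv cg dis.
have H a : ~ eqv (fun n => act a (act (pow g n) o)) (fun n => act (pow g n) o) ->
    exists a C, forall n m, gp (act a (act (pow g n) o)) (act (pow g m) o) <= C.
  move=> ne; have [C hC] := not_eqv_bounded met dl0 hyp (conv_act a cg) cg ne.
  by exists a, C.
have [e1|/H//] := pselect (eqv (fun n => act h1 (act (pow g n) o)) (fun n => act (pow g n) o)).
have [e2|/H//] := pselect (eqv (fun n => act h2 (act (pow g n) o)) (fun n => act (pow g n) o)).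
suff : (bfix d o act h1 `&` bfix d o act h2) (bclass d o (fun n => act (pow g n) o)).
  by rewrite dis.
by split; apply: bfix_class.
Qed.

(** Since [B] fixes the class of [b], it is neither the attracting nor the repelling point of [A].
    Being away from the repelling point, it is pushed by large powers of [A] towards the attracting
    one; if [A^m] fixed it, it would itself be close to the attracting point. *)
Lemma independent_pow (A B : G) b m : lox A -> conv b ->
  bfix d o act A `&` bfix d o act B = set0 -> eqv (fun n => act B (b n)) b ->
  (0 < m)%N -> ~ eqv (fun n => act (pow A m) (b n)) b.
Proof.
move=> lA cb dis fB m0 fA.
have cp := lox_conv lA; have cm := lox_conv (lox_inv lA).
have nofix p : conv p -> eqv (fun n => act A (p n)) p -> ~ eqv b p.
  move=> cp' fp bp.
  suff : (bfix d o act A `&` bfix d o act B) (bclass d o p) by rewrite dis.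
  split; first exact: bfix_class.
  by rewrite -(bclass_eq met hyp cb bp cp'); exact: bfix_class.
have fm : eqv (fun n => act A (act (pow (inv A) n) o)) (fun n => act (pow (inv A) n) o).
  have := eqv_act A (pow_fixed cm).
  under eq_fun do rewrite actKV.
  by move=> /(eqv_sym met).
have [Cp hp] := not_eqv_bounded met dl0 hyp cb cp (nofix _ cp (pow_fixed cp)).
have [Cm hm] := not_eqv_bounded met dl0 hyp cb cm (nofix _ cm fm).
have fq q : eqv (fun n => act (pow (pow A m) q) (b n)) b.
  elim: q => [|q IH]; first by under eq_fun do rewrite act1; exact: cb.
  refine (eqv_trans met hyp (y := fun n => act (pow A m) (b n)) _ fA).
  have := eqv_act (pow A m) IH.
  by under eq_fun do rewrite -actM -powS.
have [c [c' [c0 gr]]] := lox_growth lA.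
pose q := (Num.truncn ((Cp + Cm + dl + 1 + c') / c)).+1.
have hq : Cp + dl + 1 <= len (pow A (m * q)) - Cm.
  have := gr (m * q)%N.
  have h1 : (Cp + Cm + dl + 1 + c') / c <= q%:R by rewrite ltW // truncnS_gt.
  have h2 : Cp + Cm + dl + 1 + c' <= c * q%:R by move: h1; rewrite ler_pdivrMr // mulrC.
  have : c * q%:R <= c * (m * q)%:R by rewrite ler_pM2l // ler_nat leq_pmull.
  by lra.
have [N hN] := fq q (Cp + dl + 1).
have h1 := hN N N (leqnn _) (leqnn _).
have h2 : Cp + dl + 1 <= gp (act (pow (pow A m) q) (b N)) (act (pow A (m * q)) o).
  rewrite -powM (gprodC met) (gprod_swap met) -/(len _).
  have -> : gprod d (act (pow A (m * q)) o) o (act (pow A (m * q)) (b N)) =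
    gp (b N) (act (pow (inv A) (m * q)) o).
    by rewrite powV -(gprod_act (pow A (m * q)) o (b N)) actKV (gprodC met).
  by have := hm N (m * q)%N; lra.
have := hp N (m * q)%N.
have := gprod_ultra met hyp (w := o) (x := b N) (y := act (pow A (m * q)) o) (m := Cp + dl + 1)
  (z := act (pow (pow A m) q) (b N)).
rewrite (gprodC met _ (b N)) => /(_ h1 h2); rewrite (gprodC met); lra.
Qed.

Definition prodw (s : seq G) : G := foldr mul one s.

Lemma prodw_cat s t : prodw (s ++ t) = mul (prodw s) (prodw t).
Proof. by elim: s => [|a s IH] /=; rewrite ?gmul1 // IH gmulA. Qed.

Lemma prodw_flatten n s : prodw (flatten (nseq n s)) = pow (prodw s) n.
Proof. by elim: n => //= n IH; rewrite prodw_cat IH. Qed.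

Lemma size_flatten_nseq (T : Type) n (s : seq T) : size (flatten (nseq n s)) = (n * size s)%N.
Proof. by elim: n => //= n IH; rewrite size_cat IH mulSn. Qed.

Lemma all_flatten_nseq (T : Type) (p : pred T) n (s : seq T) : all p s -> all p (flatten (nseq n s)).
Proof. by move=> h; elim: n => //= n IH; rewrite all_cat h. Qed.

Lemma fin_bound (I J : finType) (f : I -> J -> R -> Prop) :
  (forall i j C C', C <= C' -> f i j C -> f i j C') ->
  (forall i j, exists C, f i j C) -> exists C, forall i j, f i j C.
Proof.
move=> mono h.
have h' i : exists g : J -> R, forall j, f i j (g j).
  by have [g hg] := choice (h i); exists g.
have [c hc] := choice h'.
exists (\sum_i \sum_j `|c i j|) => i j; apply: mono (hc i j).
rewrite (bigD1 i) //= (bigD1 j) //= -addrA; apply: ler_wpDr (ler_norm _).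
by rewrite addr_ge0 // ?sumr_ge0 // => i' _; rewrite sumr_ge0.
Qed.

Lemma independent_translates (A B : G) : lox A -> lox B ->
  bfix d o act A `&` bfix d o act B = set0 -> forall i j, i <> j ->
  exists C, forall n n',
    gp (act (pow A i) (act (pow B n) o)) (act (pow A j) (act (pow B n') o)) <= C.
Proof.
move=> lA lB dis i j; have cb := lox_conv lB; wlog ij : i j / (i < j)%N.
  move=> W ne; have : (i < j)%N || (j < i)%N by lia.
  case/orP => lt; first exact: W.
  have [||C hC] := W j i => //; first by lia.
  by exists C => n n'; rewrite (gprodC met).
move=> _; apply: (not_eqv_bounded met dl0 hyp); try exact: conv_act.
move=> h.
apply: (independent_pow lA cb dis (pow_fixed cb) (m := j - i)); first by lia.
apply: (eqv_sym met); have := eqv_act (inv (pow A i)) h.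
under eq_fun do rewrite actV.
rewrite (_ : (fun n => act (inv (pow A i)) _) = fun n => act (pow A (j - i)) (act (pow B n) o)) //.
apply/funext => n; rewrite -actM; congr act.
by rewrite -{1}(subnKC (ltnW ij)) powD gmulKV.
Qed.

Variable mu : G -> R.
Hypothesis Hgen : generating mul one mu.
Hypothesis Hnonel : non_elementary mul one d o act.

(** The words spell [s i = A^i B^Q A^(r-i)]. The trailing power of [A] makes all lengths equal and
    separates the inverses: the [s i] point towards distinct translates of the limit point of [B],
    the inverses towards distinct translates of that of [B^-1]. Hence [y] lies in the direction of
    at most one inverse (the index [i1]); for any other [i], the point [s i y] lies in the direction
    of [s i o], which [x] sees for at most one index [i2]. *)
Lemma schottky_words (r : nat) : exists (k : nat) (w : 'I_r.+1 -> seq G) (C : R),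
  [/\ forall i, size (w i) = k, forall i, all (fun a => 0 < mu a) (w i) &
   forall x y : X, exists i1 i2, forall i,
     C < gp x (act (prodw (w i)) y) -> i = i1 \/ i = i2].
Proof.
have [B [A [lB [lA]]]] := Hnonel; rewrite setIC => dis; have D0 := dl0.
have [wA [_ [pA eA]]] := Hgen A; have [wB [_ [pB eB]]] := Hgen B.
have dis' : bfix d o act (inv A) `&` bfix d o act (inv B) = set0.
  rewrite -subset0 -dis => xi [h1 h2]; split.
    by rewrite -(ginvK A); exact: bfix_inv.
  by rewrite -(ginvK B); exact: bfix_inv.
have [C1 hC1] : exists C, forall i j : 'I_r.+1, i <> j -> forall n n',
    gp (act (pow A i) (act (pow B n) o)) (act (pow A j) (act (pow B n') o)) <= C.
  apply: fin_bound => [i j C C' CC h ij n n'|i j]; first exact: le_trans (h ij n n') CC.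
  have [->|/eqP ij] := eqVneq i j; first by exists 0.
  have [|C hC] := independent_translates lA lB dis (i := i) (j := j); last by exists C.
  by move=> /val_inj.
have [C2 hC2] : exists C, forall i j : 'I_r.+1, i <> j -> forall n n',
    gp (act (pow (inv A) (r - i)) (act (pow (inv B) n) o))
       (act (pow (inv A) (r - j)) (act (pow (inv B) n') o)) <= C.
  apply: fin_bound => [i j C C' CC h ij n n'|i j]; first exact: le_trans (h ij n n') CC.
  have [->|/eqP ij] := eqVneq i j; first by exists 0.
  have [|C hC] := independent_translates (lox_inv lA) (lox_inv lB) dis'
    (i := (r - i)%N) (j := (r - j)%N); last by exists C.
  by move=> h; apply: ij; apply: ord_inj; have := ltn_ord i; have := ltn_ord j; lia.
have [rho hrho] : exists rho, forall (i : 'I_r.+1) (j : 'I_1), len (pow A i) <= rho.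
  apply: (@fin_bound _ _ (fun (i : 'I_r.+1) (j : 'I_1) C => len (pow A i) <= C)).
    by move=> i j C C' CC /le_trans; apply.
  by move=> i j; exists (len (pow A i)).
have {}hrho i : (i <= r)%N -> len (pow A i) <= rho.
  by move=> ir; have := hrho (Ordinal (ir : (i < r.+1)%N)) ord0.
have [C0 [hC01 hC02]] : exists C0 : R, C1 + rho + rho <= C0 /\ C2 + rho + rho <= C0.
  by exists (Num.max (C1 + rho + rho) (C2 + rho + rho)); rewrite !le_max !lexx orbT.
have [c [c' [c0 gr]]] := lox_growth lB.
have [Q hQ] : exists Q, 2 * C0 + 3 * dl + 1 + rho + rho <= len (pow B Q).
  pose Q := (Num.truncn ((2 * C0 + 3 * dl + 1 + rho + rho + c') / c)).+1.
  exists Q; have := gr Q.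
  have h1 : (2 * C0 + 3 * dl + 1 + rho + rho + c') / c <= Q%:R by rewrite ltW // truncnS_gt.
  by move: h1; rewrite ler_pdivrMr // mulrC; lra.
pose s (i : nat) := mul (pow A i) (mul (pow B Q) (pow A (r - i))).
pose w (i : nat) := flatten (nseq i wA) ++ flatten (nseq Q wB) ++ flatten (nseq (r - i) wA).
have sw i : prodw (w i) = s i by rewrite /w !prodw_cat !prodw_flatten /prodw eA eB.
exists (r * size wA + Q * size wB)%N, (fun i => w i), (C0 + 2 * dl); split.
- move=> i; rewrite /w !size_cat !size_flatten_nseq addnCA -mulnDl.
  by rewrite subnKC ?(leq_ord i) // addnC.
- by move=> i; rewrite /w !all_cat; apply/and3P; split; apply: all_flatten_nseq.
have s_near i : (i <= r)%N -> d (act (s i) o) (act (pow A i) (act (pow B Q) o)) <= rho.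
  by move=> ir; rewrite /s !actM !act_isom -/(len _); apply: hrho; lia.
have si_near i : (i <= r)%N ->
    d (act (inv (s i)) o) (act (pow (inv A) (r - i)) (act (pow (inv B) Q) o)) <= rho.
  move=> ir; rewrite /s !ginvM -!powV !actM !act_isom -/(len _) powV lenV.
  exact: hrho.
have s1 (i j : 'I_r.+1) : i <> j -> gp (act (s i) o) (act (s j) o) <= C0.
  move=> ij; have := hC1 i j ij Q Q.
  have := gprod_lip_l met o (act (s i) o) (act (pow A i) (act (pow B Q) o)) (act (s j) o).
  have := gprod_lip_r met o (act (pow A i) (act (pow B Q) o)) (act (s j) o) (act (pow A j) (act (pow B Q) o)).
  by have := s_near i (leq_ord i); have := s_near j (leq_ord j); lra.
have s2 (i j : 'I_r.+1) : i <> j -> gp (act (inv (s i)) o) (act (inv (s j)) o) <= C0.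
  move=> ij; have := hC2 i j ij Q Q.
  have := gprod_lip_l met o (act (inv (s i)) o) (act (pow (inv A) (r - i)) (act (pow (inv B) Q) o)) (act (inv (s j)) o).
  have := gprod_lip_r met o (act (pow (inv A) (r - i)) (act (pow (inv B) Q) o)) (act (inv (s j)) o) (act (pow (inv A) (r - j)) (act (pow (inv B) Q) o)).
  by have := si_near i (leq_ord i); have := si_near j (leq_ord j); lra.
have s3 (i : 'I_r.+1) : 2 * C0 + 3 * dl + 1 <= len (s i).
  have e : pow B Q = mul (inv (pow A i)) (mul (s i) (inv (pow A (r - i)))).
    by rewrite /s -!gmulA gmulKV gmulVr gmul1r.
  have := lenM (inv (pow A i)) (mul (s i) (inv (pow A (r - i)))).
  have := lenM (s i) (inv (pow A (r - i))).
  rewrite -e !lenV; have := hrho i (leq_ord i); have := hrho (r - i)%N (leq_subr _ _).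
  by lra.
move=> x y.
(* An exceptional index if there is one, and the dummy [ord0] otherwise. *)
have pick_ex (P : 'I_r.+1 -> Prop) : exists i0, forall i, P i -> P i0.
  by case: (pselect (exists i, P i)) => [[i0 h]|h]; [exists i0|exists ord0 => i pi; case: h; exists i].
have [i1 h1] := pick_ex (fun i => C0 + dl < gp y (act (inv (s i)) o)).
have [i2 h2] := pick_ex (fun i => C0 + dl < gp x (act (s i) o)).
exists i1, i2 => i; rewrite sw => bad.
case: (ltP (C0 + dl) (gp y (act (inv (s i)) o))) => hi.
  left; apply: contrapT => ne; have := s2 _ _ ne; have := h1 i hi.
  have := gprod_hyp met hyp o (act (inv (s i)) o) (act (inv (s i1)) o) y.
  by rewrite (gprodC met _ (act (inv (s i)) o) y); lra.
right; have hi2 : C0 + dl < gp x (act (s i) o).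
  have := gprod_hyp met hyp o x (act (s i) o) (act (s i) y).
  suff : C0 + 2 * dl < gp (act (s i) y) (act (s i) o) by lra.
  rewrite (gprodC met) (gprod_swap met) -/(len _).
  have -> : gprod d (act (s i) o) o (act (s i) y) = gp y (act (inv (s i)) o).
    by rewrite -(gprod_act (s i) o y) actKV (gprodC met).
  by have := s3 i; lra.
apply: contrapT => ne; have := s1 _ _ ne; have := h2 i hi2.
have := gprod_hyp met hyp o (act (s i) o) (act (s i2) o) x.
by rewrite (gprodC met _ (act (s i) o) x); lra.
Qed.

(** The exponent given by WPD may be too small. In that case [g^P o] is near [o], so that already
    the set of elements that move [o] by at most [K] is finite, and any large exponent will do. *)
Lemma WPD_large g (K V : R) : WPD mul one d act g -> exists P,
  V <= len (pow g P) /\ finite_set (StabK d act K o (act (pow g P) o)).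
Proof.
move=> [lg wg].
have [V' [VV V0]] : exists V', V <= V' /\ 0 <= V'.
  by exists (Num.max V 0); rewrite !le_max !lexx orbT.
have [K' [KK K0]] : exists K', K <= K' /\ 0 <= K'.
  by exists (Num.max K 0); rewrite !le_max !lexx orbT.
have [|P [_ fP]] := wg o (K' + 2 * V'); first by lra.
case: (leP V (len (pow g P))) => hP.
  exists P; split=> //; apply: sub_finite_set fP => h [h1 h2]; split; lra.
have [c [c' [c0 gr]]] := lox_growth lg.
pose Q := (Num.truncn ((V + c') / c)).+1.
exists Q; split.
  have := gr Q; have : (V + c') / c <= Q%:R by rewrite ltW // truncnS_gt.
  by rewrite ler_pdivrMr // mulrC; lra.
apply: sub_finite_set fP => h [h1 h2]; split; first by lra.
have := dist_tri met (act (pow g P) o) o (act h (act (pow g P) o)).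
have := dist_tri met o (act h o) (act h (act (pow g P) o)).
rewrite act_isom (dist_sym met o (act (pow g P) o)) -/(len _); lra.
Qed.

(* The two words have the same length, and no point of [X] sees both of their
   products in the same direction; this is what makes the choice between them
   depend only on the past of the walk. *)
Lemma WPD_words g : WPD mul one d act g -> exists C1 : R, forall K V : R,
  exists w : bool -> seq G,
  [/\ size (w true) = size (w false),
      forall b, all (fun a => 0 < mu a) (w b),
      gp (act (prodw (w true)) o) (act (prodw (w false)) o) <= C1,
      forall b, V <= len (prodw (w b)) &
      forall b, finite_set (StabK d act K o (act (prodw (w b)) o))].
Proof.
move=> wg; have [lg _] := wg.
have [h1 [h2 [_ [_ dis]]]] := Hnonel.
have [a [C hC]] := lox_not_fixed lg dis.
exists (C + len a) => K V.
have [P [hV fP]] := WPD_large (K + len a + len a) (V + len a) wg.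
have [wa [_ [pa ea]]] := Hgen a; have [wgs [_ [pg eg]]] := Hgen g.
pose gP := flatten (nseq P wgs).
(* The products [g^P a] and [a g^P] point towards the limit point of [g] and its image under [a],
   which differ; the bound on their product does not depend on [P]. *)
exists (fun b => if b then gP ++ wa else wa ++ gP).
have E1 : prodw (gP ++ wa) = mul (pow g P) a by rewrite prodw_cat prodw_flatten /prodw ea eg.
have E2 : prodw (wa ++ gP) = mul a (pow g P) by rewrite prodw_cat prodw_flatten /prodw ea eg.
split.
- by rewrite !size_cat addnC.
- by case; rewrite all_cat pa (all_flatten_nseq P pg).
- rewrite E1 E2 !actM.
  have := gprod_lip_l met o (act (pow g P) (act a o)) (act (pow g P) o) (act a (act (pow g P) o)).
  by rewrite act_isom -/(len _) (gprodC met _ (act (pow g P) o)); have := hC P P; lra.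
- case; rewrite ?E1 ?E2.
    have := lenM (mul (pow g P) a) (inv a).
    by rewrite -gmulA gmulVr gmul1r lenV; lra.
  have := lenM (inv a) (mul a (pow g P)).
  by rewrite gmulKV lenV; lra.
case; rewrite ?E1 ?E2.
  apply: sub_finite_set fP => h [k1 k2]; split; first by have := len_ge0 a; lra.
  have := dist_tri met (act (pow g P) o) (act (mul (pow g P) a) o) (act h (act (pow g P) o)).
  have := dist_tri met (act (mul (pow g P) a) o) (act h (act (mul (pow g P) a) o)) (act h (act (pow g P) o)).
  move: k2; rewrite !actM !act_isom (dist_sym met o) -/(len a); lra.
(* The coarse stabilizer for [a g^P] is conjugated by [a] into the one for [g^P], the displacement
   of [o] growing by at most [2 len a]. *)
apply: (@sub_finite_set _ _ ((fun h => mul a (mul h (inv a))) @` StabK d act (K + len a + len a) o (act (pow g P) o))); last exact: finite_image.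
move=> h [k1 k2]; exists (mul (inv a) (mul h a)); last by rewrite -!gmulA gmulVK gmulVr gmul1r.
have la := len_ge0 a; split.
  have -> : d o (act (mul (inv a) (mul h a)) o) = d (act a o) (act h (act a o)).
    by rewrite -(act_isom a o) !actM actKV.
  have := dist_tri met (act a o) o (act h (act a o)).
  have := dist_tri met o (act h o) (act h (act a o)).
  rewrite act_isom (dist_sym met o (act a o)) -/(len a); lra.
rewrite -(act_isom a (act (pow g P) o)) !actM actKV.
by move: k2; rewrite !actM; lra.
Qed.

End Schottky.

(** * Expectations of bounded functions *)

Section Expectation.
Context {dT : measure_display} {T : measurableType dT} {R : realType}.
Variable P : probability T R.

(** [fine] turns an infinite integral into 0, so the calculus below asks for integrability, mostly
    in the form [bm]: bounded and measurable. *)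
Definition Ex (f : T -> R) : R := fine (\int[P]_x (f x)%:E)%E.
Definition Pr (A : set T) : R := fine (P A).
Definition bm (f : T -> R) : Prop := measurable_fun setT f /\ exists M, forall x, `|f x| <= M.

Lemma PrE A : measurable A -> P A = (Pr A)%:E.
Proof. by move=> mA; rewrite /Pr fineK // fin_num_measure. Qed.

Lemma Pr_ge0 A : 0 <= Pr A.
Proof. by rewrite /Pr fine_ge0. Qed.

Lemma Pr_setT : Pr setT = 1.
Proof. by rewrite /Pr probability_setT. Qed.

Lemma Pr_set0 : Pr set0 = 0.
Proof. by rewrite /Pr measure0. Qed.

Lemma Pr_le A B : measurable A -> measurable B -> A `<=` B -> Pr A <= Pr B.
Proof.
move=> mA mB AB; rewrite -lee_fin -!PrE //.
by apply: le_measure; rewrite ?inE.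
Qed.

Lemma Pr_le1 A : measurable A -> Pr A <= 1.
Proof. by move=> mA; rewrite -Pr_setT; exact: Pr_le. Qed.

Lemma PrC A : measurable A -> Pr (~` A) = 1 - Pr A.
Proof.
by move=> mA; rewrite /Pr probability_setC // fineB ?fin_num_measure.
Qed.

Lemma PrU_le A B : measurable A -> measurable B -> Pr (A `|` B) <= Pr A + Pr B.
Proof.
move=> mA mB; rewrite -lee_fin EFinD -!PrE //; last exact: measurableU.
exact: measureU2.
Qed.

Lemma Pr_bigcup_le (F : nat -> set T) c : (forall n, measurable (F n)) ->
  nondecreasing_seq F -> (forall n, Pr (F n) <= c) -> Pr (\bigcup_n F n) <= c.
Proof.
move=> mF ndF hc; have mU : measurable (\bigcup_n F n) by exact: bigcupT_measurable.
rewrite -lee_fin -PrE //.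
have := nondecreasing_cvg_mu (mu := P) mF mU ndF.
move=> /cvg_lim <- //; apply: lime_le => [|].
  by apply/cvg_ex; exists (P (\bigcup_n F n)); exact: nondecreasing_cvg_mu.
by apply: nearW => n /=; rewrite PrE // lee_fin.
Qed.

Lemma Pr_bigcap_le (F : nat -> set T) e : (forall n, measurable (F n)) ->
  nonincreasing_seq F -> \bigcap_n F n = set0 -> 0 < e -> exists n, Pr (F n) <= e.
Proof.
move=> mF niF F0 e0; apply: contrapT => /forallNP hn.
have hn' n : Pr (~` F n) <= 1 - e.
  by rewrite PrC //; have := hn n; move=> /negP; rewrite -ltNge; lra.
have := @Pr_bigcup_le (fun n => ~` F n) (1 - e) (fun n => measurableC (mF n)) _ hn'.
have -> : \bigcup_n ~` F n = setT by rewrite -setC_bigcap F0 setC0.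
rewrite Pr_setT => h; have {h} : 1 <= 1 - e.
  by apply: h => m n mn; apply/subsetPset; apply: subsetC; apply/subsetPset/niF.
by lra.
Qed.

Lemma bm_integrable f : bm f -> P.-integrable setT (EFin \o f).
Proof.
move=> [mf [M hM]]; apply: measurable_bounded_integrable => //.
  by rewrite ltey_eq fin_num_measure.
exists M; split; first exact: num_real.
by move=> x Mx y _ /=; apply: le_trans (hM y) _; exact: ltW.
Qed.

Lemma ExE f : P.-integrable setT (EFin \o f) -> (\int[P]_x (f x)%:E)%E = (Ex f)%:E.
Proof. by move=> h; rewrite /Ex fineK //; exact: integrable_fin_num. Qed.

Lemma bm_ExE f : bm f -> (\int[P]_x (f x)%:E)%E = (Ex f)%:E.
Proof. by move=> /bm_integrable/ExE. Qed.

Lemma bm_cst c : bm (fun=> c).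
Proof. by split; [exact: measurable_cst|exists `|c|]. Qed.

Lemma bmD f g : bm f -> bm g -> bm (fun x => f x + g x).
Proof.
move=> [mf [M hM]] [mg [N hN]]; split; first exact: measurable_funD.
by exists (M + N) => x; apply: le_trans (ler_normD _ _) _; rewrite lerD.
Qed.

Lemma bmZ c f : bm f -> bm (fun x => c * f x).
Proof.
move=> [mf [M hM]]; split; first by apply: measurable_funM => //; exact: measurable_cst.
by exists (`|c| * M) => x; rewrite normrM ler_wpM2l.
Qed.

Lemma bmN f : bm f -> bm (fun x => - f x).
Proof. by move=> /(bmZ (-1)); under eq_fun do rewrite mulN1r. Qed.

Lemma bmB f g : bm f -> bm g -> bm (fun x => f x - g x).
Proof. by move=> hf /bmN; exact: bmD. Qed.

Lemma bm_indic A : measurable A -> bm (\1_A : T -> R).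
Proof.
by move=> mA; split; [exact: measurable_indic|exists 1 => x; rewrite indicE; case: (_ \in _); rewrite ?normr1 ?normr0].
Qed.

Lemma bm_sum (I : Type) (s : seq I) (f : I -> T -> R) :
  (forall i, bm (f i)) -> bm (fun x => \sum_(i <- s) f i x).
Proof.
move=> h; elim: s => [|i s IH]; first by under eq_fun do rewrite big_nil; exact: bm_cst.
by under eq_fun do rewrite big_cons; exact: bmD.
Qed.

Lemma iExD f g : P.-integrable setT (EFin \o f) -> P.-integrable setT (EFin \o g) ->
  Ex (fun x => f x + g x) = Ex f + Ex g.
Proof. by move=> hf hg; exact: (RintegralD measurableT hf hg). Qed.

Lemma iExB f g : P.-integrable setT (EFin \o f) -> P.-integrable setT (EFin \o g) ->
  Ex (fun x => f x - g x) = Ex f - Ex g.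
Proof. by move=> hf hg; exact: (RintegralB measurableT hf hg). Qed.

Lemma iExZ c f : P.-integrable setT (EFin \o f) -> Ex (fun x => c * f x) = c * Ex f.
Proof. by move=> hf; exact: RintegralZl. Qed.

Lemma iEx_le f g : P.-integrable setT (EFin \o f) -> P.-integrable setT (EFin \o g) ->
  (forall x, f x <= g x) -> Ex f <= Ex g.
Proof. by move=> hf hg fg; apply: (le_Rintegral measurableT hf hg) => x _. Qed.

Lemma ExD f g : bm f -> bm g -> Ex (fun x => f x + g x) = Ex f + Ex g.
Proof. by move=> /bm_integrable hf /bm_integrable hg; exact: iExD. Qed.

Lemma ExB f g : bm f -> bm g -> Ex (fun x => f x - g x) = Ex f - Ex g.
Proof. by move=> /bm_integrable hf /bm_integrable hg; exact: iExB. Qed.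

Lemma ExZ c f : bm f -> Ex (fun x => c * f x) = c * Ex f.
Proof. by move=> /bm_integrable hf; exact: iExZ. Qed.

Lemma Ex_cst c : Ex (fun=> c) = c.
Proof. by rewrite /Ex integral_cst // [X in (_ * X)%E](_ : _ = 1%E) ?mule1 //; exact: probability_setT. Qed.

Lemma Ex_le f g : bm f -> bm g -> (forall x, f x <= g x) -> Ex f <= Ex g.
Proof. by move=> /bm_integrable hf /bm_integrable hg; exact: iEx_le. Qed.

Lemma Ex_ge0 f : (forall x, 0 <= f x) -> 0 <= Ex f.
Proof. by move=> h; rewrite /Ex fine_ge0 // integral_ge0 // => x _; rewrite lee_fin. Qed.

Lemma Ex_indic A : measurable A -> Ex (\1_A : T -> R) = Pr A.
Proof. by move=> mA; rewrite /Ex integral_indic // setIT. Qed.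

Lemma Ex_sum (I : Type) (s : seq I) (f : I -> T -> R) : (forall i, bm (f i)) ->
  Ex (fun x => \sum_(i <- s) f i x) = \sum_(i <- s) Ex (f i).
Proof.
move=> h; elim: s => [|i s IH].
  by rewrite big_nil; under eq_fun do rewrite big_nil; exact: Ex_cst.
under eq_fun do rewrite big_cons.
by rewrite big_cons ExD ?IH //; exact: bm_sum.
Qed.

Lemma eq_Ex f g : f =1 g -> Ex f = Ex g.
Proof. by move=> /funext ->. Qed.

Lemma Ex_norm_le f M : bm f -> (forall x, `|f x| <= M) -> `|Ex f| <= M.
Proof.
move=> bf h; rewrite ler_norml; apply/andP; split.
  have := @Ex_le _ _ (bm_cst (- M)) bf; rewrite Ex_cst; apply => x.
  by have := h x; rewrite ler_norml => /andP[].
have := @Ex_le _ _ bf (bm_cst M); rewrite Ex_cst; apply => x.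
by have := h x; rewrite ler_norml => /andP[].
Qed.

Section Discrete.
Variables (V : countType) (X : T -> V).
Hypothesis mX : forall v, measurable (X @^-1` [set v]).

Lemma disc_preimage (A : set V) : measurable (X @^-1` A).
Proof.
have -> : X @^-1` A = \bigcup_(v in A) (X @^-1` [set v]).
  by apply/seteqP; split=> [x Ax|x [v Av /= ->]] //; exists (X x).
rewrite bigcup_mkcond; apply: countable_bigcupT_measurable => [|v].
  exact: countableP.
by case: ifP.
Qed.

Lemma disc_measurable dV (V' : measurableType dV) (f : V -> V') : measurable_fun setT (fun x => f (X x)).
Proof. by move=> _ Y mY; rewrite setTI (_ : _ @^-1` _ = X @^-1` (f @^-1` Y)) //; exact: disc_preimage. Qed.

Lemma bm_disc (f : V -> R) M : (forall v, `|f v| <= M) -> bm (fun x => f (X x)).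
Proof. by move=> h; split; [exact: disc_measurable|exists M]. Qed.

(** The fibres of [X], numbered by [pickle], form a countable partition into pieces on which the
    integrand is constant. *)
Lemma disc_integral (f : V -> \bar R) : (forall v, 0 <= f v)%E ->
  (\int[P]_x f (X x) = \esum_(v in [set: V]) (f v * P (X @^-1` [set v])))%E.
Proof.
move=> f0.
(* [unpickle] may send several numbers to the same [v]; the test on [pickle v] keeps only one of
   them. *)
pose F (n : nat) : set T := if unpickle n is Some v then
  (if pickle v == n then X @^-1` [set v] else set0) else set0.
have mF n : measurable (F n) by rewrite /F; case: (unpickle n) => // v; case: ifP.
have FU : \bigcup_n F n = setT.
  apply/seteqP; split=> // x _; exists (pickle (X x)) => //=.
  by rewrite /F pickleK eqxx.
have Fin n x : F n x -> n = pickle (X x).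
  by rewrite /F; case: (unpickle n) => // v; case: ifP => // /eqP <- /= ->.
have trF : trivIset setT F.
  by apply/trivIsetP => i j _ _ ij; apply/seteqP; split=> // x [/Fin e1 /Fin e2]; move/eqP: ij; rewrite e1 e2.
have mF' : measurable_fun (\bigcup_n F n) (fun x => f (X x)).
  by rewrite FU; exact: disc_measurable.
rewrite -[in LHS]FU (ge0_integral_bigcup P mF mF') //.
pose a n := (if unpickle n is Some v then
    (if pickle v == n then f v * P (X @^-1` [set v]) else 0) else 0)%E.
transitivity (\sum_(n <oo) a n)%E.
  apply: eq_eseriesr => n _; rewrite /F /a; case: (unpickle n) => [v|]; last by rewrite integral_set0.
  case: ifP => _; last by rewrite integral_set0.
  rewrite (eq_integral (cst (f v))) ?integral_cst //.
  by move=> x; rewrite inE /= => ->.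
have a0 n : (0 <= a n)%E.
  rewrite /a; case: (unpickle n) => // v; case: ifP => // _.
  by apply: mule_ge0 => //; exact: f0.
rewrite nneseries_esumT // (esumID (range (@pickle V))) //.
rewrite [X in (_ + X)%E]esum1 ?adde0 ?setTI; last first.
  move=> n /= ne; rewrite /a; case E : (unpickle n) => [v|] //; case: ifP => // /eqP en.
  by exfalso; apply: ne; exists v.
rewrite (@reindex_esum R V nat setT (range (@pickle V)) (@pickle V) a) //; last first.
  split=> [v _|v v' _ _ /(pcan_inj (@pickleK V))|n [v _ <-]] //; exists v => //.
by apply: eq_esum => v _; rewrite /a pickleK eqxx.
Qed.

End Discrete.
End Expectation.

(** The parameter [one] supplies the distinguished point that a measurable type must have. *)
Definition path_space (G : countType) (one : G) : Type := nat -> G.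
HB.instance Definition _ (G : countType) (one : G) := gen_eqMixin (path_space one).
HB.instance Definition _ (G : countType) (one : G) := gen_choiceMixin (path_space one).
HB.instance Definition _ (G : countType) (one : G) :=
  isPointed.Build (path_space one) (fun=> one).

Definition incs (G : countType) (one : G) :=
  g_sigma_algebraType (@path_cylinders G : set (set (path_space one))).
HB.instance Definition _ (G : countType) (one : G) := Measurable.on (incs one).

(** * The space of increments *)

Section PathSpace.
Variables (G : countType) (one : G).
Local Notation T := (incs one).

Definition pre (n : nat) (s : nat -> G) : seq G := mkseq s n.
Definition drops (n : nat) (s : nat -> G) : nat -> G := fun i => s (n + i)%N.
Definition glue (n : nat) (s s' : nat -> G) : nat -> G :=
  fun i => if (i < n)%N then s i else s' (i - n)%N.

Lemma size_pre n s : size (pre n s) = n. Proof. exact: size_mkseq. Qed.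

Lemma nth_pre x n s i : (i < n)%N -> nth x (pre n s) i = s i.
Proof. exact: nth_mkseq. Qed.

Lemma pre_glue n s s' : pre n (glue n s s') = pre n s.
Proof. by apply/eq_in_map => i; rewrite mem_iota /glue /= => ->. Qed.

Lemma drops_glue n s s' : drops n (glue n s s') = s'.
Proof. by apply/funext => i; rewrite /drops /glue ltnNge leq_addr /= addKn. Qed.

Lemma pre_take m n s : (m <= n)%N -> take m (pre n s) = pre m s.
Proof. by move=> mn; rewrite /pre /mkseq -map_take take_iota (minn_idPl mn). Qed.

Lemma preD m n s : pre (m + n) s = pre m s ++ pre n (drops m s).
Proof.
apply: (@eq_from_nth _ one) => [|i]; rewrite ?size_cat !size_pre // => i_lt.
rewrite nth_cat size_pre nth_pre //; case: ltnP => im; first by rewrite nth_pre.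
by rewrite nth_pre /drops ?subnKC //; lia.
Qed.

Lemma drops_drops m n s : drops m (drops n s) = drops (n + m) s.
Proof. by apply/funext => i; rewrite /drops addnA. Qed.

Lemma measurable_coord n (a : G) : measurable ([set s | s n = a] : set T).
Proof. by apply: sub_gen_smallest; exists n, a. Qed.

Lemma measurable_atom n (a : seq G) : measurable ([set s | pre n s = a] : set T).
Proof.
have -> : [set s | pre n s = a] =
    if size a == n then \bigcap_(i < n) [set s : T | s i = nth one a i] else set0.
  apply/seteqP; split=> s /=.
    by move=> <-; rewrite size_pre eqxx => i /= ?; rewrite nth_pre.
  case: eqP => // sa h; apply: (@eq_from_nth _ one); rewrite size_pre // => i iN.
  by rewrite nth_pre // h.
case: ifP => // _; rewrite bigcap_mkcond; apply: bigcapT_measurable => i.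
by case: ifP => // _; exact: measurable_coord.
Qed.

Lemma measurable_pre n (A : set (seq G)) : measurable ([set s | A (pre n s)] : set T).
Proof. exact: (@disc_preimage _ T (seq G : countType) (pre n) (measurable_atom n) A). Qed.

(** Unlike the one-coordinate cylinders, these are closed under intersection, as the uniqueness
    theorem for measures requires. *)
Definition atoms : set (set T) := [set A | exists n a, A = [set s | pre n s = a]].

Lemma atoms_gen : @measurable _ T = <<s atoms >>.
Proof.
apply/seteqP; split.
  apply: smallest_sub; first exact: smallest_sigma_algebra.
  move=> _ [i [a ->]].
  have -> : [set x : T | x i = a] = \bigcup_(b in [set b : seq G | nth one b i = a])
      [set s | pre i.+1 s = b].
    apply/seteqP; split=> s /=.
      by move=> <-; exists (pre i.+1 s) => //=; rewrite nth_pre.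
    by move=> [b /= <- <-]; rewrite nth_pre.
  have [_ _ hU] := smallest_sigma_algebra setT atoms.
  rewrite bigcup_mkcond.
  pose F n := if unpickle n is Some b then
     (if b \in [set b : seq G | nth one b i = a] then [set s : T | pre i.+1 s = b] else set0)
     else set0.
  have -> : \bigcup_b (if b \in [set b : seq G | nth one b i = a] then [set s : T | pre i.+1 s = b] else set0)
      = \bigcup_n F n.
    apply/seteqP; split=> s [b _ h]; first by exists (pickle b) => //; rewrite /F pickleK.
    by move: h; rewrite /F; case: (unpickle b) => // c h; exists c.
  apply: hU => n; rewrite /F; case: (unpickle n) => [b|]; last exact: sigma_algebra0.
  case: ifP => _; last exact: sigma_algebra0.
  by apply: sub_gen_smallest; exists i.+1, b.
apply: smallest_sub; first exact: smallest_sigma_algebra.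
by move=> _ [n [a ->]]; exact: measurable_atom.
Qed.

Lemma atoms_setI : setI_closed atoms.
Proof.
move=> _ _ [n [a ->]] [m [b ->]]; wlog nm : n m a b / (n <= m)%N.
  move=> W; case/orP: (leq_total n m) => h; first exact: W.
  by rewrite setIC; exact: W.
have [ab|ab] := pselect (take n b = a).
  exists m, b; apply/seteqP; split=> s /=; first by case.
  by move=> h; split=> //; rewrite -ab -h pre_take.
(* A prefix of length 0 is never a one-letter word: this is the empty set written as an atom. *)
exists 0%N, [:: one]; apply/seteqP; split=> s //= -[ha hb].
by exfalso; apply: ab; rewrite -ha -hb pre_take.
Qed.

Lemma measurable_glue n : measurable_fun setT (fun z : T * T => glue n z.1 z.2 : T).
Proof.
apply: (measurability (@path_cylinders G : set (set T))) => // _ [_ [i [a ->]] <-].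
rewrite setTI /glue /preimage /=; case: (ltnP i n) => h.
  rewrite (_ : [set _ | _] = fst @^-1` ([set s : T | s i = a])) //.
  by rewrite -[X in measurable X]setTI; apply: measurable_fst => //; exact: measurable_coord.
rewrite (_ : [set _ | _] = snd @^-1` ([set s : T | s (i - n)%N = a])) //.
by rewrite -[X in measurable X]setTI; apply: measurable_snd => //; exact: measurable_coord.
Qed.

Lemma measurable_drops n : measurable_fun setT (drops n : T -> T).
Proof.
apply: (measurability (@path_cylinders G : set (set T))) => // _ [_ [i [a ->]] <-].
by rewrite setTI; exact: (measurable_coord (n + i) a).
Qed.

Lemma measurable_preshift (m : nat) (Phi : seq G -> set T) :
  (forall a, measurable (Phi a)) -> measurable [set s : T | Phi (pre m s) (drops m s)].
Proof.
move=> mPhi.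
rewrite (_ : [set _ | _] = \bigcup_a ([set s : T | pre m s = a] `&` drops m @^-1` (Phi a))).
  apply: countable_bigcupT_measurable => [|a]; first exact: countableP.
  apply: measurableI; first exact: measurable_atom.
  by rewrite -[X in measurable X]setTI; exact: measurable_drops.
by apply/seteqP; split=> s /= => [h|[a _ [/= -> h]]] //; exists (pre m s).
Qed.

Section Law.
Variables (R : realType) (mu : G -> R) (Q : probability T R).

Hypothesis HQ : iid_law Q mu (fun i (s : T) => s i).

Definition muw (a : seq G) : R := \prod_(x <- a) mu x.

Lemma muw_cat a b : muw (a ++ b) = muw a * muw b.
Proof. by rewrite /muw big_cat. Qed.

Lemma Q_atom n (a : seq G) :
  Q [set s | pre n s = a] = (if size a == n then muw a else 0)%:E.
Proof.
case: eqP => [sa|ne]; last first.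
  rewrite (_ : [set _ | _] = set0) ?measure0 //.
  by apply/seteqP; split=> s //= h; apply: ne; rewrite -h size_pre.
have := HQ.2 n (nth one a); rewrite (_ : [set _ | _] = [set s : T | pre n s = a]).
  by move=> ->; rewrite /muw (big_nth one) big_mkord sa.
apply/seteqP; split=> s /= h.
  by apply: (@eq_from_nth _ one); rewrite size_pre // => i iN; rewrite nth_pre // h.
by move=> i iN; rewrite -h nth_pre.
Qed.

(** Independence of the increments in the form used below: replacing everything after time [n] by an
    independent copy does not change the law. It is checked on atoms. *)
Lemma Q_glue n (B : set T) : measurable B ->
  Q B = pushforward (Q \x Q)%E (fun z : T * T => glue n z.1 z.2 : T) B.
Proof.
move=> mB; have mg := @measurable_glue n.
pose m2 : {measure set T -> \bar R} := pushforward (Q \x Q)%E (fun z : T * T => glue n z.1 z.2 : T).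
refine (@measure_unique _ R T atoms (fun=> setT) atoms_gen atoms_setI _ _ Q (m2 mg) _ _ B mB).
- by move=> _; exists 0%N, [::]; apply/seteqP; split.
- by rewrite bigcup_const //; exists 0%N.
- move=> _ [k [a ->]]; rewrite /m2 /= /pushforward Q_atom.
  have [kn|nk] := leqP k n.
    rewrite (_ : _ @^-1` _ = [set s : T | pre k s = a] `*` setT).
      rewrite product_measure1E //; last exact: measurable_atom.
      transitivity (Q [set s | pre k s = a] * Q setT)%E => //.
      by rewrite probability_setT mule1 Q_atom.
    have e s s' : pre k (glue n s s') = pre k s.
      by rewrite -(pre_take _ kn) pre_glue pre_take.
    by apply/seteqP; split=> -[s s'] /=; rewrite e // => -[].
  rewrite (_ : _ @^-1` _ = [set s : T | pre n s = take n a] `*` [set s : T | pre (k - n) s = drop n a]).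
    rewrite product_measure1E; [|exact: measurable_atom|exact: measurable_atom].
    transitivity (Q [set s | pre n s = take n a] * Q [set s | pre (k - n) s = drop n a])%E => //.
    rewrite !Q_atom -EFinM; congr EFin.
    rewrite size_take size_drop; case: eqP => [->|ne].
      by rewrite nk !eqxx -muw_cat cat_take_drop.
    by rewrite (_ : (size a - n == k - n)%N = false) ?mulr0 //; lia.
  have e s s' : pre k (glue n s s') = pre n s ++ pre (k - n) s'.
    by rewrite -{1}(subnKC (ltnW nk)) preD pre_glue drops_glue.
  apply/seteqP; split=> -[s s'] /=; rewrite e.
    by move=> <-; rewrite take_size_cat ?drop_size_cat ?size_pre.
  by move=> [-> ->]; rewrite cat_take_drop.
- by rewrite -ge0_fin_numE // fin_num_measure.
Qed.

Lemma ind_ge0 n (F : T -> \bar R) : measurable_fun setT F -> (forall s, 0 <= F s)%E ->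
  (\int[Q]_s F s = \int[Q]_s \int[Q]_s' F (glue n s s'))%E.
Proof.
move=> mF F0; have mg := @measurable_glue n.
pose m2 : {measure set T -> \bar R} := pushforward (Q \x Q)%E (fun z : T * T => glue n z.1 z.2 : T).
rewrite (@eq_measure_integral _ _ _ setT (m2 mg)); last by move=> A mA _; exact: Q_glue.
rewrite ge0_integral_pushforward // preimage_setT.
rewrite fubini_tonelli1 //=; last exact: measurableT_comp.
Qed.

End Law.
End PathSpace.

(** The walk lives on the canonical space of increments; the probability space of the theorem enters
    only at the end, through the law of its increments. *)
Record rwalk (R : realType) := RWalk {
  action_of :> hyp_action R;
  mu_of : G_of action_of -> R;
  mu_prob : prob_on mu_of;
  mu_gen : generating (@mul_of R action_of) (@one_of R action_of) mu_of;
  mu_ent : finite_entropy mu_of;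
  nonel_of : non_elementary (@mul_of R action_of) (@one_of R action_of)
    (@d_of R action_of) (@o_of R action_of) (@act_of R action_of);
  wpd_of : exists g, WPD (@mul_of R action_of) (@one_of R action_of)
    (@d_of R action_of) (@act_of R action_of) g;
  Q_of : probability (incs (@one_of R action_of)) R;
  Q_iid : iid_law Q_of mu_of (fun i (s : incs (@one_of R action_of)) => s i) }.

(** * Measurability of sets described by quantifiers over countable types *)

Section MeasurableSets.
Context {dT : measure_display} {T : measurableType dT}.

Lemma meas_ex (V : countType) (F : V -> set T) :
  (forall k, measurable (F k)) -> measurable [set s | exists k, F k s].
Proof.
move=> h; rewrite (_ : [set _ | _] = \bigcup_k F k).
  by apply: countable_bigcupT_measurable => //; exact: countableP.
by apply/seteqP; split=> s [k]; [move=> hk; exists k|move=> _ hk; exists k].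
Qed.

Lemma meas_not (A : set T) : measurable A -> measurable [set s | ~ A s].
Proof. exact: measurableC. Qed.

Lemma meas_all (V : countType) (F : V -> set T) :
  (forall k, measurable (F k)) -> measurable [set s | forall k, F k s].
Proof.
move=> h; rewrite (_ : [set _ | _] = ~` [set s | exists k, ~ F k s]).
  by apply: measurableC; apply: meas_ex => k; exact: measurableC.
apply/seteqP; split=> s /=; first by move=> H [k]; apply.
by move=> H k; apply: contrapT => h'; apply: H; exists k.
Qed.

Lemma meas_and (A B : set T) : measurable A -> measurable B -> measurable [set s | A s /\ B s].
Proof. exact: measurableI. Qed.

Lemma meas_or (A B : set T) : measurable A -> measurable B -> measurable [set s | A s \/ B s].
Proof. exact: measurableU. Qed.

Lemma meas_cst (p : Prop) : measurable [set _ : T | p].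
Proof.
have [h|h] := pselect p.
  by rewrite (_ : [set _ | _] = setT) //; apply/seteqP; split.
by rewrite (_ : [set _ | _] = set0) //; apply/seteqP; split.
Qed.

Lemma meas_imp (p : Prop) (A : set T) : measurable A -> measurable [set s | p -> A s].
Proof.
move=> mA; have [h|h] := pselect p.
  by rewrite (_ : [set _ | _] = A) //; apply/seteqP; split=> s /= => [/(_ h)|].
by rewrite (_ : [set _ | _] = setT) //; apply/seteqP; split=> s //= _ /h.
Qed.

End MeasurableSets.

(** * The random walk *)

Section Walk.
Variables (R : realType) (W : rwalk R).
Local Notation G := (G_of W).
Local Notation mul := (@mul_of R W).
Local Notation one := (@one_of R W).
Local Notation X := (X_of W).
Local Notation mu := (@mu_of R W).
Local Notation Q := (@Q_of R W).
Local Notation T := (incs one).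
Local Notation Ex := (Ex Q).
Local Notation Pr := (Pr Q).
Local Notation pre := (@pre G).
Local Notation drops := (@drops G).
Local Notation prodw := (@prodw R W).
Local Notation inv := (@inv_of R W).
Local Notation d := (@d_of R W).
Local Notation dl := (@dl_of R W).
Local Notation o := (@o_of R W).
Local Notation act := (@act_of R W).
Local Notation gp := (gprod d o).
Local Notation met := (@met_of R W).
Local Notation hyp := (@hyp_of R W).
Local Notation dl0 := (@dl_of_ge0 R W).
Local Notation bp := (bpoint d o).
Local Notation borel := (bborel d o).

Lemma mu_ge0 a : 0 <= mu a. Proof. by have [h _] := mu_prob W. Qed.

(** The Markov property at time [n]: given the prefix, the remaining increments form a fresh
    sample. *)
Lemma ind_pre_ge0 n (f : seq G -> T -> \bar R) :
  (forall a, measurable_fun setT (f a)) -> (forall a s, 0 <= f a s)%E ->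
  (\int[Q]_s f (pre n s) (drops n s) = \int[Q]_s \int[Q]_s' f (pre n s) s')%E.
Proof.
move=> mf f0; rewrite (ind_ge0 (Q_iid W) n (F := fun s => f (pre n s) (drops n s))) //.
  by apply: eq_integral => s _; apply: eq_integral => s' _; rewrite pre_glue drops_glue.
move=> _ Y mY; rewrite setTI.
apply: (measurable_preshift n (Phi := fun a => f a @^-1` Y)) => a.
by rewrite -[X in measurable X]setTI; exact: mf.
Qed.

Lemma bm_pre n (f : seq G -> R) M : (forall a, `|f a| <= M) -> bm (fun s : T => f (pre n s)).
Proof. exact: (bm_disc (measurable_atom n)). Qed.

Lemma ind_pre n (f : seq G -> T -> R) M : (forall a, measurable_fun setT (f a)) ->
  (forall a s, `|f a s| <= M) ->
  Ex (fun s => f (pre n s) (drops n s)) = Ex (fun s => Ex (f (pre n s))).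
Proof.
move=> mf hM.
have bf a : bm (f a) by split=> //; exists M.
have bF : bm (fun s : T => f (pre n s) (drops n s)).
  split; last by exists M.
  move=> _ Y mY; rewrite setTI.
  apply: (measurable_preshift n (Phi := fun a => f a @^-1` Y)) => a.
  by rewrite -[X in measurable X]setTI; exact: mf.
have bE : bm (fun s : T => Ex (f (pre n s))).
  by apply: (@bm_pre n (fun a => Ex (f a)) M) => a; exact: Ex_norm_le.
(* Adding [M] reduces the bounded case to the nonnegative one. *)
have h0 a s : (0 <= (f a s + M)%:E)%E.
  by rewrite lee_fin; have := hM a s; rewrite ler_norml => /andP[]; lra.
have := ind_pre_ge0 n (f := fun a s => (f a s + M)%:E) _ h0.
rewrite bm_ExE; last by apply: bmD => //; exact: bm_cst.
rewrite (eq_integral (fun s : T => (Ex (f (pre n s)) + M)%:E)); last first.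
  by move=> s _; rewrite bm_ExE ?ExD ?Ex_cst //; [exact: bm_cst|apply: bmD => //; exact: bm_cst].
rewrite bm_ExE; last by apply: bmD => //; exact: bm_cst.
rewrite !ExD ?Ex_cst //; try exact: bm_cst.
move=> H; have mf' a : measurable_fun setT (fun s : T => (f a s + M)%:E).
  apply/measurable_EFinP; apply: measurable_funD => //; exact: measurable_cst.
by have [] := H mf'; lra.
Qed.

Lemma ind_pre_set n (Phi : seq G -> set T) : (forall a, measurable (Phi a)) ->
  Pr [set s | Phi (pre n s) (drops n s)] = Ex (fun s => Pr (Phi (pre n s))).
Proof.
move=> mPhi; rewrite -Ex_indic; last exact: measurable_preshift.
rewrite (eq_Ex _ (g := fun s : T => \1_(Phi (pre n s)) (drops n s))); last first.
  by move=> s; rewrite !indicE; congr (_ %:R); congr nat_of_bool; apply/idP/idP; rewrite !inE.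
rewrite (ind_pre (f := fun a => \1_(Phi a)) n (M := 1)) //.
- by apply: eq_Ex => s; rewrite Ex_indic.
- by move=> a s; rewrite indicE; case: (_ \in _); rewrite ?normr1 ?normr0.
Qed.

Definition pos (s : nat -> G) n : G := prodw (pre n s).

Lemma pos0 s : pos s 0 = one. Proof. by []. Qed.

Lemma posD s m n : pos s (m + n) = mul (pos s m) (pos (drops m s) n).
Proof. by rewrite /pos (preD one) prodw_cat. Qed.

Lemma posS s n : pos s n.+1 = mul (pos s n) (s n).
Proof. by rewrite -addn1 posD /pos /pre /mkseq /= gmul1r /drops addn0. Qed.

Lemma measurable_pos n (A : set G) : measurable ([set s | A (pos s n)] : set T).
Proof. exact: (measurable_pre n (fun a => A (prodw a))). Qed.

(** The [n]-th power of the Markov operator of the walk; [TnDn] is its semigroup property. *)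
Definition Tn n (f : G -> R) (g : G) : R := Ex (fun s => f (mul g (pos s n))).

Definition bdd (f : G -> R) := exists M, forall g, `|f g| <= M.

Lemma bm_pos f g n : bdd f -> bm (fun s : T => f (mul g (pos s n))).
Proof. by move=> [M h]; apply: (@bm_pre n (fun a => f (mul g (prodw a))) M). Qed.

Lemma bdd_cst c : bdd (fun=> c). Proof. by exists `|c|. Qed.

Lemma bdd01 f : (forall g, 0 <= f g <= 1) -> bdd f.
Proof. by move=> h; exists 1 => g; have /andP[h0 h1] := h g; rewrite ger0_norm. Qed.

Lemma bdd_bool (b : G -> bool) : bdd (fun g => (b g)%:R).
Proof. by apply: bdd01 => g; case: (b g); rewrite ?lexx ?ler01. Qed.

Lemma bddD f f' : bdd f -> bdd f' -> bdd (fun g => f g + f' g).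
Proof.
move=> [M h] [M' h']; exists (M + M') => g.
by apply: le_trans (ler_normD _ _) _; rewrite lerD.
Qed.

Lemma bddZ c f : bdd f -> bdd (fun g => c * f g).
Proof. by move=> [M h]; exists (`|c| * M) => g; rewrite normrM ler_wpM2l. Qed.

Lemma bddB f f' : bdd f -> bdd f' -> bdd (fun g => f g - f' g).
Proof. by move=> h /(bddZ (-1)) /(bddD h); under eq_fun do rewrite mulN1r. Qed.

Lemma bdd_sum (I : Type) (r : seq I) (f : I -> G -> R) : (forall i, bdd (f i)) ->
  bdd (fun g => \sum_(i <- r) f i g).
Proof.
move=> h; elim: r => [|i r IH]; first by under eq_fun do rewrite big_nil; exact: bdd_cst.
by under eq_fun do rewrite big_cons; exact: bddD.
Qed.

Lemma bdd_mul h f : bdd f -> bdd (fun g => f (mul h g)).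
Proof. by move=> [M hM]; exists M. Qed.

Lemma Tn_le n f f' g : bdd f -> bdd f' -> (forall g, f g <= f' g) -> Tn n f g <= Tn n f' g.
Proof. by move=> hf hf' h; apply: Ex_le; [exact: bm_pos|exact: bm_pos|move=> s; exact: h]. Qed.

Lemma TnD n f f' g : bdd f -> bdd f' -> Tn n (fun g => f g + f' g) g = Tn n f g + Tn n f' g.
Proof. by move=> hf hf'; apply: (ExD Q (bm_pos g n hf) (bm_pos g n hf')). Qed.

Lemma TnB n f f' g : bdd f -> bdd f' -> Tn n (fun g => f g - f' g) g = Tn n f g - Tn n f' g.
Proof. by move=> hf hf'; apply: (ExB Q (bm_pos g n hf) (bm_pos g n hf')). Qed.

Lemma TnZ n c f g : bdd f -> Tn n (fun g => c * f g) g = c * Tn n f g.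
Proof. by move=> hf; apply: (ExZ Q c (bm_pos g n hf)). Qed.

Lemma Tn_cst n c g : Tn n (fun=> c) g = c. Proof. exact: Ex_cst. Qed.

Lemma Tn_sum (I : Type) (r : seq I) n (f : I -> G -> R) g : (forall i, bdd (f i)) ->
  Tn n (fun g => \sum_(i <- r) f i g) g = \sum_(i <- r) Tn n (f i) g.
Proof. by move=> h; exact: (Ex_sum Q r (fun i => bm_pos g n (h i))). Qed.

Lemma Tn_ge0 n f g : (forall g, 0 <= f g) -> 0 <= Tn n f g.
Proof. by move=> h; exact: Ex_ge0. Qed.

Lemma Tn01 n f g : (forall g, 0 <= f g <= 1) -> 0 <= Tn n f g <= 1.
Proof.
move=> h; rewrite Tn_ge0 ?andTb => [|g']; last by case/andP: (h g').
rewrite -(Tn_cst n 1 g); apply: Tn_le; [exact: bdd01|exact: bdd_cst|].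
by move=> g'; case/andP: (h g').
Qed.

Lemma Tn_bdd n f : bdd f -> bdd (Tn n f).
Proof.
move=> [M h]; exists M => g; apply: Ex_norm_le => [|s]; last exact: h.
by apply: bm_pos; exists M.
Qed.

Lemma Tn0 f g : Tn 0 f g = f g.
Proof. by rewrite /Tn; under eq_fun do rewrite pos0 gmul1r; exact: Ex_cst. Qed.

Lemma Tn_mull n f h g : Tn n f (mul h g) = Tn n (fun k => f (mul h k)) g.
Proof. by apply: eq_Ex => s; rewrite gmulA. Qed.

Lemma TnDn m n f g : bdd f -> Tn (m + n) f g = Tn m (Tn n f) g.
Proof.
move=> [M hM]; rewrite /Tn; under eq_Ex do rewrite posD gmulA.
rewrite /pos -/(pos _ _).
apply: (ind_pre (f := fun a s => f (mul (mul g (prodw a)) (pos s n))) m (M := M)) => // a.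
by have [] := @bm_pos f (mul g (prodw a)) n (ex_intro _ M hM).
Qed.

Lemma Pr_pos n (b : G -> bool) g : Pr [set s | b (mul g (pos s n))] = Tn n (fun h => (b h)%:R) g.
Proof.
rewrite -Ex_indic; last exact: (measurable_pos n (fun h => b (mul g h))).
by apply: eq_Ex => s; rewrite indicE; congr (_ %:R); congr nat_of_bool; apply/idP/idP; rewrite inE.
Qed.

Lemma Tn_atom (w : seq G) f g : bdd f -> (forall g, 0 <= f g) ->
  muw mu w * f (mul g (prodw w)) <= Tn (size w) f g.
Proof.
move=> hf f0; have mA := measurable_atom (one := one) (size w) w.
have -> : muw mu w = Pr [set s | pre (size w) s = w].
  by rewrite /(Pr _) (Q_atom (Q_iid W)) eqxx.
rewrite mulrC -Ex_indic // -ExZ; last exact: bm_indic.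
apply: Ex_le; [by apply: bmZ; exact: bm_indic|exact: bm_pos|move=> s].
rewrite indicE; case: (boolP (s \in _)) => /=; last by rewrite mulr0.
by rewrite inE mulr1 /pos /= => ->.
Qed.

Lemma muw_gt0 (w : seq G) : all (fun a => 0 < mu a) w -> 0 < muw mu w.
Proof.
elim: w => [|a w IH] /=; first by rewrite /muw big_nil.
by move=> /andP[h1 h2]; rewrite /muw big_cons mulr_gt0 // IH.
Qed.

Lemma tight n e : 0 < e -> exists R0, Pr [set s | R0 < len (pos s n)] <= e.
Proof.
move=> e0.
have [|||k hk] := @Pr_bigcap_le _ _ _ Q (fun k => [set s | k%:R < len (pos s n)]) e _ _ _ e0.
- by move=> k; exact: (measurable_pos n (fun g => k%:R < len g)).
- move=> i j ij; apply/subsetPset => s /=; apply: le_lt_trans; by rewrite ler_nat.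
- apply/seteqP; split=> s // /(_ (Num.truncn (len (pos s n))).+1 I) /=.
  by rewrite ltNge ltW // truncnS_gt.
- by exists k%:R.
Qed.

(** * Uniform bounds for shadows *)

Definition shadow (x : X) (s : R) (g : G) : bool := s <= gp x (act g o).

Lemma bdd_shadow x s : bdd (fun g => (shadow x s g)%:R).
Proof. exact: bdd_bool. Qed.

(** Cancelling [g] moves the base point by [len g], and the depth drops by at most that much. *)
Lemma shadow_mull x (s t : R) g h : s + len g <= t ->
  shadow x t (mul g h) -> shadow (act (inv g) x) s h.
Proof.
rewrite /shadow actM => st.
have -> : gp x (act g (act h o)) = gprod d (act (inv g) o) (act (inv g) x) (act h o).
  by rewrite -(gprod_act (inv g) o x) actV.
have := gprod_lip_base met (act (inv g) o) o (act (inv g) x) (act h o).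
by rewrite -/(len _) lenV; lra.
Qed.

Lemma shadow_mull_Tn x (s t : R) n g : s + len g <= t ->
  Tn n (fun h => (shadow x t h)%:R) g <= Tn n (fun h => (shadow (act (inv g) x) s h)%:R) one.
Proof.
move=> st; rewrite -{1}[g]gmul1r Tn_mull; apply: Tn_le => [||h].
- exact: (bdd_mul g (bdd_shadow x t)).
- exact: bdd_shadow.
by rewrite ler_nat; case E : (shadow x t (mul g h)) => //; rewrite (shadow_mull st E).
Qed.

Lemma Tn_tight n (e : R) : 0 < e -> exists R0 : R, Tn n (fun g => (R0 < len g)%R%:R) one <= e.
Proof.
move=> /(tight n)[R0 h]; exists R0; rewrite -Pr_pos.
by under eq_set do rewrite gmul1.
Qed.

Lemma muw_min (I : finType) (w : I -> seq G) : (forall i, all (fun a => 0 < mu a) (w i)) ->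
  exists b, [/\ 0 < b, b <= 1 & forall i, b <= muw mu (w i)].
Proof.
move=> h.
have [C hC] : exists C : R, forall (i : I) (j : 'I_1), (muw mu (w i))^-1 <= C.
  apply: (@fin_bound _ _ _ (fun (i : I) (j : 'I_1) C => (muw mu (w i))^-1 <= C)).
    by move=> i j C C' CC /le_trans; apply.
  by move=> i j; exists (muw mu (w i))^-1.
pose C' := Num.max C 1.
have C1 : 1 <= C' by rewrite le_max lexx orbT.
exists C'^-1; split; rewrite ?invr_gt0 ?invf_le1 //; try lra.
move=> i; have p := muw_gt0 (h i).
rewrite -[leRHS]invrK lef_pV2 ?posrE ?invr_gt0 //; last by lra.
by apply: le_trans (hC i ord0) _; rewrite le_max lexx.
Qed.

Let ubound_at (c : R) := exists s, forall x n, Tn n (fun g => (shadow x s g)%:R) one <= c.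

(* Improvement step: on a Schottky set the shadow of [x] is seen by at most two
   of the [r+1] translates, so that some translate has probability at most [t]. *)
Let ubound_at_step r : let t := 2 / r.+1%:R in
  exists2 b : R, 0 < b <= 1 & forall eta : R, 0 < eta -> forall c : R, ubound_at c -> t <= c ->
    ubound_at (c - b * (c - t) + eta).
Proof.
move=> t; have [k [w [C [sw pw hw]]]] := schottky_words (@mu_gen R W) (nonel_of W) r.
have t0 : 0 < t by rewrite divr_gt0.
have [b [b0 b1 hb]] := muw_min pw; exists b; first by rewrite b0 b1.
move=> eta eta0 c [s0 hs0] tc.
have [R1 hR1] := Tn_tight k eta0.
(* Before time [k] there is no room for a Schottky word. Tightness settles these finitely many
   times, since a deep shadow contains only points far from [o]. *)
have [R2 hR2] : exists R2 : R, forall n : nat, (n < k)%N -> Tn n (fun g => (R2 < len g)%R%:R) one <= t.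
  have [R2 hR2] : exists C : R, forall (i : 'I_k) (j : 'I_1), Tn i (fun g => (C < len g)%R%:R) one <= t.
    apply: (@fin_bound _ _ _ (fun (i : 'I_k) (j : 'I_1) C => Tn i (fun g => (C < len g)%R%:R) one <= t)).
      move=> i j D D' DD; apply: le_trans; apply: Tn_le; try exact: bdd_bool.
      by move=> g; rewrite ler_nat; case: (boolP (D' < len g)) => // /(le_lt_trans DD) ->.
    by move=> i j; exact: Tn_tight.
  by exists R2 => n nk; exact: (hR2 (Ordinal nk) ord0).
have [s [s1 s2 s3]] : exists s : R, [/\ s0 + R1 <= s, C < s & R2 < s].
  exists (Num.max (s0 + R1) (Num.max (C + 1) (R2 + 1))).
  by rewrite !lt_max le_max lexx !ltrDl !ltr01 !orbT.
have c'0 : t <= c - b * (c - t) + eta.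
  suff : 0 <= (1 - b) * (c - t) by lra.
  by apply: mulr_ge0; lra.
exists s => x n; have [nk|kn] := ltnP n k.
  apply: le_trans c'0; apply: le_trans (hR2 n nk); apply: Tn_le; try exact: bdd_bool.
  move=> g; rewrite ler_nat; case E : (shadow x s g) => //.
  have h : s <= gp x (act g o) := E.
  suff -> : R2 < len g by [].
  by have := gprod_le_r met o x (act g o); rewrite -/(len _); lra.
rewrite -(subnKC kn) TnDn; last exact: bdd_shadow.
set f := Tn (n - k) _.
have f01 g : 0 <= f g <= 1 by apply: Tn01 => h; case: (shadow _ _ _); rewrite ?lexx ?ler01.
(* The deficit of [f] below the old bound [c], corrected where [g] is too long for [shadow_mull_Tn].
   It is nonnegative, and at least [c - t] at the Schottky word found next, so its mean after [k]
   steps is at least [b * (c - t)]. *)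
pose phi g := c + (R1 < len g)%R%:R - f g.
have bphi : bdd phi.
  by apply: bddB; [apply: bddD; [exact: bdd_cst|exact: bdd_bool]|exact: bdd01].
have phi0 g : 0 <= phi g.
  rewrite /phi; case: (ltP R1 (len g)) => hg /=.
    by have := f01 g; lra.
  rewrite addr0 subr_ge0; apply: le_trans (hs0 (act (inv g) x) (n - k)%N).
  by apply: shadow_mull_Tn; lra.
have [i hi] : exists i, f (prodw (w i)) <= t.
  apply: contrapT => /forallNP hn.
  have {}hn i : t < f (prodw (w i)) by rewrite ltNge; apply/negP.
  have : \sum_(i < r.+1) f (prodw (w i)) <= 2.
    have -> : \sum_(i < r.+1) f (prodw (w i)) =
        Tn (n - k) (fun h => \sum_(i < r.+1) (shadow x s (mul (prodw (w i)) h))%:R) one.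
      rewrite Tn_sum; last first.
        by move=> i; exact: (bdd_mul _ (bdd_shadow x s)).
      by apply: eq_bigr => i _; rewrite /f -{1}[prodw (w i)]gmul1r Tn_mull.
    rewrite -[leRHS](Tn_cst (n - k) 2 one); apply: Tn_le.
    - apply: bdd_sum => i.
      exact: (bdd_mul _ (bdd_shadow x s)).
    - exact: bdd_cst.
    move=> h; have [i1 [i2 h12]] := hw x (act h o).
    have H (i : 'I_r.+1) : (shadow x s (mul (prodw (w i)) h))%:R <= (i == i1)%:R + (i == i2)%:R :> R.
      rewrite -natrD ler_nat /shadow actM; case: (boolP (s <= _)) => // hs.
      by have [->|->] := h12 i (lt_le_trans s2 hs); rewrite eqxx //= ?leq_addl.
    apply: le_trans (ler_sum _ (fun i _ => H i)) _.
    have S (j : 'I_r.+1) : \sum_(i < r.+1) (i == j)%:R = 1 :> R.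
      by rewrite (bigD1 j) //= eqxx big1 ?addr0 // => l /negbTE ->.
    by rewrite big_split /= !S; lra.
  apply/negP; rewrite -ltNge.
  have <- : \sum_(i < r.+1) t = 2 by rewrite sumr_const card_ord -[LHS]mulr_natr /t divfK.
  by apply: ltr_sum => //; apply/hasP; exists ord0; rewrite ?mem_index_enum.
have E : Tn k f one = c + Tn k (fun g => (R1 < len g)%R%:R) one - Tn k phi one.
  rewrite /phi TnB ?TnD ?Tn_cst; try exact: bdd_cst; try exact: bdd_bool.
  - by lra.
  - by apply: bddD; [exact: bdd_cst|exact: bdd_bool].
  - exact: bdd01.
have P1 : b * (c - t) <= Tn k phi one.
  have := Tn_atom (w i) one bphi phi0; rewrite sw gmul1; apply: le_trans.
  have p1 : c - t <= phi (prodw (w i)).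
    by rewrite /phi; case: (_ < _) => /=; lra.
  apply: (@le_trans _ _ (b * phi (prodw (w i)))); first by rewrite ler_pM2l.
  by rewrite ler_wpM2r.
by rewrite E; lra.
Qed.

(** The infimum of the uniform bounds is at most [2 / r.+1] for every [r]: otherwise the improvement
    step, applied to a bound close to the infimum, would go below it. *)
Theorem shadow_uniform (e : R) : 0 < e ->
  exists s, forall x n, Tn n (fun g => (shadow x s g)%:R) one <= e.
Proof.
pose A := [set c | ubound_at c].
have good1 : ubound_at 1.
  exists 0 => x n; rewrite -[leRHS](Tn_cst n 1 one).
  apply: Tn_le; [exact: bdd_shadow|exact: bdd_cst|].
  by move=> g; case: (shadow _ _ _); rewrite ?ler01.
have A0 : has_inf A.
  split; first by exists 1.
  exists 0 => c [s hs]; apply: le_trans (hs o 0%N); apply: Tn_ge0 => g.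
  by rewrite ler0n.
have inf_le r : inf A <= 2 / r.+1%:R.
  rewrite leNgt; apply/negP => lt.
  have t0 : 0 < 2 / r.+1%:R :> R by rewrite divr_gt0.
  have lb c : ubound_at c -> inf A <= c by move=> gc; apply: ge_inf; [case: A0|].
  have t1 : 2 / r.+1%:R <= 1 :> R by apply: le_trans (lb 1 good1); exact: ltW.
  have [b /andP[b0 b1] hb] := ubound_at_step r.
  (* Starting within [eta] of the infimum, the step gains at least [4 eta] and loses [eta]. *)
  pose eta := b * (inf A - 2 / r.+1%:R) / 4.
  have eta0 : 0 < eta by rewrite divr_gt0 // mulr_gt0 // subr_gt0.
  have [c gc clt] := inf_adherent eta0 A0.
  have gc' := hb eta eta0 c gc (le_trans (ltW lt) (lb c gc)).
  have p1 := lb _ gc'; have p2 : eta * 4 = b * (inf A - 2 / r.+1%:R) by rewrite /eta divfK.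
  have p3 := lb c gc.
  have p4 : 0 <= b * (c - inf A) by rewrite mulr_ge0 ?subr_ge0 ?lb // ltW.
  have arith (I t e' : R) : I <= c - b * (c - t) + e' -> e' * 4 = b * (I - t) ->
    0 <= b * (c - I) -> 0 < e' -> c < I + e' -> False by move=> *; lra.
  exact: (arith _ _ _ p1 p2 p4 eta0 clt).
move=> e0; have [r hr] : exists r, 2 / r.+1%:R < e.
  exists (Num.truncn (2 / e)); rewrite ltr_pdivrMr // mulrC -ltr_pdivrMr //.
  exact: truncnS_gt.
have [|c [s hs] clt] := @inf_adherent _ A (e - inf A) _ A0.
  by rewrite subr_gt0 (le_lt_trans (inf_le r)).
by exists s => x n; apply: le_trans (hs x n) _; lra.
Qed.

Definition hits (x : X) (s : R) (g : G) (n : nat) : set T :=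
  [set u | exists2 k, (k <= n)%N & shadow x s (mul g (pos u k))].

Lemma measurable_hits x s g n : measurable (hits x s g n).
Proof.
rewrite (_ : hits x s g n = [set u | exists k, (k <= n)%N /\ shadow x s (mul g (pos u k))]).
  apply: meas_ex => k; apply: meas_and; first exact: meas_cst.
  exact: (measurable_pos k (fun h => shadow x s (mul g h))).
by apply/seteqP; split=> u [k]; [exists k|case=> h1 h2; exists k].
Qed.

(* After the first visit to the shadow of depth [2s+dl] the walk stays in the
   shadow of depth [s] with probability at least [1-e]. *)
Lemma hits_le (e s : R) : 0 <= e <= 1 -> 0 <= s ->
  (forall x n, Tn n (fun g => (shadow x s g)%:R) one <= e) ->
  forall x n g, (1 - e) * Pr (hits x (2 * s + dl) g n) <= Tn n (fun h => (shadow x s h)%:R) g.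
Proof.
move=> /andP[e0 e1] s0 hs x n; have D0 := dl0.
(* To leave the shadow of depth [s], the walk restarted at [g] has to enter the shadow of [g^-1 o]
   of depth [s], which has probability at most [e]. *)
have stay n' g : shadow x (2 * s + dl) g -> 1 - e <= Tn n' (fun h => (shadow x s h)%:R) g.
  move=> hg; rewrite -[g]gmul1r Tn_mull.
  have -> : 1 - e = Tn n' (fun=> 1) one - e by rewrite Tn_cst.
  apply: (@le_trans _ _ (Tn n' (fun=> 1) one - Tn n' (fun h => (shadow (act (inv g) o) s h)%:R) one)).
    by rewrite lerB.
  rewrite -TnB; [|exact: bdd_cst|exact: bdd_shadow].
  apply: Tn_le => [||h].
  - by apply: bddB; [exact: bdd_cst|exact: bdd_shadow].
  - exact: (bdd_mul _ (bdd_shadow x s)).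
  case: (boolP (shadow (act (inv g) o) s h)) => h1; first by rewrite subrr ler0n.
  rewrite subr0; suff -> : shadow x s (mul g h) by [].
  move: h1 hg; rewrite /shadow -ltNge => h1 hg.
  have h2 : s + dl <= gp (act g o) (act (mul g h) o).
    rewrite (gprod_swap met) -/(len g) actM.
    have -> : gprod d (act g o) o (act g (act h o)) = gp (act (inv g) o) (act h o).
      by rewrite -(gprod_act g o (act (inv g) o)) actKV.
    by have := gprod_le_r met o x (act g o); rewrite -/(len g); lra.
  have := gprod_ultra met hyp (w := o) (x := x) (y := act (mul g h) o) (z := act g o) (m := s + dl).
  by rewrite addrK; apply=> //; lra.
elim: n => [|n IH] g; (case: (boolP (shadow x (2 * s + dl) g)) => hg;
  first by apply: le_trans (stay _ _ hg); rewrite ler_piMr ?subr_ge0 // Pr_le1 //; exact: measurable_hits).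
- rewrite (_ : hits _ _ _ _ = set0) ?Pr_set0 ?mulr0; last first.
    by apply/seteqP; split=> u // -[[|//] _]; rewrite pos0 gmul1r (negbTE hg).
  by apply: Tn_ge0 => h; rewrite ler0n.
have E : hits x (2 * s + dl) g n.+1 =
    [set u | hits x (2 * s + dl) (mul g (prodw (pre 1 u))) n (drops 1 u)].
  apply/seteqP; split=> u [k kn].
    case: k kn => [|k] kn; first by rewrite pos0 gmul1r (negbTE hg).
    by rewrite -(add1n k) posD gmulA => h; exists k.
  by rewrite -gmulA -[prodw (pre 1 u)]/(pos u 1) -posD => h; exists (1 + k)%N.
rewrite E (ind_pre_set 1 (Phi := fun a => hits x (2 * s + dl) (mul g (prodw a)) n)); last first.
  by move=> a; exact: measurable_hits.
rewrite -(add1n n) TnDn; last exact: bdd_shadow.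
rewrite -ExZ; last first.
  apply: (@bm_pre 1%N (fun a => Pr (hits x (2 * s + dl) (mul g (prodw a)) n)) 1) => a.
  by rewrite ger0_norm ?Pr_ge0 // Pr_le1 //; exact: measurable_hits.
rewrite /(Tn 1) /pos; apply: Ex_le => [||u]; last exact: IH.
- apply: bmZ; apply: (@bm_pre 1%N (fun a => Pr (hits x (2 * s + dl) (mul g (prodw a)) n)) 1) => a.
  by rewrite ger0_norm ?Pr_ge0 // Pr_le1 //; exact: measurable_hits.
- by apply: (bm_pos (f := Tn n (fun h => (shadow x s h)%:R)) g 1); apply: Tn_bdd; exact: bdd_shadow.
Qed.

Definition ever (x : X) (s : R) : set T := [set u | exists k, shadow x s (pos u k)].

Lemma measurable_ever x s : measurable (ever x s).
Proof. by apply: meas_ex => k; exact: (measurable_pos k (fun h => shadow x s h)). Qed.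

(** A maximal inequality: by [hits_le], an early visit to a deep shadow is still noticed at a fixed
    later time, where [shadow_uniform] applies. *)
Theorem ever_uniform (e : R) : 0 < e -> exists2 s, 0 < s & forall x, Pr (ever x s) <= e.
Proof.
move=> e0; have D0 := dl0.
(* From [(1 - e') p <= e'] and [e' <= 1 / 2] follows [p <= 2 e' <= e]. *)
pose e' := Num.min (e / 2) (1 / 2).
have e'0 : 0 < e' by rewrite lt_min; apply/andP; split; lra.
have [e'1 e'2] : e' <= e / 2 /\ e' <= 1 / 2 by rewrite !ge_min !lexx orbT.
have [s hs] := shadow_uniform e'0.
pose s1 := Num.max s 1.
have [ss1 s1p] : s <= s1 /\ 1 <= s1 by rewrite !le_max !lexx orbT.
have hs1 x n : Tn n (fun g => (shadow x s1 g)%:R) one <= e'.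
  apply: le_trans (hs x n); apply: Tn_le; try exact: bdd_shadow.
  by move=> g; rewrite ler_nat /shadow; case: (boolP (s1 <= _)) => // /(le_trans ss1) ->.
exists (2 * s1 + dl); first by lra.
move=> x; have -> : ever x (2 * s1 + dl) = \bigcup_n hits x (2 * s1 + dl) one n.
  apply/seteqP; split=> u.
    by move=> [k h]; exists k => //; exists k => //; rewrite gmul1.
  by move=> [n _ [k _]]; rewrite gmul1 => h; exists k.
apply: Pr_bigcup_le => [n|m n mn|n]; first exact: measurable_hits.
  by apply/subsetPset => u [k km h]; exists k => //; exact: leq_trans mn.
have := hits_le (e := e') _ _ hs1 x n one; have := hs1 x n.
have p0 := Pr_ge0 Q (hits x (2 * s1 + dl) one n).
move=> h1 /(_ _ _) h2; have {h2} : (1 - e') * Pr (hits x (2 * s1 + dl) one n) <= e'.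
  by apply: le_trans h1; apply: h2; [apply/andP; split|]; lra.
by nra.
Qed.

(** * Pivots *)

Lemma drops0 (u : nat -> G) : drops 0 u = u.
Proof. by apply/funext => i; rewrite /(drops _ _) add0n. Qed.

Lemma measurable_pos2 n m (A : G -> G -> Prop) : measurable ([set u | A (pos u n) (pos u m)] : set T).
Proof.
have := measurable_pre (maxn n m) (one := one)
  (fun a : seq G => A (prodw (take n a)) (prodw (take m a))).
rewrite (_ : [set s | _ ] = [set u : T | A (pos u n) (pos u m)]) //.
by apply/funext => u /=; rewrite !pre_take ?leq_maxl ?leq_maxr.
Qed.

(** Off this event the origin and all later positions lie in different directions as seen from
    [w_k o] ([pivot_gprod]). The shadow is determined by the increments before time [k] and the
    visit by those after it. *)
Definition not_pivot (s : R) (k : nat) : set T :=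
  [set u | ever (act (inv (prodw (pre k u))) o) s (drops k u)].

Lemma measurable_not_pivot s k : measurable (not_pivot s k).
Proof.
apply: (measurable_preshift k (Phi := fun a => ever (act (inv (prodw a)) o) s)) => a.
exact: measurable_ever.
Qed.

Lemma not_pivot_le s e k : (forall x, Pr (ever x s) <= e) -> Pr (not_pivot s k) <= e.
Proof.
move=> h; rewrite /not_pivot.
rewrite (ind_pre_set k (Phi := fun a => ever (act (inv (prodw a)) o) s)); last first.
  by move=> a; exact: measurable_ever.
rewrite -[leRHS](Ex_cst Q); apply: Ex_le => //; last exact: bm_cst.
apply: (@bm_pre k (fun a => Pr (ever (act (inv (prodw a)) o) s)) 1) => a.
by rewrite ger0_norm ?Pr_ge0 // Pr_le1 //; exact: measurable_ever.
Qed.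

Lemma not_ever_gprod g x s (u : T) n :
  ~ ever (act (inv g) x) s u -> gprod d (act g o) x (act (mul g (pos u n)) o) < s.
Proof.
move=> h; rewrite ltNge; apply/negP => h'; apply: h; exists n.
rewrite /shadow; move: h'; rewrite -(gprod_act (inv g) (act g o)) actV actM actV.
by [].
Qed.

Lemma pivot_gprod s k n (u : T) : ~ not_pivot s k u -> (k <= n)%N ->
  gprod d (act (pos u k) o) o (act (pos u n) o) < s.
Proof. by move=> h kn; rewrite -(subnKC kn) posD; exact: not_ever_gprod. Qed.

Section Window.
Variables (s C1 e : R) (w : bool -> seq G) (m : nat) (p : R).
Hypothesis hs : forall x, Pr (ever x s) <= e.
Hypothesis wm : forall b, size (w b) = m.
Hypothesis wC : gp (act (prodw (w true)) o) (act (prodw (w false)) o) <= C1.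
Hypothesis p0 : 0 <= p.
Hypothesis p1 : p <= 1.
Hypothesis hp : forall b, p <= muw mu (w b).
Let v b := prodw (w b).

(* The word to be spelled next, chosen so that the past of the walk is not seen
   in its direction. *)
Definition next_word (g : G) : bool := gp (act (inv g) o) (act (v true) o) <= C1 + dl.

Lemma next_wordP g : gp (act (inv g) o) (act (v (next_word g)) o) <= C1 + dl.
Proof.
case E : (next_word g); first exact: E.
have := gprod_hyp met hyp o (act (v true) o) (act (v false) o) (act (inv g) o).
have : C1 + dl < gp (act (inv g) o) (act (v true) o) by rewrite ltNge; apply/negP; rewrite -/(next_word g) E.
have := wC; rewrite -/(v true) -/(v false) (gprodC met o (act (v true) o) (act (inv g) o)); lra.
Qed.

(** The walk starts at [g], so that the event can be restarted after any past. The word spelled at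
    time [j] is the one prescribed by the past, and afterwards the walk never turns back along
    it. *)
Definition superpivot (g : G) (j : nat) : set T :=
  [set u | pre m (drops j u) = w (next_word (mul g (prodw (pre j u)))) /\
     ~ ever (act (inv (v (next_word (mul g (prodw (pre j u)))))) o) s (drops m (drops j u))].

Lemma measurable_superpivot g j : measurable (superpivot g j).
Proof.
apply: (measurable_preshift j (Phi := fun a => [set u : T | pre m u = w (next_word (mul g (prodw a))) /\
     ~ ever (act (inv (v (next_word (mul g (prodw a))))) o) s (drops m u)])) => a.
apply: meas_and; first exact: measurable_atom.
apply: meas_not; rewrite -[X in measurable X]setTI.
by apply: measurable_drops => //; exact: measurable_ever.
Qed.

Definition no_superpivot g r : set T :=
  [set u | forall l, (l < r)%N -> ~ superpivot g (l * m) u].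

Lemma measurable_no_superpivot g r : measurable (no_superpivot g r).
Proof.
apply: meas_all => l; apply: meas_imp; apply: meas_not.
exact: measurable_superpivot.
Qed.

(** Each block misses its prescribed word with probability at most [1 - p]. The failure of the
    future is charged only to the first block that does spell its word, so [e] is paid once and not
    [r] times. *)
Lemma no_superpivot_le r : forall g, Pr (no_superpivot g r) <= e + (1 - p) ^+ r.
Proof.
have e0 : 0 <= e by apply: le_trans (hs o); exact: Pr_ge0.
elim: r => [|r IH] g.
  rewrite expr0; apply: le_trans (Pr_le1 Q (measurable_no_superpivot g 0)) _; lra.
pose b := next_word g.
pose Phi (a : seq G) : set T := if a == w b then ever (act (inv (v b)) o) s
  else no_superpivot (mul g (prodw a)) r.
have mPhi a : measurable (Phi a).
  by rewrite /Phi; case: ifP => _; [exact: measurable_ever|exact: measurable_no_superpivot].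
have sub : no_superpivot g r.+1 `<=` [set u | Phi (pre m u) (drops m u)].
  move=> u hu; rewrite /= /Phi; case: eqP => [e1|ne].
    apply: contrapT => h; apply: (hu 0%N) => //.
    by rewrite /superpivot /= mul0n drops0 /pos /(pre _ _) /mkseq /= gmul1r -/b.
  move=> l lr sp; apply: (hu l.+1) => //; move: sp.
  by rewrite /superpivot /= mulSn !drops_drops (preD one) prodw_cat gmulA.
apply: le_trans (Pr_le Q (measurable_no_superpivot g r.+1) (measurable_preshift m mPhi) sub) _.
rewrite ind_pre_set //.
have q0 : 0 <= (1 - p) ^+ r by rewrite exprn_ge0 // subr_ge0.
have mA := measurable_atom (one := one) m (w b).
have bA : bm (fun u : T => (1 - p) ^+ r * \1_[set u : T | pre m u = w b] u) by apply: bmZ; exact: bm_indic.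
have bB : bm (fun u : T => e + (1 - p) ^+ r) by exact: bm_cst.
apply: (@le_trans _ _ (Ex (fun u => (e + (1 - p) ^+ r) - (1 - p) ^+ r * \1_[set u : T | pre m u = w b] u))).
  apply: Ex_le; last first.
  - move=> u; rewrite indicE /Phi; case: eqP => [eu|ne].
      by rewrite mem_set //= mulr1; apply: le_trans (hs _) _; lra.
    by rewrite memNset //= mulr0 subr0; exact: IH.
  - exact: bmB.
  apply: (@bm_pre m (fun a => Pr (Phi a)) 1) => a.
  by rewrite ger0_norm ?Pr_ge0 // Pr_le1.
rewrite (ExB Q bB bA) Ex_cst ExZ; last exact: bm_indic.
rewrite Ex_indic // /(Pr _) (Q_atom (Q_iid W)) wm eqxx /= exprSr.
have := ler_wpM2l q0 (hp b); lra.
Qed.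

(** Local-to-global along [o], [x], [y], [z]: the product at [x] of [o] and [y] is bounded by the
    choice of the word, the one at [y] of [x] and [z] by the future, and the word is longer than
    both bounds together, so each bound extends to [o] and [z] at the cost of [dl]. *)
Lemma superpivot_gprod (u : T) j : superpivot one j u -> (forall b, C1 + s + 2 * dl + 1 <= len (v b)) ->
  exists b, pos u (j + m) = mul (pos u j) (v b) /\ forall k, (j + m <= k)%N ->
    gprod d (act (pos u j) o) o (act (pos u k) o) <= C1 + 2 * dl /\
    gprod d (act (pos u (j + m)) o) o (act (pos u k) o) <= s + dl.
Proof.
move=> [h1 h2] hV; have D0 := dl0; rewrite gmul1 -/(pos u j) in h1 h2.
set b := next_word _ in h1 h2; exists b.
have E : pos u (j + m) = mul (pos u j) (v b) by rewrite posD /(pos (drops _ _) _) h1.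
split=> // k jk; rewrite drops_drops in h2.
have {h2} : ~ ever (act (inv (pos u (j + m))) (act (pos u j) o)) s (drops (j + m) u).
  by rewrite E ginvM actM actV.
move=> /(not_ever_gprod (k - (j + m))); rewrite -posD subnKC // => h3.
have nb := next_wordP (pos u j); rewrite -/b in nb; have := hV b; rewrite /len => hb.
set x := act (pos u j) o in h3 *; set y := act (pos u (j + m)) o in h3 *; set z := act (pos u k) o in h3 *.
have n1 : gprod d x o y <= C1 + dl.
  move: nb; rewrite -(gprod_act (pos u j)) actKV -actM -E.
  by [].
have dxy : d y x = d (act (v b) o) o by rewrite /x /y E actM act_isom.
have s1 : gprod d x y z = d y x - gprod d y x z by rewrite (gprod_swap met).
have s2 : gprod d y o x = d x y - gprod d x o y.
  by rewrite (gprodC met) (gprod_swap met) (gprodC met x).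
rewrite (dist_sym met x y) in s2.
have a1 := gprod_hyp met hyp x o y z.
have a2 := gprod_hyp met hyp y x z o.
rewrite (gprodC met x z y) in a1; rewrite (gprodC met y x o) in a2.
split; lra.
Qed.

End Window.

(** * Convergence to the boundary *)

(** The order of the quantifiers matters: [s2] depends on [e] only, so [K] may later be chosen in
    terms of [s2]. The window has [r * m] steps, whatever its starting time [j]. *)
Theorem pivot_window (e : R) : 0 < e -> exists2 s2, 0 <= s2 & forall K V : R,
  exists (w : bool -> G) (m r : nat) (E : nat -> set T),
  [/\ forall b, V <= len (w b),
      forall b, finite_set (StabK d act K o (act (w b) o)),
      forall j, measurable (E j),
      forall j, Pr (~` E j) <= e &
      forall j u, E j u -> exists l b, [/\ (l < r)%N,
        pos u (j + l * m + m) = mul (pos u (j + l * m)) (w b) &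
        forall k, (j + l * m + m <= k)%N ->
          gprod d (act (pos u (j + l * m)) o) o (act (pos u k) o) <= s2 /\
          gprod d (act (pos u (j + l * m + m)) o) o (act (pos u k) o) <= s2]].
Proof.
move=> e0; have D0 := dl0; have [g wg] := wpd_of W.
have [C1 hW] := WPD_words (@mu_gen R W) (nonel_of W) wg.
have e2 : 0 < e / 2 by rewrite divr_gt0.
have [s s0 hs] := ever_uniform e2.
have [s2 [s2a s2b s2c]] : exists s2 : R, [/\ C1 + 2 * dl <= s2, s + dl <= s2 & 0 <= s2].
  exists (Num.max (C1 + 2 * dl) (s + dl)); rewrite !le_max !lexx ?orbT; split=> //.
  by apply/orP; right; lra.
exists s2 => // K V.
have [w [sw pw wC hV fin]] := hW K (Num.max V (C1 + s + 2 * dl + 1)).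
have [p [p0 p1 hp]] := muw_min pw.
have wm b : size (w b) = size (w true) by case: b.
set m := size (w true) in wm.
(* One half of [e] pays for missing all words, the other half for the future. *)
have [r hr] : exists r, (1 - p) ^+ r <= e / 2.
  have : (fun n => (1 - p) ^+ n) @ \oo --> (0 : R).
    by apply: cvg_expr; rewrite ger0_norm ?subr_ge0 //; lra.
  move=> /cvgrPdist_lt/(_ _ e2)[N _ hN]; exists N.
  have := hN N (leqnn N); rewrite sub0r normrN ger0_norm ?exprn_ge0 ?subr_ge0 //.
  exact: ltW.
pose N j := [set u : T | no_superpivot s C1 w m (prodw (pre j u)) r (drops j u)].
have mN j : measurable (N j).
  apply: (measurable_preshift j (Phi := fun a => no_superpivot s C1 w m (prodw a) r)) => a.
  exact: measurable_no_superpivot.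
exists (fun b => prodw (w b)), m, r, (fun j => ~` N j); split.
- by move=> b; apply: le_trans (hV b); rewrite le_max lexx.
- exact: fin.
- by move=> j; exact: measurableC.
- move=> j; rewrite setCK /N.
  rewrite (ind_pre_set j (Phi := fun a => no_superpivot s C1 w m (prodw a) r)); last first.
    by move=> a; exact: measurable_no_superpivot.
  rewrite -[leRHS](Ex_cst Q); apply: Ex_le.
  + apply: (@bm_pre j (fun a => Pr (no_superpivot s C1 w m (prodw a) r)) 1) => a.
    by rewrite ger0_norm ?Pr_ge0 // Pr_le1 //; exact: measurable_no_superpivot.
  + exact: bm_cst.
  + move=> u; have := no_superpivot_le C1 hs wm p1 hp r (prodw (pre j u)); lra.
move=> j u; rewrite /N /= => /existsNP[l /not_implyP[lr /contrapT sp]].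
have {}sp : superpivot s C1 w m one (j + l * m) u.
  by move: sp; rewrite /superpivot /= !drops_drops gmul1 (preD one) prodw_cat.
have hV' b : C1 + s + 2 * dl + 1 <= len (prodw (w b)).
  by apply: le_trans (hV b); rewrite le_max lexx orbT.
have [b [eb hb]] := superpivot_gprod wC sp hV'.
exists l, b; split=> // k jk; have [h1 h2] := hb k jk; split; lra.
Qed.

(** One long pivotal block in the window at time 0 keeps all later positions far from [o]. *)
Theorem escape (R0 e : R) : 0 < e -> exists n0, forall n, (n0 <= n)%N ->
  Pr [set u | len (pos u n) <= R0] <= e.
Proof.
move=> e0; have [s2 s20 h] := pivot_window e0.
(* The end of the block is at distance at least [len (w b) - 2 s2] from [o], and later positions are
   at most [s2] closer. *)
have [w [m [r [E [hV _ mE pE hE]]]]] := h 0 (R0 + 3 * s2 + 1).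
exists (r * m)%N => n hn; apply: le_trans (pE 0%N); apply: Pr_le.
- exact: (measurable_pos n (fun g => len g <= R0)).
- exact: measurableC.
move=> u /= hu Eu; have [l [b [lr eb hb]]] := hE _ _ Eu.
move: eb hb; rewrite add0n; set t := (l * m)%N => eb hb.
have tn : (t + m <= n)%N.
  by apply: leq_trans hn; rewrite /t -mulSnr leq_mul2r lr orbT.
have [_ h1] := hb n tn; have [h2 _] := hb (t + m)%N (leqnn _).
have h3 := gprod_le_r met o (act (pos u (t + m)) o) (act (pos u n) o).
rewrite (gprod_swap met) -/(len _) -/(len _) in h3.
have h4 : len (pos u (t + m)) = len (pos u t) + len (w b) - 2 * gprod d (act (pos u t) o) o (act (pos u (t + m)) o).
  rewrite /gprod eb actM act_isom (dist_sym met o) -/(len _) -/(len _) -actM.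
  by rewrite (dist_sym met o) -/(len (mul _ _)); lra.
have := hV b; have := len_ge0 (pos u t); lra.
Qed.

Definition conv_paths : set T := [set u | conv_infty d o (fun n => act (pos u n) o)].

Lemma conv_pathsE : conv_paths = [set u | forall M : nat, exists N : nat, forall n m : nat,
  (N <= n)%N -> (N <= m)%N -> M%:R <= gp (act (pos u n) o) (act (pos u m) o)].
Proof.
apply/seteqP; split=> u; first by move=> h M; exact: h.
move=> h M; have [N hN] := h (Num.truncn M).+1; exists N => n m hn hm.
by apply: le_trans (hN n m hn hm); rewrite ltW // truncnS_gt.
Qed.

Lemma measurable_tail M : measurable ([set u | exists N : nat, forall n m : nat,
  (N <= n)%N -> (N <= m)%N -> M <= gp (act (pos u n) o) (act (pos u m) o)] : set T).
Proof.
apply: meas_ex => N; apply: meas_all => n; apply: meas_all => m; do 2! apply: meas_imp.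
exact: (measurable_pos2 n m (fun g h => M <= gp (act g o) (act h o))).
Qed.

Lemma measurable_conv_paths : measurable conv_paths.
Proof. by rewrite conv_pathsE; apply: meas_all => M; exact: measurable_tail. Qed.

(** With probability close to 1, a fixed late time [k] is a pivot with [w_k o] far from [o]. Then
    all later positions have a large product with [w_k o], hence with each other. *)
Theorem conv_paths_full : Pr (~` conv_paths) = 0.
Proof.
have D0 := dl0.
pose F M := [set u : T | exists N : nat, forall n m : nat,
  (N <= n)%N -> (N <= m)%N -> M <= gp (act (pos u n) o) (act (pos u m) o)].
have mF M : measurable (F M) by exact: measurable_tail.
have H (M : nat) : Pr (~` F M%:R) = 0.
  apply/le_anti; rewrite Pr_ge0 andbT; apply/ler_addgt0Pl => e e0; rewrite addr0.
  have e2 : 0 < e / 2 by rewrite divr_gt0.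
  have [s s0 hs] := ever_uniform e2.
  have [k hk] := escape (M%:R + s + dl) e2.
  have {hk} hk := hk k (leqnn k).
  have mA : measurable ([set u | len (pos u k) <= M%:R + s + dl] : set T).
    exact: (measurable_pos k (fun g => len g <= M%:R + s + dl)).
  have mB := measurable_not_pivot s k.
  apply: (@le_trans _ _ (Pr ([set u | len (pos u k) <= M%:R + s + dl] `|` not_pivot s k))).
    apply: Pr_le; [exact: measurableC|exact: measurableU|].
    move=> u nF; apply: contrapT => /not_orP[n1 n2]; apply: nF; exists k => n m kn km.
    have {n1} n1 : M%:R + s + dl < len (pos u k) by rewrite ltNge; apply/negP.
    have h1 := pivot_gprod n2 kn; have h2 := pivot_gprod n2 km.
    have := gprod_ultra met hyp (w := o) (x := act (pos u n) o) (y := act (pos u m) o)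
      (z := act (pos u k) o) (m := M%:R + dl).
    rewrite addrK; apply; rewrite ?(gprodC met _ (act (pos u n) o)) (gprod_swap met) -/(len _); lra.
  have := PrU_le Q mA mB; have := not_pivot_le k hs; lra.
have mC M : measurable (~` F M) by exact: measurableC.
have -> : ~` conv_paths = \bigcup_M ~` F M%:R.
  by rewrite conv_pathsE -setC_bigcap; congr (~` _); apply/seteqP; split=> u h M; [move=> _|]; exact: h.
apply/le_anti; rewrite Pr_ge0 andbT -lee_fin -PrE; last exact: bigcupT_measurable.
have mU : measurable (\bigcup_(M : nat) ~` F M%:R) by exact: bigcupT_measurable.
apply: le_trans (measure_sigma_subadditive Q (A := \bigcup_(M : nat) ~` F M%:R) (F := fun M : nat => ~` F M%:R) _ _ _) _ => //.
by rewrite eseries0 // => i _ _; exact: (etrans (PrE Q (mC i%:R)) (congr1 EFin (H i))).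
Qed.

(** * Borel sets of the boundary *)

Definition orb (x : nat -> G) : nat -> X := fun n => act (x n) o.
Definition cv (x : nat -> G) : Prop := conv_infty d o (orb x).
Definition bnd0 (x : nat -> G) : set (nat -> X) := bclass d o (orb x).

Lemma bnd0_bpoint x : cv x -> bp (bnd0 x).
Proof. exact: (bclassP met hyp). Qed.

Lemma bpoint_cv x : bp (bnd0 x) -> cv x.
Proof. by move=> [[y [cx _ _]] _]. Qed.

Lemma borel0 : borel set0.
Proof. by have [] := smallest_sigma_algebra bp [set U | bopen d o U]. Qed.

Lemma borelC B : borel B -> borel (bp `\` B).
Proof. by have [_ h _] := smallest_sigma_algebra bp [set U | bopen d o U]; exact: h. Qed.

Lemma borel_bigcup (F : nat -> set (set (nat -> X))) : (forall n, borel (F n)) -> borel (\bigcup_n F n).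
Proof. by have [_ _ h] := smallest_sigma_algebra bp [set U | bopen d o U]; exact: h. Qed.

Lemma borel_open U : bopen d o U -> borel U.
Proof. by move=> h; exact: sub_gen_smallest. Qed.

Lemma borelT : borel bp.
Proof. by have := borelC borel0; rewrite setD0. Qed.

Lemma borel_sub B : borel B -> B `<=` bp.
Proof.
move: B; apply: smallest_sub; last by move=> U [].
split=> [x []|A _ x [] //|F hF x [n _]]; exact: hF n x.
Qed.

Lemma borelU A B : borel A -> borel B -> borel (A `|` B).
Proof.
move=> hA hB; rewrite -bigcup2E; apply: borel_bigcup => -[|[|n]] //=.
exact: borel0.
Qed.

Lemma borelI A B : borel A -> borel B -> borel (A `&` B).
Proof.
move=> hA hB; have -> : A `&` B = bp `\` ((bp `\` A) `|` (bp `\` B)).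
  apply/seteqP; split=> xi.
    by move=> [a b]; split; [exact: borel_sub a|move=> [[_ na]|[_ nb]]; [exact: na|exact: nb]].
  by move=> [b /not_orP[h1 h2]]; split; apply: contrapT => h; [apply: h1|apply: h2].
by apply: borelC; apply: borelU; exact: borelC.
Qed.

(** This makes every Borel event of the limit point an invariant event. *)
Lemma bnd0_shift_tail x y : shift_tail x y -> bnd0 x = bnd0 y.
Proof.
move=> [k [p [N h]]].
have ext (z : nat -> G) j : cv z -> seq_equiv d o (orb z) (fun n => orb z (n + j)%N).
  by move=> cz; apply: (eqv_subseq (f := fun n => (n + j)%N)) => // n; exact: leq_addr.
have tail (z : nat -> G) j : conv_infty d o (fun n => orb z (n + j)%N) <-> cv z.
  split=> hz M; have [L hL] := hz M.
    exists (L + j)%N => n m hn hm.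
    by have := hL (n - j)%N (m - j)%N; rewrite !subnK; [apply; lia|lia|lia].
  by exists L => n m hn hm; apply: hL; lia.
have ev (f f' : nat -> X) : (forall n, (N <= n)%N -> f n = f' n) -> conv_infty d o f ->
    seq_equiv d o f f'.
  move=> e cf M; have [L hL] := cf M; exists (maxn L N) => n m.
  rewrite !geq_max => /andP[n1 n2] /andP[m1 m2].
  by rewrite -(e m m2); exact: hL.
have ev' (f f' : nat -> X) : (forall n, (N <= n)%N -> f n = f' n) -> conv_infty d o f ->
    conv_infty d o f'.
  move=> e cf M; have [L hL] := cf M; exists (maxn L N) => n m.
  rewrite !geq_max => /andP[n1 n2] /andP[m1 m2].
  by rewrite -(e m m2) -(e n n2); exact: hL.
have hx n : (N <= n)%N -> orb x (n + k)%N = orb y (n + p)%N by move=> /h; rewrite /orb => ->.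
have hy n : (N <= n)%N -> orb y (n + p)%N = orb x (n + k)%N by move=> /hx ->.
have cxy : cv x <-> cv y.
  split=> c.
    by apply/(tail y p); apply: ev' hx _; apply/(tail x k).
  by apply/(tail x k); apply: ev' hy _; apply/(tail y p).
have [cx|ncx] := pselect (cv x); last first.
  by apply/seteqP; split=> z [c _ _]; exfalso; apply: ncx => //; apply/cxy.
have cy : cv y by apply/cxy.
apply: (bclass_eq met hyp) => //.
apply: (eqv_trans met hyp (ext x k cx)); apply: (eqv_trans met hyp (ev _ _ hx _)).
  exact/(tail x k).
exact: (eqv_sym met (ext y p cy)).
Qed.

Definition eventually_shadow (y : X) (c : R) (x : nat -> G) : Prop :=
  exists N, forall n, (N <= n)%N -> c < gp y (act (x n) o).

Lemma measurable_coord_set n (A : set G) : measurable ([set x : T | A (x n)]).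
Proof. exact: (@disc_preimage _ T G (fun x => x n) (measurable_coord (one := one) n) A). Qed.

Lemma measurable_coord2 n m (A : G -> G -> Prop) : measurable ([set x : T | A (x n) (x m)]).
Proof.
rewrite (_ : [set _ | _] = [set x : T | exists g, x n = g /\ A g (x m)]).
  apply: meas_ex => g; apply: meas_and; first exact: measurable_coord.
  exact: measurable_coord_set.
by apply/seteqP; split=> x /= => [h|[g [-> //]]]; exists (x n).
Qed.

Lemma measurable_eventually_shadow y c : measurable ([set x | eventually_shadow y c x] : set T).
Proof.
apply: meas_ex => N; apply: meas_all => n; apply: meas_imp.
exact: (measurable_coord_set n (fun g => c < gp y (act g o))).
Qed.

Lemma measurable_cv : measurable ([set x | cv x] : set T).
Proof.
rewrite (_ : [set _ | _] = [set x : T | forall M : nat, exists N : nat, forall n m : nat,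
  (N <= n)%N -> (N <= m)%N -> M%:R <= gp (act (x n) o) (act (x m) o)]).
  apply: meas_all => M; apply: meas_ex => N; apply: meas_all => n; apply: meas_all => m.
  do 2! apply: meas_imp.
  exact: (measurable_coord2 n m (fun g h => M%:R <= gp (act g o) (act h o))).
apply/seteqP; split=> x; first by move=> h M; exact: h.
move=> h M; have [N hN] := h (Num.truncn M).+1; exists N => n m hn hm.
by apply: le_trans (hN n m hn hm); rewrite ltW // truncnS_gt.
Qed.

(** The boundary need not have a countable base, but the paths run in the countable orbit of [o]:
    shadows of orbit points with integer depth are enough to exhaust the preimage of [U]. *)
Lemma measurable_bnd0_open U : bopen d o U -> measurable ([set x | U (bnd0 x)] : set T).
Proof.
move=> [Ub Uo]; have D0 := dl0.
pose good (gq : G * nat) := forall x, cv x -> eventually_shadow (act gq.1 o) gq.2%:R x -> U (bnd0 x).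
rewrite (_ : [set _ | _] = [set x : T | exists gq : G * nat, good gq /\
    (cv x /\ eventually_shadow (act gq.1 o) gq.2%:R x)]).
  apply: (@meas_ex _ _ (G * nat)%type) => gq; apply: meas_and; first exact: meas_cst.
  by apply: meas_and; [exact: measurable_cv|exact: measurable_eventually_shadow].
apply/seteqP; split=> x; last by move=> [gq [hg [cx ex]]]; exact: hg.
move=> /= Ux; have cx := bpoint_cv (Ub _ Ux).
have [r hr] := Uo _ Ux.
pose q := (Num.truncn (`|r + dl|)).+1.
have hq : r + dl < q%:R by apply: le_lt_trans (ler_norm _) _; exact: truncnS_gt.
have [N hN] := cx (q%:R + 1).
have xN n : (N <= n)%N -> q%:R + 1 <= gp (act (x N) o) (act (x n) o) by move=> h; exact: hN.
exists (x N, q); split; last first.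
  by split=> //; exists N => n /xN /=; lra.
move=> x' cx' [N' hN'] /=; apply: hr; split; first exact: bnd0_bpoint.
exists (orb x), (orb x'); split; first exact: bclass_refl.
split; first exact: bclass_refl.
exists (maxn N N') => n m; rewrite !geq_max => /andP[n1 _] /andP[_ m2].
have := xN n n1; have /= := hN' m m2.
have := gprod_hyp met hyp o (orb x n) (orb x' m) (act (x N) o).
rewrite (gprodC met o (orb x n) (act (x N) o)) /orb; lra.
Qed.

Lemma measurable_bnd0 B : borel B -> measurable ([set x | B (bnd0 x)] : set T).
Proof.
move: B; apply: smallest_sub => [|U]; last exact: measurable_bnd0_open.
split=> [|A hA|F hF] /=.
- exact: meas_cst.
- rewrite (_ : [set _ | _] = [set x : T | cv x /\ ~ A (bnd0 x)]).
    by apply: meas_and; [exact: measurable_cv|exact: meas_not].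
  by apply/seteqP; split=> x [h1 h2]; split=> //; [exact: bpoint_cv|exact: bnd0_bpoint].
rewrite (_ : [set _ | _] = [set x : T | exists n, F n (bnd0 x)]).
  by apply: meas_ex => n; exact: hF.
by apply/seteqP; split=> x [n]; [move=> _ h; exists n|move=> h; exists n].
Qed.

(** Whether a path ends up in a shadow is decided by its limit point only up to a multiple of [dl].
    Between the depths [r + 3 dl + 1] and [r] lies an open set of the boundary, the interior [V] of
    the coarse shadow [S]. *)
Lemma shadow_borel (y : X) (r : R) : exists2 B, borel B & forall x, cv x ->
  (eventually_shadow y (r + 3 * dl + 1) x -> B (bnd0 x)) /\
  (B (bnd0 x) -> eventually_shadow y r x).
Proof.
have D0 := dl0.
pose S : set (set (nat -> X)) := [set eta | bp eta /\ exists2 z, eta z & exists N, forall n, (N <= n)%N ->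
   r + dl < gp y (z n)].
pose V : set (set (nat -> X)) := [set xi | bp xi /\ exists r', bnbhd d o xi r' `<=` S].
have eqv_in xi z z' : bp xi -> xi z -> xi z' -> seq_equiv d o z z'.
  by move=> [_ [_ h]] hz hz'; have [_] := (h z hz z').1 hz'.
have VS xi : V xi -> S xi.
  move=> [b [r' h]]; apply: h; split=> //; have [[z xz] [hc _]] := b.
  exists z, z; split=> //; split=> //; have [N hN] := hc z xz (r' + 1).
  by exists N => n m hn hm; have := hN n m hn hm; lra.
exists V.
  apply: borel_open; split=> [xi []//|xi [b [r' h]]].
  exists (r' + 2 * dl + 1) => eta [be [x [z [hx [hz [N hN]]]]]]; split=> //.
  exists (r' + 2 * dl + 1) => zeta [bz [z' [t [hz' [ht [N' hN']]]]]].
  apply: h; split=> //; exists x, t; split=> //; split=> //.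
  have [N'' hN''] := eqv_in _ _ _ be hz hz' (r' + 2 * dl + 1).
  pose M := maxn N (maxn N' N''); exists M => n m hn hm.
  have [M1 M2 M3] : [/\ (N <= M)%N, (N' <= M)%N & (N'' <= M)%N] by rewrite /M; split; lia.
  have h1 := hN n M (leq_trans M1 hn) M1.
  have h2 := hN'' M M M3 M3.
  have h3 := hN' M m M2 (leq_trans M2 hm).
  have a1 := gprod_hyp met hyp o (x n) (t m) (z M).
  have a2 := gprod_hyp met hyp o (z M) (t m) (z' M).
  lra.
move=> x cx; split.
  move=> [N hN]; split; first exact: bnd0_bpoint.
  exists (r + 3 * dl + 1) => eta [be [x' [z [hx' [hz [N' hN']]]]]]; split=> //; exists z => //.
  have xx' : seq_equiv d o (orb x) x' by have [_ _] := hx'.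
  have [N'' hN''] := xx' (r + 3 * dl + 1).
  pose M := maxn N (maxn N' N''); exists M => m hm.
  have [M1 M2 M3] : [/\ (N <= M)%N, (N' <= M)%N & (N'' <= M)%N] by rewrite /M; split; lia.
  have h1 := hN M M1; have h2 := hN'' M M M3 M3; have h3 := hN' M m M2 (leq_trans M2 hm).
  have a1 := gprod_hyp met hyp o y (x' M) (orb x M).
  have a2 := gprod_hyp met hyp o y (z m) (x' M).
  rewrite /orb in h2 a1 *; lra.
move=> /VS[_ [z [_ cz xz] [N hN]]].
have [N' hN'] := xz (r + dl + 1); exists (maxn N N') => n; rewrite geq_max => /andP[n1 n2].
have h1 := hN (maxn N N') (leq_maxl _ _); have h2 := hN' n (maxn N N') n2 (leq_maxr _ _).
have := gprod_hyp met hyp o y (act (x n) o) (z (maxn N N')).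
rewrite (gprodC met o (z _)) /orb in h2 *; lra.
Qed.

Lemma bpoint_bact g xi : bp xi -> bp (bact act g xi).
Proof.
move=> b; have [[x xx] [hc _]] := b; rewrite (bpoint_class b xx).
rewrite bact_class; last exact: hc.
by apply: (bclassP met hyp); apply: conv_act; exact: hc.
Qed.

Lemma borel_bact g B : borel B -> borel [set xi | bp xi /\ B (bact act g xi)].
Proof.
move: B; apply: smallest_sub => [|U [Ub Uo]].
  split=> [|A hA|F hF] /=.
  - by rewrite (_ : [set _ | _] = set0); [exact: borel0|apply/seteqP; split=> // xi []].
  - rewrite (_ : [set _ | _] = bp `\` [set xi | bp xi /\ A (bact act g xi)]); first exact: borelC.
    apply/seteqP; split=> xi.
      by move=> [b [_ nA]]; split=> // -[].
    by move=> [b h]; split=> //; split; [exact: bpoint_bact|move=> a; apply: h].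
  - rewrite (_ : [set _ | _] = \bigcup_n [set xi | bp xi /\ F n (bact act g xi)]).
      exact: borel_bigcup.
    by apply/seteqP; split=> xi; [move=> [b [n _ h]]; exists n|move=> [n _ [b h]]; split=> //; exists n].
apply: borel_open; split=> [xi []//|xi [b Ux]].
have [r hr] := Uo _ Ux; exists (r + len g) => eta [be [x [y [xx [yy [N hN]]]]]]; split=> //.
apply: hr; split; first exact: bpoint_bact.
exists (fun n => act g (x n)), (fun n => act g (y n)); split; first by exists x.
split; first by exists y.
by exists N => n m hn hm; have := hN n m hn hm; have := gprod_act_ge g (x n) (y m); lra.
Qed.

Lemma bnd0_mul g x : cv x -> bnd0 (fun n => mul g (x n)) = bact act g (bnd0 x).
Proof.
move=> cx; rewrite /bnd0 bact_class //; congr bclass.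
by apply/funext => n; rewrite /orb actM.
Qed.

Lemma cv_mul g x : cv x -> cv (fun n => mul g (x n)).
Proof.
move=> /(conv_act g); congr (conv_infty d o _).
by apply/funext => n; rewrite /orb actM.
Qed.

(** * Entropy and the information carried by invariant labels *)

Definition xlnx (t : R) : R := t * ln t.

Lemma xlnx_bound (t : R) : 0 <= t <= 1 -> -1 <= xlnx t <= 0.
Proof.
move=> /andP[t0 t1]; rewrite /xlnx.
have [->|tn] := eqVneq t 0; first by rewrite mul0r; lra.
have tp : 0 < t by rewrite lt_neqAle eq_sym tn.
rewrite mulr_ge0_le0 ?ln_le0 // andbT.
have := le_ln1Dx (x := t^-1 - 1); rewrite addrCA subrr addr0 lnV ?posrE // => h.
have tV : 0 < t^-1 by rewrite invr_gt0.
have {}h : - ln t <= t^-1 - 1 by apply: h; lra.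
have : t * - ln t <= t * (t^-1 - 1) by rewrite ler_wpM2l.
by rewrite mulrBr mulfV // mulrN; lra.
Qed.

Lemma ln_le_subr1 (x : R) : 0 < x -> ln x <= x - 1.
Proof. by move=> x0; have := le_ln1Dx (x := x - 1); rewrite addrCA subrr addr0; apply; lra. Qed.

Definition mun n (g : G) : R := Pr [set s | pos s n = g].

Lemma mun_ge0 n g : 0 <= mun n g. Proof. exact: Pr_ge0. Qed.

Lemma mun_le1 n g : mun n g <= 1.
Proof. by apply: Pr_le1; exact: (measurable_pos n [set g]). Qed.

Lemma pos_integral n (f : G -> \bar R) : (forall g, 0 <= f g)%E ->
  (\int[Q]_s f (pos s n) = \esum_(g in [set: G]) (f g * (mun n g)%:E))%E.
Proof.
move=> f0; rewrite (disc_integral Q (X := fun s => pos s n)) //.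
  by apply: eq_esum => g _; rewrite /mun -PrE //; exact: (measurable_pos n [set g]).
by move=> g; exact: (measurable_pos n [set g]).
Qed.

(** Only an inequality, since points not charged by the law of [w_n] contribute nothing to the
    left-hand side. It bounds the mean of the likelihood ratios below. *)
Lemma mun_ratio n (f : G -> R) : (forall g, 0 <= f g) ->
  (\int[Q]_s (f (pos s n) / mun n (pos s n))%:E <= \esum_(g in [set: G]) (f g)%:E)%E.
Proof.
move=> f0; rewrite (pos_integral n (f := fun g => (f g / mun n g)%:E)); last first.
  by move=> g; rewrite lee_fin divr_ge0 // mun_ge0.
apply: le_esum => g _; rewrite -EFinM lee_fin.
have [->|ne] := eqVneq (mun n g) 0; first by rewrite mulr0.
by rewrite divfK.
Qed.

Section Label.
Variables (L : finType) (l : (nat -> G) -> L).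

Definition inv_label : Prop := (forall y, measurable ([set x | l x = y] : set T)) /\
  (forall x x', shift_tail x x' -> l x = l x').

Hypothesis hl : inv_label.

Lemma measurable_path g : measurable_fun setT (fun s : T => (fun n => mul g (pos s n)) : T).
Proof.
apply: (measurability (@path_cylinders G : set (set T))) => // _ [_ [i [a ->]] <-].
by rewrite setTI; exact: (measurable_pos i (fun h => mul g h = a)).
Qed.

Lemma measurable_label g y : measurable ([set s | l (fun n => mul g (pos s n)) = y] : set T).
Proof. by rewrite -[X in measurable X]setTI; exact: (measurable_path g measurableT (hl.1 y)). Qed.

Lemma label_drops g k (s : T) :
  l (fun n => mul g (pos s n)) = l (fun n => mul (mul g (pos s k)) (pos (drops k s) n)).
Proof.
apply: hl.2; exists k, 0%N, 0%N => n _.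
by rewrite addnC posD gmulA addn0.
Qed.

(** A bounded harmonic function of [g] ([cond_prob_harmonic]); at [g = w_k] it is the conditional
    probability of the label [y] given the first [k] increments. *)
Definition cond_prob y (g : G) : R := Pr [set s | l (fun n => mul g (pos s n)) = y].
Local Notation u := cond_prob.

Lemma cond_prob01 y g : 0 <= u y g <= 1.
Proof. by rewrite /u Pr_ge0 Pr_le1 //; exact: measurable_label. Qed.

Lemma cond_prob_ge0 y g : 0 <= u y g. Proof. by case/andP: (cond_prob01 y g). Qed.

Lemma cond_prob_bdd y : bdd (u y). Proof. exact/bdd01/cond_prob01. Qed.

Lemma measurable_pre_label k (A : seq G -> L -> Prop) g :
  measurable ([set s | A (pre k s) (l (fun n => mul g (pos s n)))] : set T).
Proof.
rewrite (_ : [set _ | _] = [set s : T | exists y, A (pre k s) y /\ l (fun n => mul g (pos s n)) = y]).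
  apply: meas_ex => y; apply: meas_and; last exact: measurable_label.
  exact: (measurable_pre k (fun a => A a y)).
by apply/seteqP; split=> s /= => [h|[y [h ->]]] //; exists (l (fun n => mul g (pos s n))).
Qed.

Lemma measurable_fun_pre_label k (phi : seq G -> L -> R) g :
  measurable_fun setT (fun s : T => phi (pre k s) (l (fun n => mul g (pos s n)))).
Proof.
move=> _ Y mY; rewrite setTI.
exact: (measurable_pre_label k (fun a y => Y (phi a y)) g).
Qed.

(** By invariance the label of the path is the label of the walk restarted at its position at time
    [k], so given the first [k] increments its law depends on that position only. *)
Lemma disintegration k (phi : seq G -> L -> R) g : (forall a y, 0 <= phi a y) ->
  (\int[Q]_s (phi (pre k s) (l (fun n => mul g (pos s n))))%:E =
   \int[Q]_s (\sum_y u y (mul g (pos s k)) * phi (pre k s) y)%:E)%E.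
Proof.
move=> phi0.
pose f (a : seq G) (s : T) := (phi a (l (fun n => mul (mul g (prodw a)) (pos s n))))%:E.
transitivity (\int[Q]_s f (pre k s) (drops k s))%E.
  by apply: eq_integral => s _; rewrite /f -/(pos s k) -label_drops.
rewrite (ind_pre_ge0 k (f := f)); last 2 first.
- by move=> a; apply/measurable_EFinP; exact: (measurable_fun_pre_label 0 (fun _ y => phi a y)).
- by move=> a s; rewrite lee_fin.
apply: eq_integral => s _; rewrite /f -/(pos s k).
move: (mul g (pos s k)) (pre k s) => h a.
transitivity (\int[Q]_s' (\sum_y (phi a y)%:E * (\1_[set s | l (fun n => mul h (pos s n)) = y] s')%:E))%E.
  apply: eq_integral => s' _; rewrite (bigD1 (l (fun n => mul h (pos s' n)))) //= indicE mem_set //= mule1.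
  rewrite big1 ?adde0 // => y ne; rewrite indicE memNset ?mule0 //= => e.
  by rewrite e eqxx in ne.
rewrite ge0_integral_sum //.
- rewrite -sumEFin; apply: eq_bigr => y _.
  have ml := measurable_label h y.
  rewrite ge0_integralZl_EFin //.
  - rewrite mulrC EFinM; congr (_ * _)%E.
    by rewrite integral_indic // setIT; exact: PrE.
  - by apply/measurable_EFinP; exact: measurable_indic.
- move=> y; apply/measurable_EFinP; apply: measurable_funM; first exact: measurable_cst.
  by apply: measurable_indic; exact: measurable_label.
- by move=> y s' _; rewrite -EFinM lee_fin mulr_ge0.
Qed.

Lemma cond_prob_sum g : \sum_y u y g = 1.
Proof.
have := disintegration 0 (phi := fun _ _ => 1) g (fun _ _ => ler01).
rewrite integral_cst // => h.
have {}h : (1%:E = (\sum_y u y g)%:E)%E.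
  rewrite -[LHS]mule1 -[X in (_ * X)%E](probability_setT Q) h.
  rewrite (eq_integral (cst (\sum_y u y g)%:E)).
    by rewrite integral_cst // [X in (_ * X)%E](probability_setT Q) mule1.
  by move=> s _; rewrite pos0 gmul1r; congr EFin; apply: eq_bigr => y _; rewrite mulr1.
by case: h.
Qed.

Lemma cond_prob_harmonic n y g : Tn n (u y) g = u y g.
Proof.
rewrite /(u y g).
rewrite (_ : [set s | _] = [set s : T | [set s' : T | l (fun k => mul (mul g (prodw (pre n s))) (pos s' k)) = y] (drops n s)]); last first.
  by apply/seteqP; split=> s /=; rewrite (label_drops g n).
rewrite (ind_pre_set n (Phi := fun a => [set s' : T | l (fun k => mul (mul g (prodw a)) (pos s' k)) = y])) //.
by move=> a; exact: measurable_label.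
Qed.

End Label.

Lemma negligible_bool (b : T -> bool) : measurable [set s | b s] ->
  (\int[Q]_s ((b s)%:R)%:E = 0)%E -> Q.-negligible [set s | b s].
Proof.
move=> mb h; apply/negligibleP => //; rewrite -h.
rewrite (eq_integral (fun s => (\1_[set s | b s] s)%:E)); first by rewrite integral_indic // setIT.
by move=> s _; rewrite indicE; congr (_ %:R)%:E; congr nat_of_bool; apply/idP/idP; rewrite inE.
Qed.

Lemma mun_negligible n : Q.-negligible [set s | mun n (pos s n) == 0].
Proof.
apply: negligible_bool; first exact: (measurable_pos n (fun g => mun n g == 0)).
rewrite (pos_integral n (f := fun g => ((mun n g == 0)%:R)%:E)).
  by rewrite esum1 // => g _; case: eqP => [->|_]; rewrite ?mule0 ?mul0e.
by move=> g; rewrite lee_fin.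
Qed.

Definition ent n : \bar R := (\int[Q]_s (- ln (mun n (pos s n)))%:E)%E.

Lemma nln_ge0 (t : R) : t <= 1 -> 0 <= - ln t.
Proof. by move=> h; rewrite oppr_ge0 ln_le0. Qed.

Lemma mu_le1 a : mu a <= 1.
Proof.
have := Q_atom (Q_iid W) 1 [:: a]; rewrite /= /muw big_seq1 => h.
rewrite -lee_fin -h; apply: probability_le1; exact: measurable_atom.
Qed.

Lemma Q_coord i (a : G) : Q [set s | s i = a] = (mu a)%:E.
Proof.
have := ind_pre_set i (Phi := fun _ => [set s : T | s 0%N = a]) (fun _ => measurable_coord (one := one) 0 a).
rewrite Ex_cst => h.
have -> : [set s : T | s i = a] = [set s : T | [set s : T | s 0%N = a] (drops i s)].
  by apply/seteqP; split=> s /=; rewrite /(drops _ _) addn0.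
rewrite PrE; last exact: (measurable_preshift i (Phi := fun _ => [set s : T | s 0%N = a]) (fun _ => measurable_coord (one := one) 0 a)).
rewrite h /(Pr _) (_ : [set s : T | s 0%N = a] = [set s : T | pre 1 s = [:: a]]).
  by rewrite (Q_atom (Q_iid W)) /= /muw big_seq1.
by apply/seteqP; split=> s /= => [<-//|[]].
Qed.

Lemma coord_integral i (f : G -> \bar R) : (forall g, 0 <= f g)%E ->
  (\int[Q]_s f (s i) = \esum_(g in [set: G]) (f g * (mu g)%:E))%E.
Proof.
move=> f0; rewrite (disc_integral Q (X := fun s : T => s i) (measurable_coord (one := one) i)) //.
by apply: eq_esum => g _; congr (_ * _)%E; exact: Q_coord.
Qed.

Lemma mu_entropy i : (\int[Q]_s (- ln (mu (s i)))%:E < +oo)%E.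
Proof.
rewrite (coord_integral i (f := fun g => (- ln (mu g))%:E)).
  apply: le_lt_trans (mu_ent W); apply: le_esum => g _.
  by rewrite -EFinM lee_fin mulNr mulrC.
by move=> g; rewrite lee_fin nln_ge0 // mu_le1.
Qed.

Lemma mu_negligible i : Q.-negligible [set s | mu (s i) == 0].
Proof.
apply: negligible_bool; first exact: (measurable_coord_set i (fun g => mu g == 0)).
rewrite (coord_integral i (f := fun g => ((mu g == 0)%:R)%:E)).
  by rewrite esum1 // => g _; case: eqP => [->|_]; rewrite ?mule0 ?mul0e.
by move=> g; rewrite lee_fin.
Qed.

Lemma muw_le_mun n (s : T) : muw mu (pre n s) <= mun n (pos s n).
Proof.
have h := Q_atom (Q_iid W) n (pre n s); rewrite size_pre eqxx in h.
rewrite -lee_fin -h /mun -PrE; last exact: (measurable_pos n [set pos s n]).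
apply: le_measure; rewrite ?inE; [exact: measurable_atom|exact: (measurable_pos n [set pos s n])|].
by move=> s' /= e; rewrite /(pos _ _) e.
Qed.

Lemma ae_imp (P P' : T -> Prop) : {ae Q, forall s, P s} -> (forall s, P s -> P' s) ->
  {ae Q, forall s, P' s}.
Proof.
move=> h hi; have h' : Q.-negligible [set s | ~ P s] by exact: h.
by apply: negligibleS h' => s /= n p; apply: n; exact: hi.
Qed.

Lemma ae_and (P P' : T -> Prop) : {ae Q, forall s, P s} -> {ae Q, forall s, P' s} ->
  {ae Q, forall s, P s /\ P' s}.
Proof.
move=> h h'; have n1 : Q.-negligible [set s | ~ P s] by exact: h.
have n2 : Q.-negligible [set s | ~ P' s] by exact: h'.
apply: negligibleS (negligibleU n1 n2) => s /= n; apply: contrapT => /not_orP[p q].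
by apply: n; split; exact: contrapT.
Qed.

Lemma ae_forall (I : countType) (P : I -> T -> Prop) :
  (forall i, {ae Q, forall s, P i s}) -> {ae Q, forall s, forall i, P i s}.
Proof.
move=> h; have h' i : Q.-negligible [set s | ~ P i s] by exact: h.
apply: (@negligibleS _ _ _ Q (\bigcup_n (if unpickle n is Some i then [set s | ~ P i s] else set0))).
  by move=> s /existsNP[i hi]; exists (pickle i) => //; rewrite pickleK.
by apply: negligible_bigcup => n; case: (unpickle n) => [i|]; [exact: h'|exact: negligible_set0].
Qed.

Lemma mu_ae : {ae Q, forall s, forall i, 0 < mu (s i)}.
Proof.
apply: (ae_forall (I := nat) (P := fun i (s : T) => 0 < mu (s i))) => i.
apply: negligibleS (mu_negligible i) => s /= h.
by apply/negPn/negP => ne; apply: h; rewrite lt_neqAle eq_sym ne mu_ge0.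
Qed.

Lemma mun_ae n : {ae Q, forall s, 0 < mun n (pos s n)}.
Proof.
apply: negligibleS (mun_negligible n) => s /= h.
by apply/negPn/negP => ne; apply: h; rewrite lt_neqAle eq_sym ne mun_ge0.
Qed.

Lemma measurable_ln_mun n : measurable_fun setT (fun s : T => (- ln (mun n (pos s n)))%:E).
Proof. exact: (@disc_measurable _ T G (fun s => pos s n) (fun g => measurable_pos n [set g]) _ (\bar R) (fun g => (- ln (mun n g))%:E)). Qed.

Lemma measurable_ln_mu i : measurable_fun setT (fun s : T => (- ln (mu (s i)))%:E).
Proof. exact: (@disc_measurable _ T G (fun s => s i) (measurable_coord (one := one) i) _ (\bar R) (fun g => (- ln (mu g))%:E)). Qed.

Lemma ent_ge0 n : (0 <= ent n)%E.
Proof. by apply: integral_ge0 => s _; rewrite lee_fin nln_ge0 // mun_le1. Qed.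

(** The position is at least as likely as the word spelled, so the entropy of [w_n] is at most [n]
    times that of [mu]. *)
Lemma ent_fin n : (ent n < +oo)%E.
Proof.
have h0 i (s : T) : (0 <= (- ln (mu (s i)))%:E)%E by rewrite lee_fin nln_ge0 // mu_le1.
apply: (@le_lt_trans _ _ (\int[Q]_s (\sum_(i < n) (- ln (mu (s i)))%:E))%E); last first.
  rewrite ge0_integral_sum //; last by move=> i; exact: measurable_ln_mu.
  by apply: lte_sum_pinfty => i _; exact: mu_entropy.
apply: ae_ge0_le_integral => //.
- by move=> s _; rewrite lee_fin nln_ge0 // mun_le1.
- exact: measurable_ln_mun.
- by move=> s _; apply: sume_ge0.
- by apply: emeasurable_sum => i; exact: measurable_ln_mu.
apply: (ae_imp mu_ae) => s hs _; rewrite sumEFin lee_fin.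
have mp : 0 < muw mu (pre n s).
  by apply: muw_gt0; apply/allP => x /mapP[i _ ->]; exact: hs.
apply: (@le_trans _ _ (- ln (muw mu (pre n s)))).
  by rewrite lerN2 ler_ln ?posrE ?muw_le_mun // (lt_le_trans mp) // muw_le_mun.
rewrite /muw /(pre _ _) /mkseq big_map (_ : iota 0 n = index_iota 0 n) ?big_mkord; last by rewrite /index_iota subn0.
elim: n {mp} => [|n IH]; first by rewrite !big_ord0 ln1 oppr0.
rewrite !big_ord_recr /= lnM ?posrE //; last by apply: prodr_gt0.
by rewrite opprD lerD2r.
Qed.

Definition entr n : R := fine (ent n).

Lemma entE n : ent n = (entr n)%:E.
Proof. by rewrite /entr fineK // ge0_fin_numE ?ent_fin ?ent_ge0. Qed.

Lemma ent_stationary n k : (\int[Q]_s (- ln (mun n (pos (drops k s) n)))%:E)%E = ent n.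
Proof.
rewrite (ind_pre_ge0 k (f := fun _ s => (- ln (mun n (pos s n)))%:E)).
- by rewrite integral_cst // [X in (_ * X)%E](probability_setT Q) mule1.
- by move=> _; exact: measurable_ln_mun.
- by move=> _ s; rewrite lee_fin nln_ge0 // mun_le1.
Qed.

Section Label.
Variables (L : finType) (l : (nat -> G) -> L).
Hypothesis hl : inv_label l.
Local Notation u := (cond_prob l).

Definition neg_entropy (g : G) : R := \sum_y xlnx (u y g).

Lemma neg_entropy_bdd : bdd neg_entropy.
Proof.
apply: bdd_sum => y; exists 1 => g; have /andP[h1 h2] := xlnx_bound (cond_prob01 hl y g).
by rewrite ler_norml h1 (le_trans h2).
Qed.

(* The mutual information of [w_n] and the label of the path. *)
Definition info n : R := Tn n neg_entropy one - neg_entropy one.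

(** The conditional entropy of the label given the first [k] increments. *)
Lemma cond_integral k g :
  (\int[Q]_s (- ln (u (l (fun n => mul g (pos s n))) (mul g (pos s k))))%:E)%E = (- Tn k neg_entropy g)%:E.
Proof.
pose phi (a : seq G) y := - ln (u y (mul g (prodw a))).
rewrite (disintegration hl (phi := phi) k g); last first.
  by move=> a y; rewrite nln_ge0 //; case/andP: (cond_prob01 hl y (mul g (prodw a))).
rewrite (eq_integral (fun s : T => (-1 * neg_entropy (mul g (pos s k)))%:E)); last first.
  by move=> s _; congr EFin; rewrite mulr_sumr; apply: eq_bigr => y _; rewrite /phi /xlnx mulN1r -mulrN.
rewrite bm_ExE; last by apply: bmZ; exact: (bm_pos g k neg_entropy_bdd).
by rewrite ExZ ?mulN1r //; exact: (bm_pos g k neg_entropy_bdd).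
Qed.

Lemma cond_negligible k : {ae Q, forall s, 0 < u (l (pos s)) (pos s k)}.
Proof.
have : Q.-negligible [set s | u (l (fun n => mul one (pos s n))) (pos s k) == 0].
  apply: negligible_bool.
    exact: (measurable_pre_label hl k (fun a y => u y (prodw a) == 0)).
  rewrite (disintegration hl (phi := fun a y => (u y (prodw a) == 0)%:R) k one) => [|a y]; last by rewrite ler0n.
  rewrite integral0_eq // => s _; rewrite big1 // => y _; rewrite gmul1 -/(pos s k).
  by case: eqP => [->|]; rewrite ?mul0r ?mulr0.
apply: negligibleS => s /= h; under eq_fun do rewrite gmul1.
apply/negPn/negP => ne; apply: h.
by rewrite lt_neqAle eq_sym ne cond_prob_ge0.
Qed.

Lemma esum_mull (f : G -> \bar R) g :
  (\esum_(h in [set: G]) f (mul g h) = \esum_(h in [set: G]) f h)%E.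
Proof.
rewrite (@reindex_esum R G G setT setT (mul g) f) //.
split=> //; first by move=> h h' _ _ e; rewrite -(gmulKV g h) e gmulKV.
by move=> h _; exists (mul (inv g) h) => //; rewrite gmulVK.
Qed.

Lemma esum_cond_mun c y n : 0 <= c ->
  (\esum_(h in [set: G]) (c * (u y h * mun n h))%:E = (c * u y one)%:E)%E.
Proof.
move=> c0; have bu := bm_pos one n (cond_prob_bdd hl y).
rewrite -[in RHS](cond_prob_harmonic hl n y one) /Tn -ExZ // -bm_ExE; last exact: bmZ.
rewrite (eq_integral (fun s : T => (c * u y (pos s n))%:E)); last by move=> s _; rewrite gmul1.
rewrite (pos_integral n (f := fun g => (c * u y g)%:E)).
  by apply: eq_esum => h _; rewrite -EFinM mulrA.
by move=> g; rewrite lee_fin mulr_ge0 // cond_prob_ge0.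
Qed.

(* Data processing: the label is independent of [w_k] given [w_(k+n)]. *)
Lemma info_le_ent k n : info k + entr n <= entr (k + n).
Proof.
have u0 y (g : G) : 0 <= u y g := cond_prob_ge0 hl y g.
have m0 i (g : G) : 0 <= mun i g := mun_ge0 i g.
(* In place of Jensen's inequality, [ln x <= x - 1] is applied to this ratio, whose mean is at most
   1; the logarithms of its four factors integrate to the four entropies involved. *)
pose ratio (a : seq G) y := u y (prodw (take k a)) * mun (k + n) (prodw a) /
  (u y one * mun n (prodw (drop k a))).
have r0 a y : 0 <= ratio a y.
  apply: divr_ge0; apply: mulr_ge0; [exact: u0|exact: m0|exact: u0|exact: m0].
have R1 : (\int[Q]_s (ratio (pre (k + n) s) (l (fun i => mul one (pos s i))))%:E <= 1)%E.
  rewrite (disintegration hl (phi := ratio) (k + n) one r0).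
  pose f y (a : seq G) (s : T) := (u y (mul (prodw a) (pos s n)) * (u y (prodw a) * mun (k + n) (mul (prodw a) (pos s n)) /
     (u y one * mun n (pos s n))))%:E.
  have f0 y a s : (0 <= f y a s)%E.
    rewrite lee_fin; apply: mulr_ge0; first exact: u0. apply: divr_ge0; apply: mulr_ge0; [exact: u0|exact: m0|exact: u0|exact: m0].
  have mf y a : measurable_fun setT (f y a).
    exact: (@disc_measurable _ T G (fun s => pos s n) (fun g => measurable_pos n [set g]) _ (\bar R)
     (fun h => (u y (mul (prodw a) h) * (u y (prodw a) * mun (k + n) (mul (prodw a) h) /
     (u y one * mun n h)))%:E)).
  rewrite (eq_integral (fun s : T => (\sum_y f y (pre k s) (drops k s))%E)); last first.
    move=> s _; rewrite sumEFin; congr EFin; apply: eq_bigr => y _; rewrite gmul1 /ratio.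
    rewrite pre_take ?leq_addr // -/(pos s (k + n)) posD (preD one) drop_size_cat ?size_pre //.
  rewrite ge0_integral_sum //; last first.
    move=> y _ Y mY; rewrite setTI.
    apply: (measurable_preshift k (Phi := fun a => f y a @^-1` Y)) => a.
    by rewrite -[X in measurable X]setTI; exact: mf.
  rewrite -(cond_prob_sum hl one) -sumEFin; apply: lee_sum => y _.
  rewrite (ind_pre_ge0 k (f := f y)) //.
  apply: (@le_trans _ _ (\int[Q]_s (u y (mul one (pos s k)))%:E)%E); last first.
    rewrite (bm_ExE Q (bm_pos one k (cond_prob_bdd hl y))) lee_fin.
    by rewrite -[leRHS](cond_prob_harmonic hl k y one).
  apply: ge0_le_integral => //.
  - by move=> s _; apply: integral_ge0.
  - exact: (@disc_measurable _ T (seq G) (pre k) (measurable_atom k) _ (\bar R) (fun a => \int[Q]_s' f y a s')%E).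
  - exact: (@disc_measurable _ T G (fun s => pos s k) (fun g => measurable_pos k [set g]) _ (\bar R) (fun h => (u y (mul one h))%:E)).
  move=> s _; rewrite gmul1 /(pos _ _); move: (pre k s) => a.
  pose c := u y (prodw a) / u y one.
  have c0 : 0 <= c by apply: divr_ge0; exact: u0.
  pose psi h := c * (u y (mul (prodw a) h) * mun (k + n) (mul (prodw a) h)).
  rewrite (eq_integral (fun s : T => (psi (pos s n) / mun n (pos s n))%:E)); last first.
    move=> s' _; rewrite /f /psi /c invfM; congr EFin.
    by rewrite !mulrA; ring.
  apply: le_trans (mun_ratio n (f := psi) _) _.
    by move=> h; apply: mulr_ge0 => //; apply: mulr_ge0; [exact: u0|exact: m0].
  rewrite (esum_mull (fun h => (c * (u y h * mun (k + n) h))%:E)).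
  rewrite esum_cond_mun // lee_fin /c.
  by have [->|ne] := eqVneq (u y one) 0; rewrite ?mulr0 // divfK.
have mdrop : measurable_fun setT (fun s : T => (- ln (mun n (pos (drops k s) n)))%:E).
  move=> _ Y mY; rewrite setTI.
  apply: (measurable_preshift k (Phi := fun _ => (fun s : T => (- ln (mun n (pos s n)))%:E) @^-1` Y)) => a.
  by rewrite -[X in measurable X]setTI; exact: measurable_ln_mun.
have mlab g i : measurable_fun setT (fun s : T => (- ln (u (l (fun n => mul one (pos s n))) (g (pos s i))))%:E).
  apply/measurable_EFinP.
  exact: (measurable_fun_pre_label hl i (fun a y => - ln (u y (g (prodw a)))) one).
have mratio : measurable_fun setT (fun s : T => (ratio (pre (k + n) s) (l (fun n => mul one (pos s n))))%:E).
  by apply/measurable_EFinP; exact: (measurable_fun_pre_label hl (k + n) ratio one).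
have n0 y (g : G) : 0 <= - ln (u y g) by rewrite nln_ge0 //; case/andP: (cond_prob01 hl y g).
have nm0 i (g : G) : 0 <= - ln (mun i g) by rewrite nln_ge0 // mun_le1.
pose A (s : T) := - ln (u (l (fun n => mul one (pos s n))) (mul one (pos s 0))).
pose B (s : T) := - ln (u (l (fun n => mul one (pos s n))) (mul one (pos s k))).
have A0 s : 0 <= A s := n0 _ _.
have B0 s : 0 <= B s := n0 _ _.
(* The terms are distributed over the two sides so that each of them is nonnegative. *)
have key : (\int[Q]_s ((A s)%:E + (- ln (mun n (pos (drops k s) n)))%:E + 1%:E) <=
  \int[Q]_s ((B s)%:E + (- ln (mun (k + n) (pos s (k + n))))%:E + (ratio (pre (k + n) s) (l (fun n => mul one (pos s n))))%:E))%E.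
  apply: ae_ge0_le_integral => //.
  - by move=> s _; rewrite -!EFinD lee_fin; apply: addr_ge0 => //; apply: addr_ge0 => //; exact: nm0.
  - apply: emeasurable_funD; [apply: emeasurable_funD => //|exact: measurable_cst].
    exact: (mlab (fun h => mul one h) 0%N).
  - by move=> s _; rewrite -!EFinD lee_fin; apply: addr_ge0 => //; apply: addr_ge0 => //; exact: nm0.
  - apply: emeasurable_funD => //; apply: emeasurable_funD; last exact: measurable_ln_mun.
    exact: (mlab (fun h => mul one h) k).
  have dr : {ae Q, forall s, 0 < mun n (pos (drops k s) n)}.
    have mN : measurable ([set s | mun n (pos s n) == 0] : set T) := measurable_pos n (fun g => mun n g == 0).
    have mN' := measurable_preshift k (Phi := fun _ => [set s : T | mun n (pos s n) == 0]) (fun _ => mN).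
    have N0 : Pr [set s | mun n (pos s n) == 0] = 0.
      have /(negligibleP Q mN) e := mun_negligible n.
      by rewrite /(Pr _) e.
    have : Q.-negligible [set s | mun n (pos (drops k s) n) == 0].
      apply/(negligibleP Q) => //; have := ind_pre_set k (Phi := fun _ => [set s : T | mun n (pos s n) == 0]) (fun _ => mN).
      rewrite Ex_cst N0 => e.
      by apply: etrans (PrE Q mN') _; rewrite e.
    apply: negligibleS => s /= h; apply/negPn/negP => ne; apply: h.
    by rewrite lt_neqAle eq_sym ne mun_ge0.
  apply: (ae_imp (ae_and (ae_and (cond_negligible 0) (cond_negligible k)) (ae_and (mun_ae (k + n)) dr))) => s [[p1 p2] [p3 p4]] _.
  rewrite -!EFinD lee_fin /A /B /ratio pos0 gmul1 gmul1.
  rewrite pos0 in p1.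
  have -> : (fun n => mul one (pos s n)) = pos s by apply/funext => i; rewrite gmul1.
  rewrite pre_take ?leq_addr // (preD one) drop_size_cat ?size_pre // -(preD one).
  rewrite -!/(pos _ _); set x1 := u _ one; set x2 := u _ (pos s k).
  set x3 := mun _ (pos s _); set x4 := mun _ (pos (drops _ _) _).
  have rp : 0 < x2 * x3 / (x1 * x4) by rewrite divr_gt0 // mulr_gt0.
  have := ln_le_subr1 rp.
  rewrite ln_div ?posrE ?mulr_gt0 // !lnM ?posrE //; lra.
have e1 : (\int[Q]_s (A s)%:E = (- neg_entropy one)%:E)%E by rewrite (cond_integral 0 one) Tn0.
have e2 : (\int[Q]_s (B s)%:E = (- Tn k neg_entropy one)%:E)%E by exact: (cond_integral k one).
have mA : measurable_fun setT (fun s => (A s)%:E) by exact: (mlab (fun h => mul one h) 0%N).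
have mB : measurable_fun setT (fun s => (B s)%:E) by exact: (mlab (fun h => mul one h) k).
have ml := measurable_ln_mun (k + n).
move: key; rewrite !ge0_integralD //; try (by move=> s _; rewrite -?EFinD lee_fin ?addr_ge0); try exact: emeasurable_funD.
rewrite e1 e2 ent_stationary -/(ent _) !entE integral_cst // [X in (_ * X)%E](probability_setT Q) mule1 -!EFinD => h.
have {h} h := le_trans h (leeD2l _ R1); move: h; rewrite -EFinD lee_fin /info; lra.
Qed.

Lemma info_le_H k : info k <= entr k.
Proof.
have := info_le_ent k 0; rewrite addn0.
suff -> : entr 0 = 0 by rewrite addr0.
rewrite /entr /ent (eq_integral (cst 0%E)) ?integral0 // => s _.
by rewrite /mun pos0 (_ : [set _ | _] = setT) ?Pr_setT ?ln1 ?oppr0 //; apply/seteqP; split.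
Qed.

End Label.

(** * A coding bound for the conditional entropy *)

Lemma one_mul_pos (s : T) : (fun n => mul one (pos s n)) = pos s.
Proof. by apply/funext => i; rewrite gmul1. Qed.

Lemma esum_mulr_le (f : G -> \bar R) c M : 0 <= c -> (forall g, 0 <= f g)%E ->
  (\esum_(g in [set: G]) f g <= M)%E -> (\esum_(g in [set: G]) (f g * c%:E) <= M * c%:E)%E.
Proof.
move=> c0 f0 h; apply: ge_ereal_sup => _ [A fA <-]; rewrite -ge0_mule_fsuml //.
apply: lee_wpmul2r; first by rewrite lee_fin.
by apply: le_trans h; apply: esum_ge; exists A.
Qed.

Section Gibbs.
Variables (L : finType) (l : (nat -> G) -> L).
Hypothesis hl : inv_label l.
Local Notation u := (cond_prob l).

Lemma measurable_ln_cond i g :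
  measurable_fun setT (fun s : T => (- ln (u (l (fun n => mul one (pos s n))) (mul g (pos s i))))%:E).
Proof.
apply/measurable_EFinP.
exact: (measurable_fun_pre_label hl i (fun a y => - ln (u y (mul g (prodw a)))) one).
Qed.

(** The left-hand side is the conditional entropy of [w_n] given the label. It is at most the mean
    code length [- ln q] for any family of subprobabilities [q] indexed by the label, again by
    [ln x <= x - 1] for a ratio of mean at most 1. *)
Lemma gibbs n (q : G -> L -> R) (c : T -> R) : (forall g y, 0 <= q g y) ->
  (forall y, \esum_(g in [set: G]) (q g y)%:E <= 1%:E)%E ->
  measurable_fun setT (fun s => (c s)%:E) -> (forall s, 0 <= c s) ->
  {ae Q, forall s, 0 < q (pos s n) (l (pos s)) /\ - ln (q (pos s n) (l (pos s))) <= c s} ->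
  ((entr n - info l n)%:E <= \int[Q]_s (c s)%:E)%E.
Proof.
move=> q0 q1 mc c0 hq.
have u0 y (g : G) : 0 <= u y g := cond_prob_ge0 hl y g.
have m0 (g : G) : 0 <= mun n g := mun_ge0 n g.
pose ratio (a : seq G) y := q (prodw a) y * u y one / (u y (prodw a) * mun n (prodw a)).
have r0 a y : 0 <= ratio a y.
  by apply: divr_ge0; apply: mulr_ge0.
have R1 : (\int[Q]_s (ratio (pre n s) (l (fun i => mul one (pos s i))))%:E <= 1)%E.
  rewrite (disintegration hl (phi := ratio) n one r0).
  pose f y g := q g y * u y one.
  have f0 y g : 0 <= f y g by apply: mulr_ge0.
  have fm y : measurable_fun setT (fun s : T => (f y (pos s n) / mun n (pos s n))%:E).
    exact: (@disc_measurable _ T G (fun s => pos s n) (fun g => measurable_pos n [set g]) _ (\bar R) (fun h => (f y h / mun n h)%:E)).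
  apply: (@le_trans _ _ (\int[Q]_s (\sum_y (f y (pos s n) / mun n (pos s n))%:E))%E).
    apply: ge0_le_integral => //.
    - by move=> s _; rewrite lee_fin; apply: sumr_ge0 => y _; apply: mulr_ge0.
    - exact: (@disc_measurable _ T (seq G) (pre n) (measurable_atom n) _ (\bar R) (fun a => (\sum_y u y (mul one (prodw a)) * ratio a y)%:E)).
    - by apply: emeasurable_sum.
    move=> s _; rewrite sumEFin lee_fin gmul1; apply: ler_sum => y _.
    rewrite /ratio /f -/(pos s n) invfM.
    have [->|ne] := eqVneq (u y (pos s n)) 0; first by rewrite mul0r; apply: divr_ge0 => //; exact: mulr_ge0.
    by rewrite mulrCA mulVKf.
  rewrite ge0_integral_sum //; last by move=> y s _; rewrite lee_fin divr_ge0.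
  rewrite -(cond_prob_sum hl one) -sumEFin; apply: lee_sum => y _.
  apply: le_trans (mun_ratio n (f0 y)) _.
  rewrite -[leRHS]mul1e; apply: (esum_mulr_le (f := fun g => (q g y)%:E)) => //.
    by move=> g; rewrite lee_fin.
have mratio : measurable_fun setT (fun s : T => (ratio (pre n s) (l (fun n => mul one (pos s n))))%:E).
  by apply/measurable_EFinP; exact: (measurable_fun_pre_label hl n ratio one).
have n0 y (g : G) : 0 <= - ln (u y g) by rewrite nln_ge0 //; case/andP: (cond_prob01 hl y g).
have nm0 i (g : G) : 0 <= - ln (mun i g) by rewrite nln_ge0 // mun_le1.
pose A (s : T) := - ln (u (l (fun n => mul one (pos s n))) (mul one (pos s 0))).
pose B (s : T) := - ln (u (l (fun n => mul one (pos s n))) (mul one (pos s n))).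
have A0 s : 0 <= A s := n0 _ _.
have B0 s : 0 <= B s := n0 _ _.
have mA : measurable_fun setT (fun s => (A s)%:E) by exact: measurable_ln_cond.
have mB : measurable_fun setT (fun s => (B s)%:E) by exact: measurable_ln_cond.
have ml := measurable_ln_mun n.
have key : (\int[Q]_s ((B s)%:E + (- ln (mun n (pos s n)))%:E + 1%:E) <=
  \int[Q]_s ((A s)%:E + (c s)%:E + (ratio (pre n s) (l (fun n => mul one (pos s n))))%:E))%E.
  apply: ae_ge0_le_integral => //.
  - by move=> s _; rewrite -!EFinD lee_fin; apply: addr_ge0 => //; apply: addr_ge0 => //; exact: nm0.
  - by apply: emeasurable_funD; [apply: emeasurable_funD => //|exact: measurable_cst].
  - by move=> s _; rewrite -!EFinD lee_fin; apply: addr_ge0 => //; apply: addr_ge0 => //; exact: nm0.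
  - by apply: emeasurable_funD => //; apply: emeasurable_funD.
  apply: (ae_imp (ae_and (ae_and (cond_negligible hl 0) (cond_negligible hl n)) (ae_and (mun_ae n) hq))) => s [[p1 p2] [p3 [p4 p5]]] _.
  rewrite -!EFinD lee_fin /A /B /ratio one_mul_pos -/(pos s n) !gmul1.
  rewrite pos0 in p1 *.
  move: p5 p4 p3 p2 p1; set x1 := u _ one; set x2 := u _ (pos s n).
  set x3 := mun _ (pos s _); set x4 := q _ _ => p5 p4 p3 p2 p1.
  have rp : 0 < x4 * x1 / (x2 * x3) by rewrite divr_gt0 // mulr_gt0.
  have := ln_le_subr1 rp.
  rewrite ln_div ?posrE ?mulr_gt0 // !lnM ?posrE //; lra.
have e1 : (\int[Q]_s (A s)%:E = (- neg_entropy l one)%:E)%E by rewrite (cond_integral hl 0 one) Tn0.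
have e2 : (\int[Q]_s (B s)%:E = (- Tn n (neg_entropy l) one)%:E)%E by exact: (cond_integral hl n one).
move: key; rewrite !ge0_integralD //; try (by move=> s _; rewrite -?EFinD lee_fin ?addr_ge0); try exact: emeasurable_funD.
rewrite e1 e2 -/(ent _) entE integral_cst // [X in (_ * X)%E](probability_setT Q) mule1 => h.
have {h} h := le_trans h (leeD2l _ R1); move: h.
have C0 : (0 <= \int[Q]_s (c s)%:E)%E by apply: integral_ge0 => s _; rewrite lee_fin; exact: c0.
case: (\int[Q]_s (c s)%:E)%E C0 => [r _|_ _|//]; last by rewrite leey.
by rewrite -!EFinD !lee_fin /info; lra.
Qed.

End Gibbs.

Lemma Pr_coords n (c : nat -> bool) (a : nat -> G) :
  Pr [set s | forall i, (i < n)%N -> c i -> s i = a i] = \prod_(i < n) (if c i then mu (a i) else 1).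
Proof.
elim: n => [|n IH].
  by rewrite big_ord0 (_ : [set _ | _] = setT) ?Pr_setT //; apply/seteqP; split.
rewrite big_ord_recr /= -IH.
pose C (w : seq G) := forall i, (i < n)%N -> c i -> nth one w i = a i.
pose D := [set s : T | c n -> s 0%N = a n].
have mD : measurable D by apply: meas_imp; exact: measurable_coord.
have PD : Pr D = if c n then mu (a n) else 1.
  rewrite /D; case: (c n).
    rewrite (_ : [set s | _] = [set s : T | s 0%N = a n]); first by rewrite /(Pr _) Q_coord.
    by apply/seteqP; split=> s /=; [move/(_ isT)|].
  by rewrite (_ : [set s | _] = setT) ?Pr_setT //; apply/seteqP; split.
rewrite (_ : [set s | _] = [set s : T | [set s' : T | C (pre n s) /\ D s'] (drops n s)]); last first.
  apply/seteqP; split=> s /=; rewrite /C /D /= /(drops _ _) addn0 => h.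
    split=> [i i_lt|]; first by rewrite nth_pre // => /h; apply; exact: ltnW.
    by apply: h.
  move=> i; rewrite ltnS leq_eqVlt => /orP[/eqP->|i_lt]; first exact: h.2.
  by rewrite -(nth_pre one s i_lt); exact: h.1.
rewrite (ind_pre_set n (Phi := fun w => [set s' : T | C w /\ D s'])); last first.
  by move=> w; apply: meas_and => //; exact: meas_cst.
have mC : measurable [set s : T | C (pre n s)] by exact: (measurable_pre n C).
have -> : [set s : T | forall i, (i < n)%N -> c i -> s i = a i] = [set s : T | C (pre n s)].
  by apply/seteqP; split=> s /= h i i_lt; have := h i i_lt; rewrite nth_pre.
rewrite -(Ex_indic Q mC) mulrC -ExZ; last exact: bm_indic.
apply: eq_Ex => s; rewrite indicE.
have [h|h] := pselect (C (pre n s)).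
  rewrite mem_set // mulr1 -PD; congr (Pr _).
  by apply/seteqP; split=> s' /= => [[]|].
rewrite memNset // mulr0 (_ : [set _ | _] = set0) ?Pr_set0 //.
by apply/seteqP; split=> s' /= => [[]|].
Qed.

Definition masked n (b : {ffun 'I_n -> bool}) (s : nat -> G) : seq (option G) :=
  [seq (if b i then Some (s i) else None) | i <- enum 'I_n].

Lemma measurable_masked n b (A : set (seq (option G))) : measurable ([set s | A (@masked n b s)] : set T).
Proof.
rewrite (_ : [set _ | _] = [set s : T | A (@masked n b (nth one (pre n s)))]).
  exact: (measurable_pre n (fun w => A (@masked n b (nth one w)))).
have e (s : T) : @masked n b (nth one (pre n s)) = masked b s.
  by apply/eq_in_map => i _; rewrite nth_pre.
by apply/seteqP; split=> s /=; rewrite e.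
Qed.

Lemma Pr_masked n (b : {ffun 'I_n -> bool}) (s : T) :
  \prod_(i < n) (if b i then mu (s i) else 1) <= Pr [set s' | masked b s' = masked b s].
Proof.
pose c i := if insub i is Some j then b j else false.
rewrite (eq_bigr (fun i : 'I_n => if c i then mu (s i) else 1)); last first.
  by move=> i _; rewrite /c valK.
rewrite -Pr_coords; apply: Pr_le.
- apply: meas_all => i; apply: meas_imp; apply: meas_imp; exact: measurable_coord.
- exact: (measurable_masked b (fun w => w = masked b s)).
move=> s' /= h; apply/eq_in_map => i _; case: ifP => // bi.
by rewrite h //= /c valK.
Qed.

Section Decoder.
Variables (L Z : finType) (l : (nat -> G) -> L).
Hypothesis hl : inv_label l.
Variables (n : nat) (fl : nat -> T -> bool) (dec : seq (option G) -> Z -> L -> G) (r : R).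
Hypothesis mfl : forall i, measurable [set s | fl i s].
Hypothesis r01 : 0 < r < 1.

Definition flags (s : T) : {ffun 'I_n -> bool} := [ffun i : 'I_n => fl i s].
Hypothesis decP : forall s, exists z, dec (masked (flags s) s) z (l (pos s)) = pos s n.

Definition step_cost i (s : T) : R := if fl i s then - ln r - ln (mu (s i)) else - ln (1 - r).

Let wt (b : {ffun 'I_n -> bool}) : R := \prod_(i < n) (if b i then r else 1 - r).

Let wt_ge0 b : 0 <= wt b.
Proof. by case/andP: r01 => h1 h2; apply: prodr_ge0 => i _; case: ifP => _; rewrite ?subr_ge0 ltW. Qed.

Let wt_sum : \sum_b wt b = 1.
Proof.
rewrite /wt -(bigA_distr_bigA (fun (_ : 'I_n) (b : bool) => if b then r else 1 - r)).
by rewrite big1 // => i _; rewrite big_bool /= addrC subrK.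
Qed.

(** The law of the decoded element when the flags are independent Bernoulli([r]), the index [z] is
    uniform and the increments are a fresh sample. The actual flags may depend on the whole path;
    they only need to be possible values. *)
Let q (g : G) (y : L) : R :=
  \sum_b \sum_z Pr [set s' | dec (masked b s') z y = g] * (wt b / #|Z|%:R).

Let Z_gt0 : (0 < #|Z|)%N.
Proof. by have [z _] := decP point; apply/card_gt0P; exists z. Qed.

Let q_ge0 g y : 0 <= q g y.
Proof. by apply: sumr_ge0 => b _; apply: sumr_ge0 => z _; rewrite mulr_ge0 ?Pr_ge0 ?divr_ge0. Qed.

Let q_le1 y : (\esum_(g in [set: G]) (q g y)%:E <= 1%:E)%E.
Proof.
pose f b z g := (Pr [set s' | dec (@masked n b s') z y = g] * (wt b / #|Z|%:R))%:E.
have f0 b z g : (0 <= f b z g)%E by rewrite lee_fin mulr_ge0 ?Pr_ge0 ?divr_ge0.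
have f1 b z : (\esum_(g in [set: G]) f b z g <= (wt b / #|Z|%:R)%:E)%E.
  rewrite /f -[leRHS]mul1e; under eq_esum do rewrite EFinM.
  apply: esum_mulr_le; rewrite ?divr_ge0 //; first by move=> g; rewrite lee_fin Pr_ge0.
  have m A : measurable ([set s | A (dec (masked b s) z y)] : set T) by exact: (measurable_masked b (fun w => A (dec w z y))).
  have := disc_integral Q (X := fun s : T => dec (masked b s) z y) (fun g => m (fun h => h = g)) (f := fun=> 1%E) (fun _ => lee01).
  rewrite integral_cst // [X in (_ * X)%E](probability_setT Q) mule1 => ->.
  apply: le_esum => g _; rewrite mul1e; rewrite -PrE //; exact: (m (fun h => h = g)).
rewrite (eq_esum (b := fun g => (\sum_b \sum_z f b z g)%E)); last first.
  by move=> g _; rewrite /q -sumEFin; apply: eq_bigr => b _; rewrite sumEFin.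
rewrite esum_sum; last by move=> g b _ _; apply: sume_ge0.
apply: (@le_trans _ _ (\sum_b (wt b)%:E)%E); last by rewrite sumEFin wt_sum.
apply: lee_sum => b _; rewrite esum_sum //.
apply: (@le_trans _ _ (\sum_(z : Z) (wt b / #|Z|%:R)%:E)%E); first by apply: lee_sum.
rewrite sumEFin lee_fin.
have -> : \sum_(z : Z) wt b / #|Z|%:R = wt b / #|Z|%:R * #|Z|%:R by rewrite sumr_const mulr_natr.
rewrite divfK //.
by rewrite pnatr_eq0 -lt0n.
Qed.

Let q_lower s : wt (flags s) / #|Z|%:R * \prod_(i < n) (if fl i s then mu (s i) else 1) <= q (pos s n) (l (pos s)).
Proof.
have [z hz] := decP s; have w0 := wt_ge0 (flags s).
rewrite /q (bigD1 (flags s)) //= (bigD1 z) //= -addrA ler_wpDr //.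
  apply: addr_ge0; first by apply: sumr_ge0 => z' _; rewrite mulr_ge0 ?Pr_ge0 ?divr_ge0.
  by apply: sumr_ge0 => b _; apply: sumr_ge0 => z' _; rewrite mulr_ge0 ?Pr_ge0 ?divr_ge0.
rewrite mulrC; apply: ler_wpM2r; first by rewrite divr_ge0.
apply: (@le_trans _ _ (Pr [set s' | masked (flags s) s' = masked (flags s) s])).
  apply: le_trans (Pr_masked (flags s) s).
  by under eq_bigr => i _ do rewrite -[fl i s](ffunE (fun i : 'I_n => fl i s)).
apply: Pr_le.
- exact: (measurable_masked (flags s) (fun w => w = masked (flags s) s)).
- exact: (measurable_masked (flags s) (fun w => dec w z (l (pos s)) = pos s n)).
by move=> s' /= ->.
Qed.

Lemma step_cost_ge0 i s : 0 <= step_cost i s.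
Proof.
case/andP: r01 => h1 h2; rewrite /step_cost; have := nln_ge0 (mu_le1 (s i)).
case: ifP => _ m0; last by apply: nln_ge0; lra.
have : 0 <= - ln r by apply: nln_ge0; lra.
lra.
Qed.

Lemma measurable_step_cost i : measurable_fun setT (fun s : T => (step_cost i s)%:E).
Proof.
rewrite (_ : (fun s => _) = (fun s : T => if fl i s then (- ln r)%:E + (- ln (mu (s i)))%:E else (- ln (1 - r))%:E)%E).
  apply: measurable_fun_ifT.
  - by apply: (measurable_fun_bool true); rewrite setTI; exact: mfl.
  - by apply: emeasurable_funD; [exact: measurable_cst|exact: measurable_ln_mu].
  - exact: measurable_cst.
by apply/funext => s; rewrite /step_cost; case: ifP.
Qed.

(* The flags and the flagged increments are transmitted with the ideal code lengths of
   independent Bernoulli([r]) flags and of [mu]. *)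
Lemma coding : ((entr n - info l n)%:E <=
  (ln #|Z|%:R)%:E + \sum_(i < n) \int[Q]_s (step_cost i s)%:E)%E.
Proof.
have /andP[rp r1] := r01.
have lZ : 0 <= ln #|Z|%:R :> R by rewrite ln_ge0 // ler1n.
pose c (s : T) := ln #|Z|%:R + \sum_(i < n) step_cost i s.
have mS : measurable_fun setT (fun s : T => (\sum_(i < n) (step_cost i s)%:E)%E).
  by apply: emeasurable_sum => i; exact: measurable_step_cost.
have cE s : (c s)%:E = ((ln #|Z|%:R)%:E + \sum_(i < n) (step_cost i s)%:E)%E by rewrite sumEFin.
have c0 s : 0 <= c s by rewrite addr_ge0 // sumr_ge0 // => i _; exact: step_cost_ge0.
have mc : measurable_fun setT (fun s => (c s)%:E).
  under eq_fun do rewrite cE.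
  by apply: emeasurable_funD => //; exact: measurable_cst.
have -> : ((ln #|Z|%:R)%:E + \sum_(i < n) \int[Q]_s (step_cost i s)%:E = \int[Q]_s (c s)%:E)%E.
  under [RHS]eq_integral do rewrite cE.
  rewrite ge0_integralD //; last by move=> s _; apply: sume_ge0 => i _; rewrite lee_fin step_cost_ge0.
  rewrite integral_cst // [X in (_ * X)%E](probability_setT Q) mule1 ge0_integral_sum //.
    by move=> i; exact: measurable_step_cost.
  by move=> i s _; rewrite lee_fin step_cost_ge0.
apply: (gibbs hl q_ge0 q_le1 mc c0).
apply: (ae_imp (mu_ae)) => s hs.
have Zp : 0 < #|Z|%:R :> R by rewrite ltr0n.
have w0 : 0 < wt (flags s) by apply: prodr_gt0 => i _; case: ifP => _; lra.
have m0 : 0 < \prod_(i < n) (if fl i s then mu (s i) else 1) by apply: prodr_gt0 => i _; case: ifP.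
have p0 := mulr_gt0 (divr_gt0 w0 Zp) m0.
split; first exact: lt_le_trans (q_lower s).
have := q_lower s; rewrite -ler_ln ?posrE //; last exact: lt_le_trans (q_lower s).
rewrite -lerN2 => h; apply: le_trans h _.
rewrite lnM ?posrE ?divr_gt0 // ln_div ?posrE // /c.
have lp (F : 'I_n -> R) : (forall i, 0 < F i) -> 0 < \prod_i F i /\ ln (\prod_i F i) = \sum_i ln (F i).
  move=> F0; apply: (big_ind2 (fun x y => 0 < x /\ ln x = y)); rewrite ?ln1 //.
  by move=> x1 x2 y1 y2 [a b] [a' b']; rewrite mulr_gt0 // lnM ?posrE // b b'.
rewrite (lp _ _).2; last by move=> i; case: ifP => _; lra.
rewrite (lp _ _).2; last by move=> i; case: ifP.
rewrite (_ : \sum_(i < n) step_cost i s = - (\sum_(i < n) ln (if flags s i then r else 1 - r) + \sum_(i < n) ln (if fl i s then mu (s i) else 1))); first lra.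
rewrite -big_split /= -sumrN; apply: eq_bigr => i _.
by rewrite /step_cost ffunE; case: ifP => _; rewrite ?ln1; lra.
Qed.

End Decoder.
(** Uniform integrability of [- ln mu]: by finite entropy, all but [e] of its mean comes from a
    finite set of increments, on which it is bounded by [K]. *)
Lemma entropy_tail e : 0 < e -> exists2 K : R, 0 <= K & forall i (b : T -> bool),
  measurable [set s | b s] ->
  (\int[Q]_s (if b s then - ln (mu (s i)) else 0)%:E <= (K * Pr [set s | b s] + e)%:E)%E.
Proof.
move=> e0; pose h g : \bar R := ((- ln (mu g))%:E * (mu g)%:E)%E.
have n0 g : 0 <= - ln (mu g) by apply: nln_ge0; exact: mu_le1.
have h0 g : (0 <= h g)%E by rewrite /h -EFinM lee_fin mulr_ge0 // mu_ge0.
have hfin : (\esum_(g in [set: G]) h g)%E \is a fin_num.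
  rewrite ge0_fin_numE; last by apply: esum_ge0 => g _.
  by rewrite -(coord_integral 0 (f := fun g => (- ln (mu g))%:E)) ?mu_entropy // => g; rewrite lee_fin.
have [_ [A [finA _] <-] hA] := ub_ereal_sup_adherent e0 hfin.
have [K [K0 hK]] : exists K : R, 0 <= K /\ forall g, A g -> - ln (mu g) <= K.
  have /finite_seqP[r rE] := finA.
  exists (\sum_(g <- r) - ln (mu g)); split; first by apply: sumr_ge0.
  move=> g; rewrite rE /= => gr.
  by rewrite (big_rem g) //= lerDl; apply: sumr_ge0.
exists K => // i b mb.
pose f g := if `[< A g >] then 0 else - ln (mu g).
have f0 g : 0 <= f g by rewrite /f; case: ifP.
have fl : (\int[Q]_s (f (s i))%:E <= e%:E)%E.
  rewrite (coord_integral i (f := fun g => (f g)%:E)) => [|g]; last by rewrite lee_fin.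
  have := @esumID _ _ A [set: G] h (fun g _ => h0 g).
  rewrite setTI (esum_fset (F := A)) // setTI => hID.
  have e1 : (\esum_(g in ~` A) h g = \esum_(g in [set: G]) ((f g)%:E * (mu g)%:E))%E.
    rewrite esum_mkcond; apply: eq_esum => g _; rewrite /f /h.
    case: asboolP => [Ag|nAg]; first by rewrite memNset ?mul0e //=; exact.
    by rewrite mem_set.
  rewrite -e1; move: hA; rewrite -/(esum _ _) hID.
  move: hfin; rewrite hID fin_numD => /andP[].
  case: (\sum_(i \in A) h i)%E => [x _|//|//].
  case: (\esum_(i in ~` A) h i)%E => [y _|//|//].
  move=> hl'; have : x + y - e < x by rewrite -lte_fin.
  by rewrite lee_fin; lra.
have mf : measurable_fun setT (fun s : T => (f (s i))%:E).
  exact: (@disc_measurable _ T G (fun s => s i) (measurable_coord (one := one) i) _ (\bar R) (fun g => (f g)%:E)).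
have mi : measurable_fun setT (fun s : T => (K * \1_[set s | b s] s)%:E).
  by apply/measurable_EFinP; apply: measurable_funM; [exact: measurable_cst|exact: measurable_indic].
apply: (@le_trans _ _ (\int[Q]_s ((K * \1_[set s | b s] s)%:E + (f (s i))%:E))%E).
  apply: ge0_le_integral => //.
  - by move=> s _; case: ifP => _; rewrite lee_fin.
  - rewrite (_ : (fun s : T => _) = (fun s : T => if b s then (- ln (mu (s i)))%:E else 0%:E)); last first.
      by apply/funext => s; case: ifP.
    apply: measurable_fun_ifT; [|exact: measurable_ln_mu|exact: measurable_cst].
    by apply: (measurable_fun_bool true); rewrite setTI.
  - by apply: emeasurable_funD.
  move=> s _; rewrite -EFinD lee_fin indicE.
  have [bs|bs] := boolP (b s); last by rewrite memNset ?mulr0 ?add0r //=; exact/negP.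
  rewrite mem_set // mulr1 /f; case: asboolP => [/hK|_]; rewrite ?addr0 //.
  by rewrite lerDr.
rewrite ge0_integralD //; last 2 first.
- by move=> s _; rewrite lee_fin mulr_ge0 // indicE.
- by move=> s _; rewrite lee_fin.
rewrite EFinD; apply: leeD => //.
by rewrite (bm_ExE Q (bmZ K (bm_indic mb))) ExZ ?Ex_indic //; exact: bm_indic.
Qed.

(** [C] depends on [e] only, so the density of the flags can be made small after [C] is known. *)
Lemma coding_rate e : 0 < e -> exists2 C : R, 0 <= C &
  forall (L Z : finType) (l : (nat -> G) -> L) n (fl : nat -> T -> bool)
    (dec : seq (option G) -> Z -> L -> G), inv_label l ->
  (forall i, measurable [set s | fl i s]) ->
  (forall s, exists z, dec (masked (flags n fl s) s) z (l (pos s)) = pos s n) ->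
  entr n - info l n <= ln #|Z|%:R + n%:R * e + C * \sum_(i < n) Pr [set s | fl i s].
Proof.
move=> e0; have h0 : 0 < e / 2 by lra.
have [K K0 hK] := entropy_tail h0.
(* An unflagged step then costs exactly [e / 2]; the other half of [e] is the tail term of
   [entropy_tail]. *)
pose r : R := 1 - expR (- (e / 2)).
have r01 : 0 < r < 1.
  have := expR_gt0 (- (e / 2)); have : expR (- (e / 2)) < 1 by rewrite expR_lt1; lra.
  rewrite /r => h1 h2; apply/andP; split; lra.
have lr : - ln (1 - r) = e / 2 by rewrite /r opprB addrC subrK expRK opprK.
have lr0 : 0 <= - ln r by apply: nln_ge0; case/andP: r01 => _ /ltW.
exists (- ln r + K); first by rewrite addr_ge0.
move=> L Z l n fl dec hl mfl hdec.
have := coding hl mfl r01 hdec.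
have sc i : (\int[Q]_s (step_cost fl r i s)%:E <= (e + (- ln r + K) * Pr [set s | fl i s])%:E)%E.
  pose a (s : T) := e / 2 + - ln r * \1_[set s | fl i s] s.
  pose b (s : T) := if fl i s then - ln (mu (s i)) else 0.
  have ba : bm a by apply: bmD; [exact: bm_cst|apply: bmZ; exact: bm_indic].
  have b0 s : 0 <= b s by rewrite /b; case: ifP => // _; apply: nln_ge0; exact: mu_le1.
  have a0 s : 0 <= a s by apply: addr_ge0; [exact: ltW|apply: mulr_ge0 => //; rewrite indicE].
  have mb : measurable_fun setT (fun s : T => (b s)%:E).
    rewrite (_ : (fun s : T => _) = (fun s : T => if fl i s then (- ln (mu (s i)))%:E else 0%:E)); last first.
      by apply/funext => s; rewrite /b; case: ifP.
    apply: measurable_fun_ifT; [|exact: measurable_ln_mu|exact: measurable_cst].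
    by apply: (measurable_fun_bool true); rewrite setTI; exact: mfl.
  have ma : measurable_fun setT (fun s : T => (a s)%:E) by apply/measurable_EFinP; exact: ba.1.
  apply: (@le_trans _ _ (\int[Q]_s ((a s)%:E + (b s)%:E))%E).
    apply: ge0_le_integral => //.
    - by move=> s _; rewrite lee_fin step_cost_ge0.
    - exact: measurable_step_cost.
    - by apply: emeasurable_funD.
    move=> s _; rewrite -EFinD lee_fin /step_cost /a /b indicE.
    have [bs|bs] := boolP (fl i s); first by rewrite mem_set // mulr1; lra.
    by rewrite memNset ?mulr0 ?addr0 //= ?lr //; exact/negP.
  rewrite ge0_integralD //; last 2 first.
  - by move=> s _; rewrite lee_fin; exact: a0.
  - by move=> s _; rewrite lee_fin; exact: b0.
  have e1 : (\int[Q]_s (a s)%:E)%E = (e / 2 + - ln r * Pr [set s | fl i s])%:E.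
    rewrite (bm_ExE Q ba) ExD; [|exact: bm_cst|by apply: bmZ; exact: bm_indic].
    by rewrite Ex_cst ExZ ?Ex_indic //; exact: bm_indic.
  rewrite e1; apply: le_trans (leeD2l _ (hK i (fl i) (mfl i))) _.
  by rewrite -EFinD lee_fin mulrDl; lra.
move=> h; rewrite -lee_fin; apply: le_trans h _.
apply: (@le_trans _ _ ((ln #|Z|%:R)%:E + \sum_(i < n) (e + (- ln r + K) * Pr [set s | fl i s])%:E)%E).
  by apply: leeD2l; apply: lee_sum => i _; exact: sc.
rewrite sumEFin -EFinD lee_fin big_split /= mulr_sumr sumr_const card_ord -mulr_natl; lra.
Qed.

(** * Decoding the walk from its limit point *)

(* Labels that are Borel functions of the limit point. *)
Definition blabel (L : finType) (l : (nat -> G) -> L) : Prop := inv_label l /\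
  exists2 F : set (nat -> X) -> L, (forall y, borel [set xi | bp xi /\ F xi = y]) &
    forall x, cv x -> l x = F (bnd0 x).

Definition set_label (I : finType) (A : I -> set (set (nat -> X))) (x : nat -> G) : {ffun I -> bool} :=
  [ffun i => `[< A i (bnd0 x) >]].

Lemma set_labelP (I : finType) (A : I -> set (set (nat -> X))) :
  (forall i, borel (A i)) -> blabel (set_label A).
Proof.
move=> hA; split; [split|].
- move=> y.
  have -> : [set x : nat -> G | set_label A x = y] = [set x : nat -> G | forall i, A i (bnd0 x) <-> y i].
    apply/seteqP; split=> x /=; first by move=> <- i; rewrite ffunE; split=> [/asboolP|/asboolP].
    by move=> h; apply/ffunP => i; rewrite ffunE; apply/idP/idP => [/asboolP /h|/h /asboolP].
  apply: (@meas_all _ T I (fun i => [set x : T | A i (bnd0 x) <-> y i])) => i; case: (y i).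
    rewrite (_ : [set s | _] = [set x | A i (bnd0 x)]); first exact: measurable_bnd0.
    by apply/seteqP; split=> x /= => [->|h]; split.
  rewrite (_ : [set s | _] = ~` [set x | A i (bnd0 x)]); first by apply: measurableC; exact: measurable_bnd0.
  by apply/seteqP; split=> x /= => [[h _] /h|h] //; split.
- by move=> x x' h; apply/ffunP => i; rewrite !ffunE (bnd0_shift_tail h).
exists (fun xi => [ffun i => `[< A i xi >]]) => [y|//].
have h (r : seq I) : borel [set xi | bp xi /\ forall i, i \in r -> A i xi <-> y i].
  elim: r => [|i r IH].
    by rewrite (_ : [set _ | _] = bp); [exact: borelT|apply/seteqP; split=> [xi []|]].
  rewrite (_ : [set _ | _] = [set xi | bp xi /\ forall i, i \in r -> A i xi <-> y i] `&`
     (if y i then A i else bp `\` A i)).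
    by apply: borelI => //; case: (y i) => //; exact: borelC.
  apply/seteqP; split=> xi /= [].
    move=> bx h; split; first by split=> // j jr; apply: h; rewrite inE jr orbT.
    have := h i (mem_head _ _); case: (y i) => [->//|[h1 h2]]; split=> //.
    by move=> /h1.
  move=> [bx h] hi; split=> // j; rewrite inE => /orP[/eqP->|]; last exact: h.
  by case: (y i) hi => [|[]].
rewrite (_ : [set _ | _] = [set xi | bp xi /\ forall i, i \in enum I -> A i xi <-> y i]) //.
apply/seteqP; split=> xi /= [bx hx]; split=> //.
  by move=> i _; rewrite -hx ffunE; split=> [/asboolP|/asboolP].
apply/ffunP => i; rewrite ffunE; apply/idP/idP => [/asboolP|yi].
  by move/(hx i (mem_enum _ _)).
by apply/asboolP/(hx i (mem_enum _ _)).
Qed.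

Lemma inv_label_mul (L : finType) (l : (nat -> G) -> L) g : inv_label l ->
  inv_label (fun x => l (fun n => mul g (x n))).
Proof.
move=> hl; split=> [y|x x' [k [p [N h]]]].
  have mg : measurable_fun setT (fun x : T => (fun n => mul g (x n)) : T).
    apply: (measurability (@path_cylinders G : set (set T))) => // _ [_ [i [a ->]] <-].
    by rewrite setTI; exact: (measurable_coord_set i (fun h => mul g h = a)).
  by rewrite -[X in measurable X]setTI; exact: (mg measurableT _ (hl.1 y)).
by apply: hl.2; exists k, p, N => n hn; rewrite h.
Qed.

Lemma blabel_mul (L : finType) (l : (nat -> G) -> L) g : blabel l ->
  blabel (fun x => l (fun n => mul g (x n))).
Proof.
move=> [hl [F bF hF]]; split; first exact: inv_label_mul.
exists (fun xi => F (bact act g xi)) => [y|x cx].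
  have := borel_bact g (bF y); congr (borel _); apply/seteqP; split=> xi /=.
    by move=> [? []].
  by move=> [bx e]; split=> //; split=> //; exact: bpoint_bact.
by rewrite hF ?bnd0_mul //; exact: cv_mul.
Qed.

(** Both points are close to the way from [o] to the same limit point, so their distance is governed
    by the difference of their distances to [o]. *)
Lemma shadow_dist c (u u' : G) x :
  eventually_shadow (act u o) (len u - c) x -> eventually_shadow (act u' o) (len u' - c) x ->
  d (act u o) (act u' o) <= `|len u - len u'| + 2 * c + 2 * dl.
Proof.
move=> [N hN] [N' hN']; have D0 := dl0.
have h1 := hN (maxn N N') (leq_maxl _ _); have h2 := hN' (maxn N N') (leq_maxr _ _).
have := gprod_ultra met hyp (w := o) (x := act u o) (y := act u' o) (z := act (x (maxn N N')) o) (m := Num.min (len u - c) (len u' - c)).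
have a1 : Num.min (len u - c) (len u' - c) <= gp (act u o) (act (x (maxn N N')) o) by rewrite ge_min (ltW h1).
have a2 : Num.min (len u - c) (len u' - c) <= gp (act (x (maxn N N')) o) (act u' o).
  by rewrite (gprodC met) ge_min (ltW h2) orbT.
move/(_ a1 a2).
rewrite /gprod -/(len u) -/(len u').
by case: (leP (len u - c) (len u' - c)) => h; case: (ger0P (len u - len u')) => h'; lra.
Qed.

(** The state holds an estimate of the distance to [o] at the last pivot and the product of the
    increments since then. At an unflagged step the length of this product is added, the unknown
    increment is ignored and a new run begins. *)
Definition run_step (st : R * G) (x : option G) : R * G :=
  if x is Some g then (st.1, mul st.2 g) else (st.1 + len st.2, one).

Definition run_state (a : seq (option G)) := foldl run_step (0, one) a.
Definition run_len (a : seq (option G)) := (run_state a).1 + len (run_state a).2.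

Lemma nth_masked n (b : {ffun 'I_n -> bool}) (s : T) i (ni : (i < n)%N) :
  nth None (masked b s) i = if b (Ordinal ni) then Some (s i) else None.
Proof.
rewrite /masked (nth_map (Ordinal ni)) ?size_enum_ord //.
by rewrite (nth_ord_enum (Ordinal ni) (Ordinal ni)).
Qed.

Lemma size_masked n (b : {ffun 'I_n -> bool}) (s : T) : size (masked b s) = n.
Proof. by rewrite size_map size_enum_ord. Qed.

Section Runs.
Variables (n : nat) (fl : nat -> T -> bool) (s : T) (t R0 : R).
Hypothesis t0 : 0 <= t.
Hypothesis R00 : 0 <= R0.
Hypothesis unflagged : forall i, (i < n)%N -> ~~ fl i s -> ~ not_pivot t i.+1 s /\ len (s i) <= R0.
Let a := masked (flags n fl s) s.

(** [p] is 0 or the time just after the last unflagged step. At a pivot lengths add up to an error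
    [2 t], and the ignored increment contributes at most [R0]. *)
Lemma run_state_inv j : (j <= n)%N -> exists p, [/\ (p <= j)%N,
  pos s j = mul (pos s p) (run_state (take j a)).2,
  `|len (pos s p) - (run_state (take j a)).1| <= (2 * t + R0) * p%:R &
  forall k, (p <= k)%N -> gprod d (act (pos s p) o) o (act (pos s k) o) <= t].
Proof.
elim: j => [_|j IH jn].
  exists 0%N; rewrite take0 /=; split=> //; first by rewrite pos0 gmul1.
    by rewrite pos0 len1 subrr normr0 mulr0.
  by move=> k _; rewrite pos0 act1 (gprod_base met).
have [p [pj e1 e2 e3]] := IH (ltnW jn).
rewrite (take_nth None) ?size_masked // /run_state foldl_rcons -/(run_state _).
rewrite (nth_masked _ _ jn) ffunE /=; case: ifP => [_|/negbT nf] /=.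
  by exists p; split=> //; [exact: leqW|rewrite posS e1 gmulA].
have [np sR] := unflagged jn nf.
exists j.+1; split=> //; first by rewrite gmul1r.
  have h1 := e3 j pj; have h0 := gprod_ge0 met (act (pos s p) o) o (act (pos s j) o).
  have h2 : len (run_state (take j a)).2 = d (act (pos s j) o) (act (pos s p) o).
    by rewrite e1 actM act_isom.
  have h3 : `|len (pos s j.+1) - len (pos s j)| <= R0.
    rewrite ler_norml; have := lenM (pos s j) (s j); rewrite -posS.
    have := lenM (pos s j.+1) (inv (s j)); rewrite {1}posS -gmulA gmulVr gmul1r lenV.
    lra.
  move: h0 h1 e2 h3; rewrite /gprod h2 (dist_sym met o) (dist_sym met o) -/(len _) -/(len _).
  have : (p%:R : R) <= j%:R by rewrite ler_nat.
  rewrite -[j.+1%:R]natr1 mulrDr mulr1 => pj' h0 h1.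
  have : (2 * t + R0) * p%:R <= (2 * t + R0) * j%:R by apply: ler_wpM2l => //; apply: addr_ge0 => //; apply: mulr_ge0.
  rewrite !ler_norml; have := t0; have := R00; lra.
by move=> k hk; apply/ltW; exact: (pivot_gprod np hk).
Qed.

Lemma run_lenP j : (j <= n)%N ->
  `|len (pos s j) - run_len (take j a)| <= (2 * t + R0) * j%:R + 2 * t.
Proof.
move=> jn; have [p [pj e1 e2 e3]] := run_state_inv jn.
have h1 := e3 j pj; have h0 := gprod_ge0 met (act (pos s p) o) o (act (pos s j) o).
have h2 : len (run_state (take j a)).2 = d (act (pos s j) o) (act (pos s p) o).
  by rewrite [in RHS]e1 actM act_isom.
move: h0 h1 e2; rewrite /run_len h2 /gprod (dist_sym met o) (dist_sym met o) -/(len _) -/(len _).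
have : (p%:R : R) <= j%:R by rewrite ler_nat.
move=> pj' h0 h1.
have : (2 * t + R0) * p%:R <= (2 * t + R0) * j%:R by apply: ler_wpM2l => //; apply: addr_ge0 => //; apply: mulr_ge0.
rewrite !ler_norml; have := t0; have := R00; lra.
Qed.

Lemma masked_drop j : (j <= n)%N -> (forall i, (j <= i < n)%N -> fl i s) ->
  mul (pos s j) (prodw [seq odflt one x | x <- drop j a]) = pos s n.
Proof.
move=> jn h; have -> : [seq odflt one x | x <- drop j a] = drop j (pre n s).
  apply: (@eq_from_nth _ one) => [|i]; rewrite size_map !size_drop ?size_masked ?size_pre // => hi.
  have hi' : (j + i < n)%N by rewrite -ltn_subRL.
  rewrite (nth_map None) ?size_drop ?size_masked // !nth_drop (nth_masked _ _ hi') ffunE /=.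
  by rewrite h ?leq_addr //= nth_pre.
by rewrite /(pos _ _) -(pre_take s jn) -prodw_cat cat_take_drop.
Qed.

End Runs.

Lemma trunc_itv (x : R) : 0 <= x -> (Num.truncn x)%:R <= x < (Num.truncn x).+1%:R.
Proof. by move=> x0; rewrite truncn_itv. Qed.

(* A code word that decodes to [w_n]: if the good event fails all increments are flagged and listed.
   Otherwise the word locates a long pivotal block [w b] starting at time [t] in the window
   [n - M, n), together with [len w_t] and [len (w_t w_b)] up to bounded error; the label says which
   pairs [(u, b)] have the limit point in the shadows of both [u] and [u w_b]. *)
Section Decode.
Variables (w : bool -> G) (m r n M A A2 N : nat) (c W0 : R) (g0 : seq G).
Local Notation L := {ffun 'I_(size g0) * bool -> bool}.
Definition code_index : finType := option ('I_r * bool * 'I_A * 'I_A2 * 'I_N).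

(** [k] and [k2] record the two lengths to within unit intervals; the shifts by [c] and [W0] make
    the recorded quantities nonnegative for the true position. *)
Definition candidate (D : R) (b : bool) (k k2 : nat) (y : L) (i : 'I_(size g0)) : bool :=
  [&& `[< k%:R <= len (nth one g0 i) - D + c < k.+1%:R >],
      `[< k2%:R <= len (mul (nth one g0 i) (w b)) - len (nth one g0 i) + W0 < k2.+1%:R >] & y (i, b)].

Definition candidates D b k k2 y : seq G := 
  [seq nth one g0 i | i : 'I_(size g0) <- [seq i <- enum 'I_(size g0) | candidate D b k k2 y i]].

Definition pivot_decode (a : seq (option G)) (z : code_index) (y : L) : G :=
  if z is Some (l, b, k, k2, j) then
    let t := (n - M + l * m)%N in
    mul (nth one (candidates (run_len (take t a)) b k k2 y) j) (prodw [seq odflt one x | x <- drop t a])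
  else prodw [seq odflt one x | x <- a].

Lemma card_code_index : #|{: code_index}| = (r * 2 * A * A2 * N).+1.
Proof. by rewrite card_option !card_prod !card_ord card_bool. Qed.
End Decode.

(** Two candidates [u], [v] have distances to [o] that agree up to 1, and up to 2 after
    multiplication by [w b]. By [shadow_dist], [u^-1 v] then moves [o] and [w b o] by at most
    [2 + 2 s2 + 2 dl], so it lies in the finite coarse stabilizer. *)
Lemma candidates_size (w : bool -> G) (c W0 s2 K0 : R) (g0 : seq G) (B : G -> set (set (nat -> X)))
    (x : nat -> G) (D : R) b k k2 (u : G) (q : seq G) :
  uniq g0 -> cv x ->
  (forall g, B g (bnd0 x) -> eventually_shadow (act g o) (len g - s2) x) ->
  2 + 2 * s2 + 2 * dl <= K0 ->
  StabK d act K0 o (act (w b) o) = [set` q] ->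
  let y := set_label (fun p : 'I_(size g0) * bool =>
    B (nth one g0 p.1) `&` B (mul (nth one g0 p.1) (w p.2))) x in
  u \in candidates w c W0 D b k k2 y ->
  (size (candidates w c W0 D b k k2 y) <= size q)%N.
Proof.
move=> ug cx hB hK hq y; have D0 := dl0.
have candP v : v \in candidates w c W0 D b k k2 y -> 
  [/\ k%:R <= len v - D + c < k.+1%:R, k2%:R <= len (mul v (w b)) - len v + W0 < k2.+1%:R,
    B v (bnd0 x) & B (mul v (w b)) (bnd0 x)].
  move=> /mapP[i]; rewrite mem_filter => /andP[/and3P[/asboolP h1 /asboolP h2 h3] _] ->.
  by move: h3; rewrite ffunE => /asboolP[].
move=> /candP[u1 u2 u3 u4].
have inj : injective (mul (inv u)) by move=> v v' e; rewrite -(gmulVK u v) e gmulVK.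
rewrite -(size_map (mul (inv u))); apply: uniq_leq_size.
  rewrite (map_inj_uniq inj) /candidates map_inj_in_uniq; first by rewrite filter_uniq ?enum_uniq.
  move=> i j _ _ e.
  by apply/val_inj/eqP; rewrite -(nth_uniq one (ltn_ord i) (ltn_ord j) ug) e.
move=> _ /mapP[v /candP[v1 v2 v3 v4] ->].
suff : StabK d act K0 o (act (w b) o) (mul (inv u) v) by rewrite hq.
have N1 : `|len u - len v| <= 1.
  move: u1 v1; rewrite -natr1 ler_norml => /andP[? ?] /andP[? ?]; lra.
have N2 : `|len (mul u (w b)) - len (mul v (w b))| <= 2.
  move: u2 v2 u1 v1; rewrite -!natr1 ler_norml => /andP[? ?] /andP[? ?] /andP[? ?] /andP[? ?]; lra.
have d1 := shadow_dist (hB _ u3) (hB _ v3).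
have d2 := shadow_dist (hB _ u4) (hB _ v4).
split; rewrite actM.
  rewrite -(act_isom u o) actKV; lra.
by rewrite -(act_isom u (act (w b) o)) actKV -!actM; lra.
Qed.

Lemma exists_nat_itv (x : R) A : 0 <= x -> x < A%:R -> exists k : 'I_A, k%:R <= x < k.+1%:R.
Proof.
move=> x0 xA; have /andP[h1 h2] := trunc_itv x0.
have hA : (Num.truncn x < A)%N by rewrite -(ltr_nat R); exact: le_lt_trans xA.
by exists (Ordinal hA); rewrite h1 h2.
Qed.

(** The bound on [c] covers the error of [run_lenP] at every time up to [n], so the true position
    before the pivotal block is among the candidates. Its rank there is the last component of the
    code word, and the flagged increments of the window lead from it to [w_n]. *)
Lemma decodeP (w : bool -> G) (m r n M A A2 N : nat) (c W0 s2 K0 t R0 : R) (g0 : seq G)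
    (B : G -> set (set (nat -> X))) (qs : bool -> seq G) (fl : nat -> T -> bool) (s : T) :
  let l := set_label (fun p : 'I_(size g0) * bool =>
    B (nth one g0 p.1) `&` B (mul (nth one g0 p.1) (w p.2))) in
  0 <= t -> 0 <= R0 -> M = (r * m)%N -> (M <= n)%N -> uniq g0 ->
  (4 * t + R0) * n.+1%:R <= c -> 2 * c < A%:R -> (forall b, len (w b) <= W0) -> 2 * W0 < A2%:R ->
  2 + 2 * s2 + 2 * dl <= K0 ->
  (forall b, StabK d act K0 o (act (w b) o) = [set` qs b]) -> (forall b, (size (qs b) <= N)%N) ->
  cv (pos s) ->
  (forall g, B g (bnd0 (pos s)) -> eventually_shadow (act g o) (len g - s2) (pos s)) ->
  (forall j, (j <= n)%N -> pos s j \in g0) ->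
  (forall i, (n - M <= i < n)%N -> fl i s) ->
  (forall i, (i < n)%N -> ~~ fl i s -> ~ not_pivot t i.+1 s /\ len (s i) <= R0) ->
  (exists l b, [/\ (l < r)%N, pos s (n - M + l * m + m) = mul (pos s (n - M + l * m)) (w b),
    B (pos s (n - M + l * m)) (bnd0 (pos s)) & B (pos s (n - M + l * m + m)) (bnd0 (pos s))]) ->
  exists z : code_index r A A2 N, pivot_decode w m n M c W0 (masked (flags n fl s) s) z (l (pos s)) = pos s n.
Proof.
move=> l t0 R00 eM Mn ug hc hA hW hA2 hK hq hN cx hB hg hfl hun [k [b [kr e1 b1 b2]]].
set j := (n - M + k * m)%N in e1 b1 b2.
have jn : (j + m <= n)%N.
  rewrite /j -addnA -mulSnr -[leqRHS](subnK Mn) leq_add2l eM.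
  by rewrite leq_mul2r kr orbT.
have jn' : (j <= n)%N by apply: leq_trans jn; exact: leq_addr.
set u := pos s j in e1 b1 b2.
set D := run_len (take j (masked (flags n fl s) s)).
have hD : `|len u - D| <= c.
  apply: le_trans (run_lenP t0 R00 hun jn') _; apply: le_trans hc.
  have : (j%:R : R) <= n%:R by rewrite ler_nat.
  rewrite -natr1 => h; have : (2 * t + R0) * j%:R <= (2 * t + R0) * n%:R by apply: ler_wpM2l => //; lra.
  have : 0 <= t * n%:R by apply: mulr_ge0.
  lra.
have [k1 hk1] : exists k1 : 'I_A, k1%:R <= len u - D + c < k1.+1%:R.
  by apply: exists_nat_itv; move: hD; rewrite ler_norml; lra.
have [k2 hk2] : exists k2 : 'I_A2, k2%:R <= len (mul u (w b)) - len u + W0 < k2.+1%:R.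
  have := lenM u (w b); have := lenM (mul u (w b)) (inv (w b)); rewrite -gmulA gmulVr gmul1r lenV => h h'.
  by have := hW b => h''; apply: exists_nat_itv; lra.
set y := l (pos s).
have ui : (index u g0 < size g0)%N by rewrite index_mem; exact: hg.
have uc : u \in candidates w c W0 D b k1 k2 y.
  apply/mapP; exists (Ordinal ui); last by rewrite /= nth_index //; exact: hg.
  rewrite mem_filter mem_enum andbT /candidate /= nth_index; last exact: hg.
  apply/and3P; split; [exact/asboolP|exact/asboolP|].
  rewrite /y /l ffunE /= nth_index; last exact: hg.
  by apply/asboolP; split=> //; rewrite -e1.
have sz : (index u (candidates w c W0 D b k1 k2 y) < N)%N.
  rewrite -index_mem in uc *; apply: leq_trans (hN b).
  apply: (leq_trans uc); rewrite index_mem in uc.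
  exact: (candidates_size ug cx hB hK (hq b) uc).
exists (Some (Ordinal kr, b, k1, k2, Ordinal sz)).
rewrite /pivot_decode /= -/j -/D nth_index // masked_drop // => i /andP[h1 h2].
by apply: hfl; rewrite h2 andbT; apply: leq_trans h1; exact: leq_addr.
Qed.

Lemma sum_tail a j : (\sum_(i < j) (a <= i)%N)%N = (j - a)%N.
Proof. by elim: j => [|j IH]; rewrite ?big_ord0 // big_ord_recr /= IH; lia. Qed.

(** For small fixed [x] this bounds the logarithm of the number of code words by a small multiple of
    [n] plus a constant. *)
Lemma ln_linear (x y : R) : 0 < x -> 0 < y -> ln y <= x * y - ln x.
Proof.
move=> x0 y0; have := ln_le_subr1 (mulr_gt0 x0 y0).
by rewrite lnM ?posrE //; lra.
Qed.

Lemma step_tail i (b : G -> Prop) : Pr [set s | b (s i)] = Pr [set s | b (pos s 1)].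
Proof.
have := ind_pre_set i (Phi := fun _ => [set s : T | b (pos s 1)]) (fun _ => measurable_pos 1 b).
rewrite Ex_cst => <-; congr (Pr _); apply/seteqP; split=> s /=;
  by rewrite posS pos0 gmul1 /(drops _ _) addn0.
Qed.

(** Labels must be finite-valued, so only finitely many positions can be tested against the limit
    point. *)
Lemma finite_positions n e : 0 < e -> exists (A : set T) (g0 : seq G),
  [/\ measurable A, Pr (~` A) <= e, uniq g0 & forall s j, A s -> (j <= n)%N -> pos s j \in g0].
Proof.
move=> e0.
have [|||k hk] := @Pr_bigcap_le _ _ _ Q (fun k => [set s | (k <= pickle (pre n s))%N]) e _ _ _ e0.
- by move=> k; exact: (measurable_pre n (fun a => (k <= pickle a)%N)).
- by move=> i j ij; apply/subsetPset => s /=; apply: leq_trans.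
- by apply/seteqP; split=> s // /(_ (pickle (pre n s)).+1 I) /=; rewrite ltnn.
exists [set s | (pickle (pre n s) < k)%N],
  (undup [seq prodw (take j a) | a <- pmap (@unpickle (seq G)) (iota 0 k), j <- iota 0 n.+1]).
split.
- exact: (measurable_pre n (fun a => (pickle a < k)%N)).
- apply: le_trans hk; rewrite le_eqVlt; apply/orP; left; apply/eqP; congr (Pr _).
  by apply/seteqP; split=> s /= => [/negP|]; [rewrite -leqNgt|move=> h; apply/negP; rewrite -leqNgt].
- exact: undup_uniq.
move=> s j hs jn; rewrite mem_undup; apply/allpairsPdep; exists (pre n s), j; split.
- by rewrite /= mem_pmap; apply/mapP; exists (pickle (pre n s)); rewrite ?pickleK // mem_iota.
- by rewrite mem_iota add0n ltnS.
- by rewrite /= pre_take.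
Qed.

Lemma code_index_bound (k : R) r A A2 N n : 0 <= k -> A%:R <= 2 * (k * n.+1%:R) + 1 ->
  #|{: code_index r A A2 N}|%:R <= (1 + r%:R * 2 * A2%:R * N%:R * (2 * k + 1)) * n.+1%:R :> R.
Proof.
move=> k0 hA; rewrite card_code_index.
have -> : ((r * 2 * A * A2 * N).+1%:R : R) = r%:R * 2 * A%:R * A2%:R * N%:R + 1.
  by rewrite -[LHS]natr1 !natrM.
have h1 : 1 <= n.+1%:R :> R by rewrite ler1n.
have hA3 : A%:R <= (2 * k + 1) * n.+1%:R by lra.
rewrite mulrDl mul1r addrC; apply: lerD => //.
have -> : r%:R * 2 * A%:R * A2%:R * N%:R = r%:R * 2 * A2%:R * N%:R * A%:R :> R by ring.
by rewrite -[leRHS]mulrA; apply: ler_wpM2l => //; rewrite !mulr_ge0.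
Qed.

Theorem boundary_info e : 0 < e -> exists n0, forall n, (n0 <= n)%N ->
  exists (L : finType) (l : (nat -> G) -> L), blabel l /\ entr n - n%:R * e <= info l n.
Proof.
move=> e0; have D0 := dl0.
have e4 : 0 < e / 4 by lra.
have [C C0 hC] := coding_rate e4.
(* Outside the window a flag has four causes of probability at most [eta] each, and divergence of
   the path, which has probability 0; with this choice [C * (4 * eta) <= e / 4]. *)
pose eta := e / (16 * (C + 1)).
have C1 : 0 < 16 * (C + 1) by lra.
have eta0 : 0 < eta by rewrite /eta divr_gt0.
have hCeta : C * (4 * eta) <= e / 4.
  have h : eta * (16 * (C + 1)) = e by rewrite /eta divfK // gt_eqF.
  have : 0 <= C * eta by rewrite mulr_ge0 // ltW.
  lra.
have [t t0 ht] := ever_uniform eta0.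
have [R1 hR1] := tight 1 eta0.
pose R0 := `|R1|.
have R00 : 0 <= R0 by rewrite normr_ge0.
have [s2 s20 hW] := pivot_window eta0.
(* [3 dl + 1] is the gap in [shadow_borel]; the remaining 1 makes the inequality strict. *)
pose s3 := s2 + 3 * dl + 2.
have [w [m [r [E [_ fin mE pE hE]]]]] := hW (2 + 2 * s3 + 2 * dl) 0.
have /choice[qs hqs] : forall b, exists q : seq G, StabK d act (2 + 2 * s3 + 2 * dl) o (act (w b) o) = [set` q].
  by move=> b; exact/finite_seqP/fin.
pose N := (size (qs true) + size (qs false))%N.
have hN b : (size (qs b) <= N)%N by rewrite /N; case: b; rewrite ?leq_addr ?leq_addl.
pose W0 := len (w true) + len (w false).
have hW0 b : len (w b) <= W0.
  by rewrite /W0; case: b; rewrite ?lerDl ?lerDr len_ge0.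
pose A2 := (Num.truncn (2 * W0)).+1.
have W00 : 0 <= 2 * W0 by rewrite mulr_ge0 // addr_ge0 // len_ge0.
have hA2 : 2 * W0 < A2%:R by case/andP: (trunc_itv W00).
pose M := (r * m)%N.
have /choice[B hB] : forall g, exists B : set (set (nat -> X)), borel B /\ forall x, cv x ->
  (eventually_shadow (act g o) (len g - s3 + 3 * dl + 1) x -> B (bnd0 x)) /\
  (B (bnd0 x) -> eventually_shadow (act g o) (len g - s3) x).
  move=> g; have [B bB h] := shadow_borel (act g o) (len g - s3); by exists B; split.
pose c2 : R := 1 + r%:R * 2 * A2%:R * N%:R * (2 * (4 * t + R0) + 1).
have K1 : 0 <= 4 * t + R0 by lra.
have c20 : 0 < c2.
  apply: (@lt_le_trans _ _ 1) => //; rewrite /c2 lerDl.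
  by rewrite mulr_ge0 //; lra.
pose x0 := e / (8 * c2).
have x00 : 0 < x0 by rewrite divr_gt0 //; lra.
have hx0 : x0 * c2 = e / 8.
  by rewrite /x0 invfM mulrA divfK ?gt_eqF.
(* The budget [e] per step is split as follows: [e / 4] for [coding_rate], [e / 4] for the flags,
   [e / 8] for the logarithm of the number of code words, and [3 e / 8] for the terms that do not
   grow with [n]. *)
pose n0 := maxn M (Num.truncn ((`|e / 8 - ln x0 + C * M%:R|) / (e * 3 / 8))).+1.
exists n0 => n hn.
have Mn : (M <= n)%N by apply: leq_trans hn; exact: leq_maxl.
have hn0 : e / 8 - ln x0 + C * M%:R <= n%:R * (e * 3 / 8).
  apply: le_trans (ler_norm _) _; rewrite -ler_pdivrMr; last lra.
  apply: (@le_trans _ _ n0%:R); last by rewrite ler_nat.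
  apply: (@le_trans _ _ (Num.truncn ((`|e / 8 - ln x0 + C * M%:R|) / (e * 3 / 8))).+1%:R); last first.
    by rewrite ler_nat leq_maxr.
  by rewrite ltW // truncnS_gt.
have [F [g0 [mF pF ug hg0]]] := finite_positions n eta0.
pose c := (4 * t + R0) * n.+1%:R.
have c0 : 0 <= 2 * c by rewrite !mulr_ge0.
pose A := (Num.truncn (2 * c)).+1.
have /andP[hA1 hA] : (Num.truncn (2 * c))%:R <= 2 * c < A%:R by exact: trunc_itv.
pose good := [set s : T | E (n - M)%N s /\ conv_paths s /\ F s].
have mgood : measurable good.
  by apply: meas_and => //; apply: meas_and => //; exact: measurable_conv_paths.
(* If the global event [good] fails, every increment is flagged and the code word [None]
   suffices. *)
pose fl i (s : T) := `[< ~ good s \/ not_pivot t i.+1 s \/ R0 < len (s i) \/ (n - M <= i)%N >].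
have mlen i : measurable [set s : T | R0 < len (s i)] by exact: (measurable_coord_set i (fun g => R0 < len g)).
have mfl i : measurable [set s | fl i s].
  rewrite (_ : [set s | _] = [set s | ~ good s \/ not_pivot t i.+1 s \/ R0 < len (s i) \/ (n - M <= i)%N]).
    apply: meas_or; first exact: meas_not.
    apply: meas_or; first exact: measurable_not_pivot.
    by apply: meas_or; [exact: mlen|exact: (@meas_cst _ T (n - M <= i)%N)].
  by apply/seteqP; split=> s /=; [move/asboolP|move=> ?; apply/asboolP].
pose l := set_label (fun p : 'I_(size g0) * bool =>
    B (nth one g0 p.1) `&` B (mul (nth one g0 p.1) (w p.2))).
have bl : blabel l.
  by apply: set_labelP => p; apply: borelI; exact: (hB _).1.
have hdec s : exists z : code_index r A A2 N,
    pivot_decode w m n M c W0 (masked (flags n fl s) s) z (l (pos s)) = pos s n.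
  have [[gE [gc gF]]|ng] := pselect (good s); last first.
    exists None; rewrite /pivot_decode -[RHS](masked_drop (n := n) (fl := fl) (s := s) (j := 0)) //.
      by rewrite drop0 pos0 gmul1.
    by move=> i _; apply/asboolP; left.
  apply: (decodeP (s2 := s3) (K0 := 2 + 2 * s3 + 2 * dl) (t := t) (R0 := R0) (qs := qs)) => //.
  - exact: ltW.
  - by move=> g; exact: ((hB g).2 _ gc).2.
  - by move=> j; exact: hg0.
  - by move=> i /andP[hi _]; apply/asboolP; do 3 right.
  - move=> i _ /asboolP nf; split=> [np|]; first by apply: nf; right; left.
    by rewrite leNgt; apply/negP => h; apply: nf; right; right; left.
  have [k [b [kr e1 h1]]] := hE _ _ gE.
  exists k, b; split=> //; apply: ((hB _).2 _ gc).1; exists (n - M + k * m + m)%N => i hi.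
    by have [h _] := h1 i hi; rewrite (gprod_swap met) -/(len _) /s3; lra.
  by have [_ h] := h1 i hi; rewrite (gprod_swap met) -/(len _) /s3; lra.
exists _, l; split=> //.
have := hC _ _ _ _ _ _ bl.1 mfl hdec.
have pfl i : Pr [set s | fl i s] <= 4 * eta + ((n - M <= i)%N)%:R.
  have [h|h] := boolP (n - M <= i)%N.
    by apply: (@le_trans _ _ 1); [exact: Pr_le1|rewrite lerDr mulr_ge0 // ltW].
  rewrite addr0.
  have mD : measurable (~` conv_paths) by apply: measurableC; exact: measurable_conv_paths.
  have s1 := PrU_le Q (measurableC (mE (n - M)%N)) mD.
  have s1' := PrU_le Q (measurableU _ _ (measurableC (mE (n - M)%N)) mD) (measurableC mF).
  have mNP := measurable_not_pivot t i.+1.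
  have s2' := PrU_le Q mNP (mlen i).
  have m1 := measurableU _ _ (measurableU _ _ (measurableC (mE (n - M)%N)) mD) (measurableC mF).
  have m2 := measurableU _ _ mNP (mlen i).
  have s3' := PrU_le Q m1 m2.
  have sub : [set s | fl i s] `<=` ((~` E (n - M)%N `|` ~` conv_paths) `|` ~` F) `|` (not_pivot t i.+1 `|` [set s : T | R0 < len (s i)]).
    move=> s /asboolP[ng|[np|[hR|]]]; [left|right; left|right; right|] => //.
      have [gE|] := pselect (E (n - M)%N s); last by left; left.
      have [gc|] := pselect (conv_paths s); last by left; right.
      by right=> gF; apply: ng; split.
    by rewrite (negbTE h).
  have s4 := Pr_le Q (mfl i) (measurableU _ _ m1 m2) sub.
  have p0 := conv_paths_full.
  have p1 := pE (n - M)%N.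
  have p2 := not_pivot_le i.+1 ht.
  have p3 : Pr [set s : T | R0 < len (s i)] <= eta.
    rewrite (step_tail i (fun g => R0 < len g)); apply: le_trans hR1; apply: Pr_le.
    - exact: (measurable_pos 1 (fun g => R0 < len g)).
    - exact: (measurable_pos 1 (fun g => R1 < len g)).
    - by move=> s /=; apply: le_lt_trans; exact: ler_norm.
  lra.
have sfl : \sum_(i < n) Pr [set s | fl i s] <= n%:R * (4 * eta) + M%:R.
  apply: (@le_trans _ _ (\sum_(i < n) (4 * eta + ((n - M <= i)%N)%:R))).
    by apply: ler_sum => i _.
  have eM : \sum_(i < n) ((n - M <= i)%N)%:R = M%:R :> R by rewrite -natr_sum sum_tail subKn.
  have eC : \sum_(i < n) (4 * eta) = n%:R * (4 * eta) by rewrite sumr_const card_ord; exact/esym/mulr_natl.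
  by rewrite big_split /= eC eM.
have hcard : #|{: code_index r A A2 N}|%:R <= c2 * n.+1%:R.
  apply: code_index_bound => //; rewrite /A; move: hA1; rewrite /c.
  by move: (Num.truncn _) => a ha; rewrite -[leLHS]natr1 lerD2r.
have hZ : ln #|{: code_index r A A2 N}|%:R <= e / 8 * n.+1%:R - ln x0.
  have cp : 0 < #|{: code_index r A A2 N}|%:R :> R by rewrite ltr0n card_code_index.
  apply: (@le_trans _ _ (ln (c2 * n.+1%:R))).
    by rewrite ler_ln ?posrE //; exact: lt_le_trans hcard.
  apply: le_trans (ln_linear x00 _) _; first exact: lt_le_trans hcard.
  by rewrite mulrA hx0.
have h2 := ler_wpM2l C0 sfl; rewrite mulrDr in h2.
have h3 : C * (n%:R * (4 * eta)) <= n%:R * (e / 4).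
  by rewrite mulrCA; apply: ler_wpM2l.
have hn1 : e / 8 * n.+1%:R = e / 8 * n%:R + e / 8 by rewrite -[n.+1%:R]natr1 mulrDr mulr1.
rewrite hn1 in hZ; move: (ln _%:R) hZ (C * \sum_(i < n) _) h2 => z hZ y h2 h.
clear - h h2 h3 hZ hn0 e0.
lra.
Qed.

(** * Invariant events are boundary events *)

Definition translate (L : Type) (l : (nat -> G) -> L) g (x : nat -> G) := l (fun n => mul g (x n)).

Lemma info_translate (L : finType) (l : (nat -> G) -> L) n g :
  Tn n (neg_entropy l) g - neg_entropy l g = info (translate l g) n.
Proof.
have e h : neg_entropy (translate l g) h = neg_entropy l (mul g h).
  have e (s : T) : (fun n => mul g (mul h (pos s n))) = (fun n => mul (mul g h) (pos s n)).
    by apply/funext => i; rewrite gmulA.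
  by apply: eq_bigr => y _; congr (xlnx (Pr _)); apply/seteqP; split=> s /=; rewrite /translate e.
rewrite /info e gmul1r; congr (_ - _); apply: eq_Ex => s; by rewrite e gmul1.
Qed.

(** After [k] steps the walk starts afresh at some [g]; what the next [n] steps reveal about the
    label is the information carried by its translate by [g]. Boundary labels are stable under
    translation, so a common bound [S] can be iterated. *)
Lemma info_add (L : finType) (l : (nat -> G) -> L) k n (S : R) : inv_label l ->
  (forall g, info (translate l g) n <= S) -> info l (k + n) <= info l k + S.
Proof.
move=> hl hS; have b := neg_entropy_bdd hl; have b' := Tn_bdd n b.
suff : Tn k (Tn n (neg_entropy l)) one <= Tn k (neg_entropy l) one + S by rewrite /info TnDn //; lra.
have -> : Tn k (neg_entropy l) one + S = Tn k (fun g => neg_entropy l g + S) one.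
  by rewrite TnD ?Tn_cst //; exact: bdd_cst.
apply: Tn_le => //; first by apply: bddD => //; exact: bdd_cst.
by move=> g; have := hS g; rewrite -info_translate; lra.
Qed.

Lemma info_mul_le k (S : R) : (forall (L : finType) (l : (nat -> G) -> L), blabel l -> info l k <= S) ->
  forall q (L : finType) (l : (nat -> G) -> L), blabel l -> info l (q * k) <= q%:R * S.
Proof.
move=> hS; elim=> [|q IH] L l bl; first by rewrite mul0n mul0r /info Tn0 subrr.
rewrite mulSn -natr1 mulrDl mul1r addrC; apply: le_trans (info_add k _ _) _; first exact: bl.1.
  by move=> g; apply: IH; exact: blabel_mul.
by rewrite lerD2r; exact: hS.
Qed.

Lemma info_mul_ge (L : finType) (l : (nat -> G) -> L) k q : inv_label l ->
  q%:R * info l k <= entr (q * k).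
Proof.
move=> hl; elim: q => [|q IH].
  by rewrite mul0r mul0n /entr fine_ge0 // ent_ge0.
rewrite mulSn -natr1 mulrDl mul1r addrC; apply: le_trans (info_le_ent hl k (q * k)).
by rewrite lerD2l.
Qed.

Theorem info_le_blabels (L : finType) (l : (nat -> G) -> L) k (S : R) : (0 < k)%N -> inv_label l ->
  (forall (L : finType) (l : (nat -> G) -> L), blabel l -> info l k <= S) -> info l k <= S.
Proof.
move=> k0 hl hS; apply/ler_addgt0Pr => e e0.
have kp : 0 < k%:R :> R by rewrite ltr0n.
(* An error of [e / k] per step is [q * e] over [q * k] steps, which disappears to [e] after
   division by [q]. *)
have [n0 hn0] := boundary_info (divr_gt0 e0 kp).
have qn : (n0 <= n0.+1 * k)%N by apply: leq_trans (leqnSn n0) _; rewrite leq_pmulr.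
have [L' [l' [bl h]]] := hn0 _ qn.
have h1 := info_mul_ge k n0.+1 hl; have h2 := info_mul_le hS n0.+1 bl.
have q0 : 0 < n0.+1%:R :> R by rewrite ltr0n.
rewrite -(ler_pM2l q0) [leRHS]mulrDr.
have e1 : (n0.+1 * k)%:R * (e / k%:R) = n0.+1%:R * e.
  by rewrite natrM -mulrA [k%:R * _]mulrC divfK // gt_eqF.
by rewrite e1 in h; apply: le_trans h1 _; rewrite -lerBlDr; exact: le_trans h h2.
Qed.

(** * Approximation of events by cylinders *)

Definition symdiff (A B : set T) : set T := (A `\` B) `|` (B `\` A).

Lemma measurable_symdiff A B : measurable A -> measurable B -> measurable (symdiff A B).
Proof. by move=> mA mB; apply: measurableU; exact: measurableD. Qed.

Lemma symdiff_tri A B C : symdiff A C `<=` symdiff A B `|` symdiff B C.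
Proof.
move=> s [[a c]|[c a]]; have [b|b] := pselect (B s).
- by right; left. - by left; left. - by left; right. - by right; right.
Qed.

Lemma Pr_symdiff_tri A B C a b : measurable A -> measurable B -> measurable C ->
  Pr (symdiff A B) <= a -> Pr (symdiff B C) <= b -> Pr (symdiff A C) <= a + b.
Proof.
move=> mA mB mC h1 h2; apply: le_trans (lerD h1 h2).
have m1 := measurable_symdiff mA mB; have m2 := measurable_symdiff mB mC.
apply: le_trans (PrU_le Q m1 m2); apply: Pr_le; [exact: measurable_symdiff|exact: measurableU|].
exact: symdiff_tri.
Qed.

Definition cyl_approx (B : set T) : Prop := forall e, 0 < e ->
  exists n (P : set (seq G)), Pr (symdiff B [set s | P (pre n s)]) <= e.

Lemma cyl_approxU A B : measurable A -> measurable B -> cyl_approx A -> cyl_approx B ->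
  cyl_approx (A `|` B).
Proof.
move=> mA mB hA hB e e0; have e2 : 0 < e / 2 by lra.
have [n [P hP]] := hA _ e2; have [n' [P' hP']] := hB _ e2.
exists (n + n')%N, [set a | P (take n a) \/ P' (take n' a)].
have mc : measurable [set s : T | P (pre n s)] by exact: (measurable_pre n P).
have mc' : measurable [set s : T | P' (pre n' s)] by exact: (measurable_pre n' P').
have m1 := measurable_symdiff mA mc; have m2 := measurable_symdiff mB mc'.
apply: (@le_trans _ _ (e / 2 + e / 2)); last lra.
apply: le_trans (lerD hP hP'); apply: le_trans (PrU_le Q m1 m2); apply: Pr_le.
- apply: measurable_symdiff; first exact: measurableU.
  exact: (measurable_pre (n + n') (fun a => P (take n a) \/ P' (take n' a))).
- exact: measurableU.
move=> s [] /=; rewrite (pre_take s (leq_addr n' n)) (pre_take s (leq_addl n n')).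
  move=> [[a|b] /not_orP[p p']]; [left; left|right; left]; by split.
by move=> [[p|p'] /not_orP[a b]]; [left; right|right; right]; split.
Qed.

(** The approximable measurable events form a sigma-algebra: complements keep the error, and a
    countable union is first cut to a finite one. *)
Lemma cyl_approxP (B : set T) : measurable B -> cyl_approx B.
Proof.
suff : @measurable _ T `<=` [set B | measurable B /\ cyl_approx B] by move=> h /h[].
apply: smallest_sub => [|_ [i [a ->]]]; last first.
  split; first exact: (measurable_coord (one := one) i a).
  move=> e e0; exists i.+1, [set w | nth one w i = a].
  rewrite (_ : symdiff _ _ = set0) ?Pr_set0; first exact: ltW.
  by apply/seteqP; split=> s // [[h1 h2]|[h1 h2]]; [apply: h2|apply: h2]; move: h1; rewrite /= nth_pre.
split.
- split; first exact: measurable0.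
  move=> e e0; exists 0%N, set0; rewrite (_ : symdiff _ _ = set0) ?Pr_set0; first exact: ltW.
  by apply/seteqP; split=> s // [[]|[]].
- move=> A [mA hA]; split; first by rewrite setTD; exact: measurableC.
  move=> e e0; have [n [P hP]] := hA e e0; exists n, (~` P).
  rewrite (_ : symdiff _ _ = symdiff A [set s | P (pre n s)]) //.
  rewrite setTD; apply/seteqP; split=> s /= [[h1 h2]|[h1 h2]].
  - by right; split=> //; exact: contrapT.
  - by left; split=> //; exact: contrapT.
  - by right; split=> // h; exact: h.
  - by left; split=> // h; exact: h.
move=> F hF.
have mF i : measurable (F i : set T) := (hF i).1.
split; first exact: bigcupT_measurable.
pose S N : set T := \bigcup_(i in [set i | (i < N)%N]) F i.
have SS N : S N.+1 = S N `|` F N.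
  apply/seteqP; split=> s; last by move=> [[i /= h]|h]; [exists i => //=; exact: ltnW|exists N => /=].
  move=> [i /=]; rewrite ltnS leq_eqVlt => /orP[/eqP->|h]; first by right.
  by left; exists i.
have hS N : measurable (S N) /\ cyl_approx (S N).
  elim: N => [|N [m h]].
    rewrite (_ : S 0%N = set0); last by apply/seteqP; split=> s // [].
    split; first exact: measurable0.
    move=> e e0; exists 0%N, set0; rewrite (_ : symdiff _ _ = set0) ?Pr_set0; first exact: ltW.
    by apply/seteqP; split=> s // [[]|[]].
  rewrite SS; split; first exact: measurableU.
  by apply: cyl_approxU => //; exact: (hF N).2.
move=> e e0; have e2 : 0 < e / 2 by lra.
pose U : set T := \bigcup_i F i.
have mU : measurable U by exact: bigcupT_measurable.
have [|||N hN] := @Pr_bigcap_le _ _ _ Q (fun N => U `\` S N) (e / 2) _ _ _ e2.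
- by move=> N; apply: measurableD => //; exact: (hS N).1.
- move=> i j ij; apply/subsetPset => s [h1 h2]; split=> // -[k /= ki fk]; apply: h2.
  by exists k => //=; exact: leq_trans ij.
- apply/seteqP; split=> s // h; have [[k _ fk] _] := h 0%N I.
  by have [_] := h k.+1 I; apply; exists k => /=.
have [n [P hP]] := (hS N).2 _ e2; exists n, P.
rewrite [e]splitr; apply: (Pr_symdiff_tri (B := S N)) => //.
- exact: (hS N).1.
- exact: (measurable_pre n P).
rewrite (_ : symdiff _ _ = U `\` S N) //.
apply/seteqP; split=> s; last by left.
by move=> [//|[[k _ fk] h]]; case: h; exists k.
Qed.

(** * Entropy inequalities for finite distributions *)

Lemma xlnx_ge (c v : R) : 0 < c -> 0 <= v -> - xlnx v <= c + v * - ln c.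
Proof.
move=> c0; rewrite le_eqVlt => /orP[/eqP<-|v0]; first by rewrite /xlnx !mul0r oppr0 addr0 ltW.
have := ln_linear c0 (y := v^-1); rewrite invr_gt0 => /(_ v0); rewrite lnV ?posrE // => h.
have := ler_wpM2l (ltW v0) h; rewrite mulrBr mulrCA divff ?gt_eqF // /xlnx; lra.
Qed.

Lemma xlnxC_ge v : 0 <= v <= 1 -> - xlnx (1 - v) <= v.
Proof.
move=> /andP[v0]; rewrite le_eqVlt => /orP[/eqP->|v1]; first by rewrite subrr /xlnx mul0r oppr0.
have h0 : 0 < 1 - v by lra.
have := ln_linear ltr01 (y := (1 - v)^-1); rewrite invr_gt0 => /(_ h0); rewrite lnV ?posrE // ln1 mul1r subr0.
have := @ln_le_subr1 ((1 - v)^-1); rewrite invr_gt0 => /(_ h0); rewrite lnV ?posrE // => h _.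
have := ler_wpM2l (ltW h0) h; rewrite mulrBr divff ?gt_eqF // /xlnx; lra.
Qed.

(** A bound of the binary entropy that is affine in the minimum, with arbitrarily small constant
    term, so that it survives taking expectations. *)
Lemma bin_entropy_le (c v : R) : 0 < c < 1 -> 0 <= v <= 1 ->
  - xlnx v - xlnx (1 - v) <= c + Num.min v (1 - v) * (1 - ln c).
Proof.
move=> /andP[c0 c1] v01; have /andP[v0 v1] := v01.
have w0 : 0 <= 1 - v by lra.
have w01 : 0 <= 1 - v <= 1 by lra.
have h1 := xlnx_ge c0 v0; have h2 := xlnx_ge c0 w0.
have h3 := xlnxC_ge v01; have h4 := xlnxC_ge w01.
rewrite subKr in h4.
case: (leP v (1 - v)) => _; rewrite mulrBr mulr1; lra.
Qed.

(** Each of the two logarithmic terms is at least [a b / (a + b)], and twice this is at least the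
    minimum. *)
Lemma xlnx_split_ge a b : 0 <= a -> 0 <= b -> Num.min a b <= xlnx (a + b) - xlnx a - xlnx b.
Proof.
have main (x y : R) : 0 <= x -> 0 <= y -> x <= y -> x <= xlnx (x + y) - xlnx x - xlnx y.
  rewrite le_eqVlt => /orP[/eqP<-|x0] y0 xy; first by rewrite add0r /xlnx mul0r; lra.
  have yp : 0 < y by exact: lt_le_trans xy.
  have xyp : 0 < x + y by exact: addr_gt0.
  have h (z z' : R) : 0 < z -> 0 < z' -> z * z' / (z + z') <= z * (ln (z + z') - ln z).
    move=> z0 z'0; have zz : 0 < z + z' by exact: addr_gt0.
    rewrite -mulrA; apply: ler_wpM2l; first exact: ltW.
    have := ln_le_subr1 (divr_gt0 z0 zz); rewrite ln_div ?posrE // => h.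
    have : z' / (z + z') = 1 - z / (z + z').
      by apply: (mulIf (lt0r_neq0 zz)); rewrite mulrBl !divfK ?gt_eqF // mul1r addrC addKr.
    move=> ->; lra.
  have h1 := h x y x0 yp; have h2 := h y x yp x0.
  have h3 : x <= 2 * (x * y / (x + y)).
    rewrite mulrA ler_pdivlMr // mulrDr.
    by have := ler_wpM2l (ltW x0) xy; rewrite !mulrA; lra.
  rewrite [y + x]addrC [y * x]mulrC in h2.
  rewrite /xlnx mulrDl; lra.
move=> a0 b0; case: (leP a b) => h; first exact: main.
have := main b a b0 a0 (ltW h); rewrite [b + a]addrC; lra.
Qed.

Lemma gibbs_term a p u : 0 <= a -> a <= p -> 0 <= u -> (0 < a -> 0 < u) ->
  a * ln p - xlnx a <= p * u - a - a * ln u.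
Proof.
rewrite le_eqVlt => /orP[/eqP<-|a0] ap u0 hu; first by rewrite /xlnx !mul0r; have := mulr_ge0 ap u0; lra.
have up := hu a0; have pp : 0 < p := lt_le_trans a0 ap.
have := ln_le_subr1 (divr_gt0 (mulr_gt0 pp up) a0).
rewrite ln_div ?posrE ?mulr_gt0 // lnM ?posrE // => h.
have e : a * (p * u / a) = p * u by rewrite mulrC divfK // gt_eqF.
have := ler_wpM2l (ltW a0) h; rewrite [leRHS]mulrBr e /xlnx; lra.
Qed.

(** Conditioning reduces entropy: [a] and [b] are the joint probabilities of a label with an event
    and with its complement. *)
Lemma cond_entropy_le (L : finType) (a b : L -> R) : (forall y, 0 <= a y) -> (forall y, 0 <= b y) ->
  \sum_y a y + \sum_y b y = 1 ->
  \sum_y (xlnx (a y + b y) - xlnx (a y) - xlnx (b y)) <= - xlnx (\sum_y a y) - xlnx (1 - \sum_y a y).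
Proof.
move=> a0 b0; set u := \sum_y a y => h1; have ub : \sum_y b y = 1 - u by rewrite -h1 addrC addKr.
have pos_sum (f : L -> R) : (forall y, 0 <= f y) -> forall y, 0 < f y -> 0 < \sum_y f y.
  by move=> f0 y fy; rewrite (bigD1 y) //= ltr_wpDr // sumr_ge0.
apply: (@le_trans _ _ (\sum_y ((a y + b y) * u - a y - a y * ln u + ((a y + b y) * (1 - u) - b y - b y * ln (1 - u))))).
  apply: ler_sum => y _.
  have e : xlnx (a y + b y) - xlnx (a y) - xlnx (b y) =
      (a y * ln (a y + b y) - xlnx (a y)) + (b y * ln (a y + b y) - xlnx (b y)).
    by rewrite {1}/xlnx mulrDl; lra.
  rewrite e; apply: lerD; apply: gibbs_term => //.
  - by rewrite lerDl.
  - by apply: sumr_ge0.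
  - exact: pos_sum.
  - by rewrite lerDr.
  - by rewrite -ub; apply: sumr_ge0.
  - by rewrite -ub; exact: pos_sum.
rewrite big_split /= !sumrB -!mulr_suml big_split /= -/u ub /xlnx.
by rewrite (_ : u + (1 - u) = 1) ?mul1r; lra.
Qed.

Lemma Pr_fin (L : finType) (f : T -> L) (P : pred L) : (forall y, measurable [set s | f s = y]) ->
  Pr [set s | P (f s)] = \sum_(y | P y) Pr [set s | f s = y].
Proof.
move=> mf; have mP : measurable [set s | P (f s)].
  rewrite (_ : [set s | _] = [set s | exists y, P y /\ f s = y]).
    apply: (@meas_ex _ T L (fun y => [set s | P y /\ f s = y])) => y.
    exact: (meas_and (meas_cst (is_true (P y))) (mf y)).
  by apply/seteqP; split=> s /= => [h|[y [h ->]]] //; exists (f s).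
rewrite -(Ex_indic Q mP) big_mkcond /=.
rewrite (eq_bigr (fun y => Ex (fun s => (P y)%:R * \1_[set s | f s = y] s))); last first.
  move=> y _; rewrite ExZ ?Ex_indic //; last exact: bm_indic.
  by case: (P y); rewrite ?mul1r ?mul0r.
rewrite -Ex_sum; last by move=> y; apply: bmZ; exact: bm_indic.
apply: eq_Ex => s; rewrite (bigD1 (f s)) //= [\1__ _ in RHS]indicE mem_set //= mulr1.
rewrite big1 ?addr0 => [|y ne].
  by rewrite indicE; congr (_ %:R); congr nat_of_bool; apply/idP/idP; rewrite inE.
by rewrite indicE memNset ?mulr0 //= => e; rewrite e eqxx in ne.
Qed.

Lemma measurable_on_paths (A : set T) : measurable A -> measurable [set s : T | A (pos s)].
Proof.
move=> mA; rewrite (_ : [set s | _] = [set s : T | A (fun n => mul one (pos s n))]).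
  by rewrite -[X in measurable X]setTI; exact: (measurable_path one measurableT mA).
by apply/seteqP; split=> s /=; rewrite (one_mul_pos s).
Qed.

(** * An invariant event joined to a boundary label *)

Section Pair.
Variables (A : set (nat -> G)).
Hypotheses (mA : measurable (A : set T)) (hA : shift_tail_invariant A).

Definition set_lab (x : nat -> G) : bool := `[< A x >].

Lemma set_lab_inv : inv_label set_lab.
Proof.
split=> [y|x x' h]; last by apply/asboolP/asboolP => ?; [exact/(hA h)|exact/(hA h)].
case: y.
  rewrite (_ : [set x | _] = A) //; apply/seteqP; split=> x /=; first by move/asboolP.
  by move=> ?; apply/asboolP.
rewrite (_ : [set x | _] = ~` A); first exact: measurableC.
by apply/seteqP; split=> x /=; [move/negbT/asboolPn|move=> ?; apply/negbTE/asboolPn].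
Qed.

(** A zero-one law in mean. The approximating cylinder is decided at time [k], so given the first
    [k] increments the symmetric difference has conditional probability [u] or [1 - u], which is at
    least the minimum. *)
Lemma set_lab_approx e : 0 < e -> exists n, forall k, (n <= k)%N ->
  Tn k (fun g => Num.min (cond_prob set_lab true g) (1 - cond_prob set_lab true g)) one <= e.
Proof.
move=> e0; have mA' := measurable_on_paths mA.
have [n [P hP]] := cyl_approxP mA' e0; exists n => k nk; apply: le_trans hP.
pose Phi (a : seq G) : set T := [set s | if `[< P (take n a) >] then ~ A (fun i => mul (prodw a) (pos s i))
  else A (fun i => mul (prodw a) (pos s i))].
have u01 g := cond_prob01 set_lab_inv true g.
have mg g : measurable [set s : T | A (fun i => mul g (pos s i))].
  by rewrite -[X in measurable X]setTI; exact: (measurable_path g measurableT mA).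
have ug g : cond_prob set_lab true g = Pr [set s : T | A (fun i => mul g (pos s i))].
  by congr (Pr _); apply/seteqP; split=> s /=; [move/asboolP|move=> ?; apply/asboolP].
have mPhi a : measurable (Phi a).
  rewrite /Phi; case: asboolP => _ //; exact: (measurableC (mg _)).
have -> : symdiff [set s | A (pos s)] [set s | P (pre n s)] = [set s | Phi (pre k s) (drops k s)].
  apply/seteqP; split=> s; rewrite /Phi /= pre_take //;
    have -> : (A (fun i => mul (prodw (pre k s)) (pos (drops k s) i))) = A (pos s)
      by (apply/propext; apply: hA; exists 0%N, k, 0%N => i _; rewrite addn0 addnC posD).
    by move=> [[a p]|[p a]]; case: asboolP.
  by case: asboolP => p a; [right|left].
rewrite (ind_pre_set k mPhi); apply: Ex_le.
- apply: (bm_pos one k (f := fun g => Num.min (cond_prob set_lab true g) (1 - cond_prob set_lab true g))).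
  apply: bdd01 => g; have /andP[u0 u1] := u01 g; case: (leP (cond_prob set_lab true g) _) => _; apply/andP; split; lra.
- apply: (@bm_pre k (fun a => Pr (Phi a)) 1) => a.
  by rewrite ger0_norm ?Pr_ge0 ?Pr_le1.
move=> s; rewrite gmul1 -/(pos s k); have := u01 (pos s k).
have uC g : Pr [set s : T | ~ A (fun i => mul g (pos s i))] = 1 - cond_prob set_lab true g.
  by rewrite ug -PrC.
by rewrite /Phi -/(pos s k) ge_min; case: asboolP => _ _; rewrite ?uC ?ug lexx ?orbT.
Qed.

Section WithLabel.
Variables (L : finType) (l : (nat -> G) -> L).
Hypothesis hl : inv_label l.

Definition pair_lab (x : nat -> G) : L * bool := (l x, set_lab x).

Lemma pair_lab_inv : inv_label pair_lab.
Proof.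
split=> [[y c]|x x' h]; last by rewrite /pair_lab (hl.2 _ _ h) (set_lab_inv.2 _ _ h).
rewrite (_ : [set x | _] = [set x | l x = y /\ set_lab x = c]).
  by apply: meas_and; [exact: hl.1|exact: set_lab_inv.1].
by apply/seteqP; split=> x; rewrite /pair_lab /=; move=> [-> ->].
Qed.

Local Notation a := (fun g y => cond_prob pair_lab (y, true) g).
Local Notation b := (fun g y => cond_prob pair_lab (y, false) g).

Lemma sum_pair (F : L * bool -> R) : \sum_p F p = \sum_y (F (y, true) + F (y, false)).
Proof.
rewrite (eq_bigr (fun p => F (p.1, p.2))); last by move=> [].
rewrite -(pair_bigA _ (fun y c => F (y, c))) /=.
by apply: eq_bigr => y _; rewrite big_bool.
Qed.

Lemma cond_prob_pair y g : cond_prob l y g = a g y + b g y.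
Proof.
rewrite (_ : cond_prob l y g = Pr [set s | (pred1 y \o fst) (pair_lab (fun n => mul g (pos s n)))]).
  rewrite (Pr_fin (f := fun s : T => pair_lab (fun n => mul g (pos s n))) (pred1 y \o fst)); last first.
    by move=> p; exact: (measurable_label pair_lab_inv).
  rewrite big_mkcond sum_pair (bigD1 y) //= eqxx big1 ?addr0 // => y' /negbTE ->; by rewrite addr0.
by congr (Pr _); apply/seteqP; split=> s /= => [->|/eqP].
Qed.

Lemma cond_prob_set c g : cond_prob set_lab c g = \sum_y cond_prob pair_lab (y, c) g.
Proof.
rewrite (_ : cond_prob set_lab c g = Pr [set s | (pred1 c \o snd) (pair_lab (fun n => mul g (pos s n)))]).
  rewrite (Pr_fin (f := fun s : T => pair_lab (fun n => mul g (pos s n))) (pred1 c \o snd)); last first.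
    by move=> p; exact: (measurable_label pair_lab_inv).
  rewrite big_mkcond sum_pair; apply: eq_bigr => y _ /=.
  by case: c; rewrite ?addr0 ?add0r.
by congr (Pr _); apply/seteqP; split=> s /= => [->|/eqP].
Qed.

Lemma neg_entropy_pair g : neg_entropy l g - neg_entropy pair_lab g =
  \sum_y (xlnx (a g y + b g y) - xlnx (a g y) - xlnx (b g y)).
Proof.
rewrite /neg_entropy sum_pair -sumrB; apply: eq_bigr => y _.
by rewrite cond_prob_pair opprD addrA.
Qed.

(** Let [h g] be the conditional entropy of the event given the label for the walk started at [g].
    The gain of information is [h one] minus the mean of [h] at [w_k]. The former dominates the sum
    of minima by [xlnx_split_ge]; the latter is at most the mean entropy of the event given [w_k],
    which [bin_entropy_le] controls. *)
Lemma info_pair_gain k c : 0 < c < 1 ->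
  \sum_y Num.min (a one y) (b one y) <= info pair_lab k - info l k + c +
    (1 - ln c) * Tn k (fun g => Num.min (cond_prob set_lab true g) (1 - cond_prob set_lab true g)) one.
Proof.
move=> c01; have /andP[c0 c1] := c01.
pose h g := neg_entropy l g - neg_entropy pair_lab g.
have bl := neg_entropy_bdd hl; have b0 := neg_entropy_bdd pair_lab_inv.
have e : info pair_lab k - info l k = h one - Tn k h one.
  by rewrite /info /h TnB //; lra.
have lo : \sum_y Num.min (a one y) (b one y) <= h one.
  rewrite /h neg_entropy_pair; apply: ler_sum => y _.
  by apply: xlnx_split_ge; exact: (cond_prob_ge0 pair_lab_inv).
have u01 g := cond_prob01 set_lab_inv true g.
have bm : bdd (fun g => Num.min (cond_prob set_lab true g) (1 - cond_prob set_lab true g)).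
  by apply: bdd01 => g; have /andP[u0 u1] := u01 g; case: (leP (cond_prob set_lab true g) _) => _; apply/andP; split; lra.
have up : Tn k h one <= c + (1 - ln c) * Tn k (fun g => Num.min (cond_prob set_lab true g) (1 - cond_prob set_lab true g)) one.
  rewrite -TnZ // -[X in X + _](Tn_cst k c one) -TnD //; [|exact: bdd_cst|exact: bddZ].
  apply: Tn_le; [exact: bddB|by apply: bddD; [exact: bdd_cst|exact: bddZ]|].
  move=> g; rewrite /h neg_entropy_pair.
  have h1 : \sum_y a g y + \sum_y b g y = 1.
    by rewrite -!cond_prob_set -(cond_prob_sum set_lab_inv g) big_bool.
  apply: le_trans (cond_entropy_le _ _ h1) _; try by move=> y; exact: (cond_prob_ge0 pair_lab_inv).
  by rewrite -cond_prob_set [leRHS]addrC [_ * Num.min _ _]mulrC addrC bin_entropy_le.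
lra.
Qed.

End WithLabel.

Lemma blabel_approx e : 0 < e -> exists (L : finType) (l : (nat -> G) -> L), blabel l /\
  \sum_y Num.min (cond_prob (pair_lab l) (y, true) one) (cond_prob (pair_lab l) (y, false) one) <= e.
Proof.
move=> e0; have e4 : 0 < e / 4 by lra.
pose c := Num.min (e / 4) (1 / 2).
have c01 : 0 < c < 1 by rewrite /c; case: (leP (e / 4) (1 / 2)) => h; lra.
have ce : c <= e / 4 by rewrite /c ge_min lexx.
have /andP[c0 c1] := c01.
have K0 : 0 < 1 - ln c by have := nln_ge0 (ltW c1); lra.
have [n hn] := set_lab_approx (divr_gt0 e4 K0).
(* The successor, because [info_le_blabels] asks for a positive time. *)
have := hn n.+1 (leqnSn n); set Dn := Tn _ _ _ => hD.
pose E := [set r : R | exists (L : finType) (l : (nat -> G) -> L), blabel l /\ r = info l n.+1].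
have hE : has_sup E.
  split.
    have b0 : blabel (set_label (fun _ : 'I_0 => bp)) by apply: set_labelP => i; exact: borelT.
    by exists (info (set_label (fun _ : 'I_0 => bp)) n.+1), _, (set_label (fun _ : 'I_0 => bp)).
  by exists (entr n.+1) => _ [L [l [bl ->]]]; apply: info_le_H; exact: bl.1.
have [_ [L [l [bl ->]]] hsup] := sup_adherent e4 hE.
exists L, l; split=> //.
have hle : info (pair_lab l) n.+1 <= sup E.
  apply: info_le_blabels => //; first exact: (pair_lab_inv bl.1).
  by move=> L' l' bl'; apply: (ub_le_sup hE.2); exists L', l'.
apply: le_trans (info_pair_gain bl.1 n.+1 c01) _; rewrite -/Dn.
have : (1 - ln c) * Dn <= e / 4 by rewrite mulrC -ler_pdivlMr.
lra.
Qed.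

(** The event is guessed from the label by choosing the more likely alternative; the probability of
    a wrong guess is the sum of minima. *)
Lemma borel_approx e : 0 < e -> exists2 B, borel B &
  Pr (symdiff [set s | A (pos s)] [set s | B (bnd0 (pos s))]) <= e.
Proof.
move=> e0; have [L [l [[hl [F bF hF]] hsum]]] := blabel_approx e0.
pose a y := cond_prob (pair_lab l) (y, true) one; pose b y := cond_prob (pair_lab l) (y, false) one.
pose Y y := b y <= a y.
have bB (r : seq L) : borel [set xi | bp xi /\ F xi \in r].
  elim: r => [|y r IH].
    by rewrite (_ : [set _ | _] = set0); [exact: borel0|apply/seteqP; split=> xi // []].
  rewrite (_ : [set _ | _] = [set xi | bp xi /\ F xi = y] `|` [set xi | bp xi /\ F xi \in r]).
    exact: borelU.
  apply/seteqP; split=> xi /=; first by move=> [bx]; rewrite inE => /orP[/eqP|]; [left|right].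
  by move=> [[bx ->]|[bx h]]; split; rewrite ?mem_head // inE h orbT.
pose B := [set xi | bp xi /\ F xi \in [seq y <- enum L | Y y]].
exists B; first exact: bB.
have mAp := measurable_on_paths mA.
have mBp : measurable [set s : T | B (bnd0 (pos s))].
  exact: (measurable_on_paths (measurable_bnd0 (bB _))).
have mC := @measurable_conv_paths.
pose P (p : L * bool) := p.2 != Y p.1.
have hp := pair_lab_inv hl.
have ml p : measurable [set s : T | pair_lab l (pos s) = p].
  exact: (measurable_on_paths (hp.1 p)).
have mP : measurable [set s : T | P (pair_lab l (pos s))].
  rewrite (_ : [set s | _] = [set s | exists p, P p /\ pair_lab l (pos s) = p]).
    apply: (@meas_ex _ T (L * bool)%type (fun p => [set s | P p /\ pair_lab l (pos s) = p])) => p.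
    exact: (meas_and (meas_cst (is_true (P p))) (ml p)).
  by apply/seteqP; split=> s /= => [h|[p [h ->]]] //; exists (pair_lab l (pos s)).
have PP : Pr [set s : T | P (pair_lab l (pos s))] <= e.
  apply: le_trans hsum; rewrite (Pr_fin (f := fun s : T => pair_lab l (pos s)) P) // big_mkcond sum_pair.
  apply: ler_sum => y _; rewrite -/(a y) -/(b y) /P /Y /=.
  have cE c : cond_prob (pair_lab l) (y, c) one = Pr [set s : T | pair_lab l (pos s) = (y, c)].
    by congr (Pr _); apply/seteqP; split=> s /=; rewrite (one_mul_pos s).
  rewrite -!cE -/(a y) -/(b y).
  by case: (leP (b y) (a y)) => h /=; rewrite ?addr0 ?add0r ?le_min ?lexx ?andbT ?(ltW h) ?h.
have sub : symdiff [set s | A (pos s)] [set s | B (bnd0 (pos s))] `<=`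
    ~` conv_paths `|` [set s | P (pair_lab l (pos s))].
  move=> s hs; have [cs|ncs] := pselect (conv_paths s); [right|by left].
  rewrite /P /pair_lab /= (hF _ cs) /set_lab; move: hs; rewrite /symdiff /B /setD /=.
  have bx : bp (bnd0 (pos s)) by exact: bnd0_bpoint.
  rewrite mem_filter mem_enum andbT.
  case: asboolP => hAs; case: (Y _) => //= -[[h1 h2]|[h1 h2]] //.
  - by case: h2.
  - by case: h1.
apply: le_trans PP; apply: (@le_trans _ _ (Pr (~` conv_paths `|` [set s | P (pair_lab l (pos s))]))).
  by apply: Pr_le => //; [exact: measurable_symdiff|apply: measurableU => //; exact: measurableC].
by apply: le_trans (PrU_le Q (measurableC mC) mP) _; rewrite conv_paths_full add0r.
Qed.

(** Borel-Cantelli: the upper limit of approximations with summable errors agrees with the event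
    almost surely. *)
Theorem borel_exact : exists2 B, borel B &
  Q.-negligible (symdiff [set s | A (pos s)] [set s | B (bnd0 (pos s))]).
Proof.
have h (k : nat) : exists B, borel B /\
    Pr (symdiff [set s | A (pos s)] [set s | B (bnd0 (pos s))]) <= 1 / (2 ^ k.+1)%:R.
  have e0 : 0 < 1 / (2 ^ k.+1)%:R :> R by rewrite divr_gt0 // ltr0n expn_gt0.
  by have [B bB hB] := borel_approx e0; exists B.
have /choice[B hB] := h.
pose S n := \bigcup_k B (n + k)%N.
have bS n : borel (S n) by apply: borel_bigcup => k; exact: (hB _).1.
pose Bl := bp `\` \bigcup_n (bp `\` S n).
exists Bl; first by apply: borelC; apply: borel_bigcup => n; exact: borelC.
have BlE xi : Bl xi <-> bp xi /\ forall n, S n xi.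
  split=> -[bx hx]; split=> //; last by move=> [n _ [_]]; apply.
  by move=> n; apply: contrapT => nS; apply: hx; exists n.
pose F k := symdiff [set s | A (pos s)] [set s | B k (bnd0 (pos s))].
have mF k : measurable (F k).
  apply: measurable_symdiff; first exact: measurable_on_paths.
  exact: (measurable_on_paths (measurable_bnd0 (hB k).1)).
have Q0 : Q (lim_sup_set F) = 0%E.
  apply: lim_sup_set_cvg0 => //.
  apply: (@le_lt_trans _ _ (\sum_(n <oo) (1 / (2 ^ n.+1)%:R)%:E)%E).
    apply: lee_nneseries => [k _ _|k _]; first exact: measure_ge0.
    have := (hB k).2; rewrite -/(F k) -lee_fin; apply: le_trans.
    by rewrite -(PrE Q (mF k)).
  by apply: le_lt_trans (epsilon_trick0 xpredT ler01) _; rewrite ltry.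
have mC := @measurable_conv_paths.
have N1 : Q.-negligible (lim_sup_set F).
  apply/negligibleP => //; apply: bigcap_measurable => // n _.
  by apply: bigcup_measurable => k _; exact: mF.
have N2 : Q.-negligible (~` conv_paths).
  apply/(negligibleP Q (measurableC mC)); apply: etrans (PrE Q (measurableC mC)) _.
  by rewrite conv_paths_full.
apply: negligibleS (negligibleU N1 N2) => s hs.
have [cs|ncs] := pselect (conv_paths s); [left|by right].
have bx : bp (bnd0 (pos s)) by exact: bnd0_bpoint.
move=> n _; case: hs => -[/= h1 h2].
  have [n' hn'] : exists n', ~ S n' (bnd0 (pos s)).
    by apply: contrapT => /forallNP hn; apply: h2; apply/BlE; split=> // m; exact: contrapT.
  exists (maxn n n'); first exact: leq_maxl.
  left; split=> // hb; apply: hn'; exists (maxn n n' - n')%N => //.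
  by rewrite subnKC // leq_maxr.
have [_ /(_ n)[k _ hk]] := (BlE _).1 h1.
by exists (n + k)%N; [exact: leq_addr|right].
Qed.

End Pair.
End Walk.

(** * Transfer to the canonical space of increments *)

Section Law.
Variables (R : realType) (G : countType) (one : G) (mu : G -> R).
Context (dO : measure_display) (Omega : measurableType dO) (P : probability Omega R).
Variables (incr : nat -> Omega -> G) (hiid : iid_law P mu incr).

Definition increments (om : Omega) : incs one := fun i => incr i om.

Lemma measurable_increments : measurable_fun setT increments.
Proof.
apply: (measurability (@path_cylinders G : set (set (incs one)))) => // _ [_ [i [a ->]] <-].
by rewrite setTI; exact: hiid.1.
Qed.

HB.instance Definition _ := isMeasurableFun.Build _ _ _ _ increments measurable_increments.

Definition path_law : probability (incs one) R := distribution P increments.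

Lemma path_law_iid : iid_law path_law mu (fun i (s : incs one) => s i).
Proof.
split=> [i a|n a]; first exact: measurable_coord.
by rewrite -(hiid.2 n a).
Qed.

End Law.

Theorem theorem1p2
  (R : realType)
  (* the countable group G *)
  (G : countType) (mul : G -> G -> G) (one : G) (inv : G -> G)
  (HG : is_group mul one inv)
  (* the geodesic hyperbolic metric space X *)
  (X : Type) (d : X -> X -> R)
  (Hmetric : is_metric d) (Hgeod : geodesic_space d) (Hhyp : hyperbolic d)
  (* base point, also used to define the Gromov boundary *)
  (o : X)
  (* the isometric action *)
  (act : G -> X -> X) (Hact : isom_action mul one d act)
  (Hnonel : non_elementary mul one d o act)
  (HWPD : exists g : G, WPD mul one d act g)
  (* the step distribution mu *)
  (mu : G -> R) (Hmu : prob_on mu) (Hgen : generating mul one mu)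
  (Hent : finite_entropy mu)
  (* the random walk w_n = g_1 ... g_n on a probability space *)
  (dO : measure_display) (Omega : measurableType dO) (P : probability Omega R)
  (incr : nat -> Omega -> G) (Hiid : iid_law P mu incr) :
  let w := walk mul one incr in
  exists bnd : Omega -> set (nat -> X),
    (* almost surely w_n o converges to the boundary point bnd *)
    (exists N : set Omega, measurable N /\ P N = 0%E /\
       forall om, ~ N om ->
         bpoint d o (bnd om) /\ bnd om (fun n => act (w n om) o)) /\
    (* bnd is measurable for the Borel structure of the boundary *)
    (forall B, bborel d o B -> measurable (bnd @^-1` B)) /\
    (* the sigma-algebra generated by bnd coincides, modulo P-null sets,
       with the sigma-algebra of shift-tail invariant events of the sample
       path: (boundary, nu) is the Poisson boundary *)
    (forall A : set (nat -> G), path_measurable A -> shift_tail_invariant A ->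
       exists B, bborel d o B /\
         ae_eq_set P [set om | A (fun n => w n om)] (bnd @^-1` B)) /\
    (forall B, bborel d o B ->
       exists A : set (nat -> G), path_measurable A /\ shift_tail_invariant A /\
         ae_eq_set P [set om | A (fun n => w n om)] (bnd @^-1` B)).
Proof.
move=> w; have [dl [dl0 hyp]] := Hhyp.
pose S := HypAction HG Hmetric dl0 hyp o Hact.
pose W := @RWalk R S mu Hmu Hgen Hent Hnonel HWPD (path_law one Hiid) (path_law_iid one Hiid).
pose I : Omega -> incs one := increments one incr.
have mI (A : set (incs one)) : measurable A -> measurable (I @^-1` A).
  by move=> mA; have := measurable_increments (one := one) Hiid measurableT mA; rewrite setTI.
have wE om : (fun n => w n om) = @pos R W (I om).
  apply/funext; elim=> [//|n IH]; rewrite posS -IH //.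
(* Where the orbit does not converge this is the empty set, which is not a boundary point and so
   belongs to no Borel set. *)
pose bnd om := @bnd0 R W (fun n => w n om).
have mbnd B : bborel d o B -> measurable (bnd @^-1` B).
  move=> bB; rewrite (_ : bnd @^-1` B = I @^-1` [set s | B (@bnd0 R W (@pos R W s))]).
    apply: mI; exact: (measurable_on_paths (W := W) (measurable_bnd0 (W := W) bB)).
  by apply/seteqP; split=> om; rewrite /bnd /= wE.
exists bnd; split; [|split; [exact: mbnd|split]].
- pose C : set (incs one) := @conv_paths R W.
  have mC : measurable C := @measurable_conv_paths R W.
  exists (I @^-1` (~` C)); split; first by apply: mI; exact: measurableC.
  split.
    have := @conv_paths_full R W; rewrite /Pr => h.
    have := PrE (Q_of W) (measurableC mC); rewrite /Pr h; exact.
  move=> om /contrapT cC; rewrite /bnd wE; split; first exact: (bnd0_bpoint (W := W)).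
  rewrite (_ : (fun n => act (w n om) o) = @orb R W (@pos R W (I om))); last by rewrite -wE.
  exact: (@bclass_refl R X d o _ cC).
- move=> A mA hA; have [B bB hB] := @borel_exact R W A mA hA.
  exists B; split=> //; have [N [mN N0 hN]] := hB.
  exists (I @^-1` N); split; first exact: mI.
  split; first exact: N0.
  by move=> om hom; apply: hN; rewrite /bnd in hom; move: hom; rewrite /symdiff /setD /= wE.
(* The limit point is itself an invariant function of the path, so the two events are equal and the
   exceptional set is empty. *)
move=> B bB; exists [set x | B (@bnd0 R W x)]; split; first exact: (measurable_bnd0 (W := W)).
split; first by move=> x y /(bnd0_shift_tail (W := W)) /= ->.
exists set0; split; first exact: measurable0.
split; first exact: measure0.
by move=> om [[]|[]].
Qed.
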